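(* Fix $\ell,\gamma,\mu>0$, a smooth pressure potential $P$ and constants $0<\underline\rho<\overline\rho$, $\tilde v>0$, $\underline C_{P''}>0$ such that the convexity and subsonicity assumptions (see context) hold. Then for every sufficiently small $\delta>0$ there exist thresholds $\overline v^*,C_t^*>0$ such that for all $0<\overline v\le\overline v^*$, $0<C_t\le C_t^*$ the following holds. Let $\hat u=(\hat\rho,\hat v)$ be a reference solution with data $\hat s_1,\hat s_2,\hat\eta$ satisfying the regularity/uniform bounds assumption, the smallness assumption (with constants $\overline v,C_t$) and the data assumption. Then for every sufficiently small $\alpha>0$ there exist $\tau_0,h_0>0$, dissipation constants $C_1=C_1(\alpha,\tau_0),C_2,C_3,C_4>0$, norm equivalence constants $c_0,C_0>0$ with $$C_1C_0^{-1}>(\alpha+\tau_0)\,C_2\,c_0^{-1},$$ and constants $\tilde C,C>0$ independent of $n,\tau,h$, such that for all $0<\tau\le\tau_0$, all $0<h\le h_0$, every solution $(\rho_h^n,m_h^n)_{n\ge0}$ of the discrete observer scheme satisfying the discrete bounds assumption, and every $n\in\mathbb N$, $$\tfrac12c_0\|u_h^n-\hat u^n\|_2^2\le 2C_0\Big(\prod_{j=1}^n w_j^{-1}\Big)\|u_h^0-\hat u_h^0\|_2^2+\tilde C(\tau^2+h^2)+\mu^2C\,\|\hat\eta\|^2_{L^\infty(0,\infty;L^2(\Omega))},$$ where $\hat u^n=\hat u(t^n,\cdot)$ and $$w_j=\frac{2+\tau C_1C_0^{-1}}{2+\tau(\alpha+\tau_0)C_2c_0^{-1}}.$$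
   Context: **Notation.** $\Omega=[0,\ell]$; $\langle\cdot,\cdot\rangle$ is the $L^2(\Omega)$ inner product, $\|\cdot\|_p$ the $L^p(\Omega)$ norm, $\|(a,b)\|_2^2=\|a\|_2^2+\|b\|_2^2$. Enthalpy: $\mathfrak h(\rho,v)=\frac12v^2+P'(\rho)$, with $P:(0,\infty)\to\mathbb R$ smooth ($h$ without Fraktur is the mesh size). **Reference solution.** $\hat u=(\hat\rho,\hat v)$ solves on $\Omega\times[0,\infty)$ $$\partial_t\hat\rho+\partial_x(\hat\rho\hat v)=\hat s_1,\qquad \partial_t\hat v+\partial_x\mathfrak h(\hat\rho,\hat v)+\gamma|\hat v|\hat v=\hat s_2.$$ Put $\hat m=\hat\rho\hat v$, $\hat{\mathfrak h}=\mathfrak h(\hat\rho,\hat v)$; the boundary data are $\hat m_\partial(t)=\hat m(t,0)$ and $\hat{\mathfrak h}_\partial(t)=\hat{\mathfrak h}(t,\ell)$. A superscript $n$ denotes evaluation at $t^n=n\tau$. $\hat\eta$ is the measurement error of the velocity. **Continuous observer.** $(\rho,v)$ denotes a solution of $\partial_t\rho+\partial_x(\rho v)=\hat s_1$, $\partial_tv+\partial_x\mathfrak h(\rho,v)+\gamma|v|v=\hat s_2-\mu(v-\hat v)+\mu\hat\eta$ with the same boundary data. **Discretization.** $h=\ell/M$, $M\in\mathbb N$, $x_i=ih$; $\tau>0$ is the time step. $Q_h$: functions constant on each cell $(x_i,x_{i+1})$. $R_h$: continuous piecewise linear functions $r$ on the grid with $r(0)=0$. $\Pi_h$ is the $L^2$-projection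 onto $Q_h$, $I_h$ the piecewise linear nodal interpolation. $\bar\partial_\tau a^n=(a^n-a^{n-1})/\tau$. **Discrete observer scheme.** Given $\rho_h^0\in Q_h$ and $m_h^0$ with $m_h^0-\hat m_\partial(t^0)\in R_h$, for each $n\ge1$: $\rho_h^n\in Q_h$, $m_h^n-\hat m_\partial(t^n)\in R_h$, and with $v_h^n=m_h^n/\rho_h^n$, $\mathfrak h_h^n=\mathfrak h(\rho_h^n,v_h^n)$, $\hat v_h^n=I_h\hat v^n$, $\hat\eta_h^n=I_h\hat\eta^n$, $$\langle\bar\partial_\tau\rho_h^n,q\rangle+\langle\partial_xm_h^n,q\rangle=\langle\Pi_h\hat s_1^n,q\rangle\quad\forall q\in Q_h,$$ $$\langle\bar\partial_\tau v_h^n,r\rangle-\langle\mathfrak h_h^n,\partial_xr\rangle+\hat{\mathfrak h}_\partial(t^n)r(\ell)+\gamma\langle|v_h^n|v_h^n,r\rangle+\mu\langle v_h^n-(\hat v_h^n+\hat\eta_h^n),r\rangle=\langle\hat s_2^n,r\rangle\quad\forall r\in R_h.$$ $u_h^n=(\rho_h^n,v_h^n)$. **Projected reference state.** $\hat\rho_h^n=\Pi_h\hat\rho^n$, $\hat m_h^n=I_h\hat m^n$, $\hat u_h^n=(\hat\rho_h^n,\hat m_h^n/\hat\rho_h^n)$, $\hat{\mathfrak h}_h^n=\mathfrak h(\hat\rho_h^n,\hat m_h^n/\hat\rho_h^n)$. **Assumptions.** - Regularity/uniform bounds: $\hat\rho,\hat v\in W^{2,\infty}([0,\infty);W^{1,1}(\Omega))\cap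 W^{1,\infty}([0,\infty);W^{1,\infty}(\Omega))$, $\underline\rho\le\hat\rho\le\overline\rho$ and $|\hat v|\le\tilde v$ pointwise. - Convexity: $P''(\rho)\ge\underline C_{P''}$ for $\rho\in[\underline\rho,\overline\rho]$. - Subsonicity: $\rho P''(\rho)\ge4\tilde v^2$ for $\rho\in[\underline\rho,\overline\rho]$. - Smallness: $\|\partial_t\hat\rho\|_{L^\infty(0,\infty;L^\infty(\Omega))}+\|\partial_t\hat v\|_{L^\infty(0,\infty;L^\infty(\Omega))}\le C_t$; $\hat v$ and the velocity $v$ of the continuous observer are bounded in absolute value by $\overline v$. - Data: $\hat s_1,\hat s_2\in W^{1,\infty}([0,\infty);W^{1,2}(\Omega))$, $\hat\eta$ is continuous and bounded on $[0,\infty)\times\Omega$. - Discrete bounds: $\underline\rho\le\rho_h^n(x)\le\overline\rho$ and $|v_h^n(x)|\le\overline v$ for all $n\ge0$, $x\in\Omega$. **Modified relative energy.** $\mathcal H(\rho,v)=\int_0^\ell\frac12\rho v^2+P(\rho)\,dx$, $\mathcal H(u,w)=\mathcal H(u)-\mathcal H(w)-\langle\mathcal H'(w),u-w\rangle$ with $\mathcal H'(\rho,v)=(\mathfrak h(\rho,v),\rho v)$. $M_h^n(x)=-\int_0^x\rho_h^n$, $\hat M_h^n(x)=-\int_0^x\hat\rho_h^n$, and $\mathcal G_h(u_h^n,\hat u_h^n)=\langle M_h^n-\hat M_h^n,\,v_h^n-\hat m_h^n/\hat\rho_h^n\rangle$. ''Norm equivalence constants'' are $c_0,C_0>0$, independent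 of $n,\tau,h$, with $c_0\|u_h^n-\hat u_h^n\|_2^2\le\mathcal H(u_h^n,\hat u_h^n)+\delta\mathcal G_h(u_h^n,\hat u_h^n)\le C_0\|u_h^n-\hat u_h^n\|_2^2$ for all $0<\tau\le\tau_0$, $0<h\le h_0$, all such discrete solutions and all $n\ge0$. **Dissipation constants.** $C_1,\dots,C_4>0$, independent of $n,\tau,h$, such that for all $0<\tau\le\tau_0$, $0<h\le h_0$, all such discrete solutions and all $n\ge1$ $$\bar\partial_\tau\big(\mathcal H(u_h^n,\hat u_h^n)+\delta\mathcal G_h(u_h^n,\hat u_h^n)\big)\le-C_1\|u_h^n-\hat u_h^n\|_2^2+(\alpha+\tau_0)C_2\|u_h^{n-1}-\hat u_h^{n-1}\|_2^2-\tfrac12\mathcal D(u_h^n,\hat u_h^n)+(1+\tfrac1\alpha)(\tau^2+h^2)C_3+\tfrac{\mu^2C_4}{\alpha}\|\hat\eta\|^2_{L^\infty(0,\infty;L^2(\Omega))}+\bar\partial_\tau\langle\hat{\mathfrak h}^n-\hat{\mathfrak h}_h^n,\rho_h^n-\hat\rho_h^n\rangle,$$ where $\mathcal D(u_h^n,\hat u_h^n)=\frac14\gamma\langle\hat\rho_h^n(v_h^n-\tfrac{\hat m_h^n}{\hat\rho_h^n}),(v_h^n-\tfrac{\hat m_h^n}{\hat\rho_h^n})(|v_h^n|+|\tfrac{\hat m_h^n}{\hat\rho_h^n}|)\rangle$. *)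

(* Defs.v *)
From HB Require Import structures.
From mathcomp Require Import all_boot all_order all_algebra.
From mathcomp Require Import all_classical all_reals all_analysis.
From mathcomp Require Import measurable_realfun ess_sup_inf lra.

Set Implicit Arguments.
Unset Strict Implicit.
Unset Printing Implicit Defensive.

Import Order.TTheory GRing.Theory Num.Theory.
Import numFieldNormedType.Exports.

Local Open Scope classical_set_scope.
Local Open Scope ring_scope.

(* Functions of (t, x) are curried maps R -> R -> R, time first; only their
   values on [0, +oo[ x [0, ell] are ever used. *)

Record param (R : realType) := Param {
  ell : R;
  gam : R;
  muo : R;         (* observer gain mu *)
  pot : R -> R;    (* pressure potential P, relevant on (0, +oo) only *)
  rho_lo : R;
  rho_hi : R;
  vtilde : R;
  cP : R           (* lower bound of P'' on [rho_lo, rho_hi] *)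
}.

Record refdata (R : realType) := RefData {
  rhat : R -> R -> R;
  vhat : R -> R -> R;
  src1 : R -> R -> R;
  src2 : R -> R -> R;
  noise : R -> R -> R   (* measurement error of the velocity *)
}.

Definition smooth_pos (R : realType) (f : R -> R) : Prop :=
  forall (n : nat) (x : R), 0 < x -> derivable (derive1n n f) x 1.

Definition valid_param (R : realType) (p : param R) : Prop :=
  [/\ [/\ 0 < ell p, 0 < gam p & 0 < muo p],
      smooth_pos (pot p),
      [/\ 0 < rho_lo p, rho_lo p < rho_hi p, 0 < vtilde p & 0 < cP p],
      forall r, rho_lo p <= r <= rho_hi p -> cP p <= derive1n 2 (pot p) r
    & forall r, rho_lo p <= r <= rho_hi p ->
        4 * vtilde p ^+ 2 <= r * derive1n 2 (pot p) r].

Definition enthalpy (R : realType) (P : R -> R) (rho v : R) : R :=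
  2^-1 * v ^+ 2 + derive1 P rho.

Definition Omega (R : realType) (l : R) : set R := `[0, l].

Definition cylinder (R : realType) (l : R) : set (R * R) :=
  [set z | 0 <= z.1 /\ Omega l z.2].

Definition mOmega (R : realType) (l : R) : measurable (Omega l) :=
  @measurable_itv R `[0, l].

Definition mTime (R : realType) : measurable (`[0, +oo[ : set R) :=
  @measurable_itv R `[0, +oo[.

Definition muOmega (R : realType) (l : R) :
    {measure set (measurableTypeR R) -> \bar R} :=
  mrestr lebesgue_measure (mOmega l).

Definition muTime (R : realType) :
    {measure set (measurableTypeR R) -> \bar R} :=
  mrestr lebesgue_measure (@mTime R).

Definition LinfLp_norm (R : realType) (l : R) (q : \bar R) (g : R -> R -> R)
    : \bar R :=
  ess_sup (@muTime R) (fun t => 'N[muOmega l]_q[EFin \o g t])%E.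

(* Joint measurability is used in place of strong measurability into
   L^q(Omega); for q = +oo this gives the larger space
   L^oo((0, +oo) x Omega). *)
Definition LinfLp (R : realType) (l : R) (q : \bar R) (g : R -> R -> R)
    : Prop :=
  measurable_fun (cylinder l) (fun z : R * R => g z.1 z.2) /\
  (LinfLp_norm l q g < +oo)%E.

(* Weak derivatives are expressed through the fundamental theorem of calculus:
   g is the weak time (resp. space) derivative of the continuous
   representative f. *)
Definition time_primitive (R : realType) (l : R) (f g : R -> R -> R) : Prop :=
  forall t x, 0 <= t -> Omega l x ->
    f t x = f 0 x + \int[lebesgue_measure]_(s in `[0, t]) g s x.

Definition space_primitive (R : realType) (l : R) (f g : R -> R -> R) : Prop :=
  forall t x, 0 <= t -> Omega l x ->
    f t x = f t 0 + \int[lebesgue_measure]_(y in `[0, x]) g t y.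

(* f belongs to W^{k,oo}([0,+oo); W^{1,q}(Omega)), with f the continuous
   representative: D i and E i are versions of the derivatives d_t^i f and
   d_x d_t^i f.  The identity d_t (E i) = E i.+1 follows from the others. *)
Definition Wkinf_W1 (R : realType) (l : R) (k : nat) (q : \bar R)
    (f : R -> R -> R) : Prop :=
  exists D E : nat -> R -> R -> R,
    [/\ D 0%N = f,
        forall i, (i <= k)%N -> LinfLp l q (D i) /\ LinfLp l q (E i),
        forall i, (i <= k)%N -> space_primitive l (D i) (E i)
      & forall i, (i < k)%N -> time_primitive l (D i) (D i.+1)].

Definition Linf_loc (R : realType) (l : R) (g : R -> R -> R) : Prop :=
  measurable_fun (cylinder l) (fun z : R * R => g z.1 z.2) /\
  forall T : R, exists B : R, forall t x,
    0 <= t <= T -> Omega l x -> `|g t x| <= B.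

(* Strong solutions: the derivatives occurring in
     d_t rho + d_x (rho v) = f1,
     d_t v + d_x h(rho, v) + gam |v| v = f2
   exist as locally bounded functions and the equations hold a.e. *)
Definition solves (R : realType) (p : param R) (f1 f2 rho v : R -> R -> R)
    : Prop :=
  (forall t x, 0 <= t -> Omega (ell p) x -> 0 < rho t x) /\
  exists rho_t m_x v_t h_x : R -> R -> R,
    [/\ [/\ Linf_loc (ell p) rho_t, Linf_loc (ell p) m_x,
            Linf_loc (ell p) v_t & Linf_loc (ell p) h_x],
        time_primitive (ell p) rho rho_t /\ time_primitive (ell p) v v_t,
        space_primitive (ell p) (fun t x => rho t x * v t x) m_x,
        space_primitive (ell p) (fun t x => enthalpy (pot p) (rho t x) (v t x)) h_x
      & {ae (lebesgue_measure \x lebesgue_measure)%E, forall z : R * R,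
          cylinder (ell p) z ->
          rho_t z.1 z.2 + m_x z.1 z.2 = f1 z.1 z.2 /\
          v_t z.1 z.2 + h_x z.1 z.2
            + gam p * `|v z.1 z.2| * v z.1 z.2 = f2 z.1 z.2}].

Section Reference.
Context (R : realType) (p : param R) (d : refdata R).

Local Notation l := (ell p).

Definition mhat (t x : R) : R := rhat d t x * vhat d t x.
Definition hhat (t x : R) : R := enthalpy (pot p) (rhat d t x) (vhat d t x).

Definition reference_solution : Prop := solves p (src1 d) (src2 d) (rhat d) (vhat d).

Definition reference_regular : Prop :=
  [/\ Wkinf_W1 l 2 1%:E (rhat d) /\ Wkinf_W1 l 2 1%:E (vhat d),
      Wkinf_W1 l 1 +oo%E (rhat d) /\ Wkinf_W1 l 1 +oo%E (vhat d),
      forall t x, 0 <= t -> Omega l x -> rho_lo p <= rhat d t x <= rho_hi p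
    & forall t x, 0 <= t -> Omega l x -> `|vhat d t x| <= vtilde p].

Definition data_regular : Prop :=
  [/\ Wkinf_W1 l 1 2%:E (src1 d), Wkinf_W1 l 1 2%:E (src2 d),
      {within cylinder l, continuous (fun z : R * R => noise d z.1 z.2)}
    & exists B : R, forall t x, 0 <= t -> Omega l x -> `|noise d t x| <= B].

Definition observer_solution (rho v : R -> R -> R) : Prop :=
  [/\ solves p (src1 d)
        (fun t x => src2 d t x - muo p * (v t x - vhat d t x) + muo p * noise d t x)
        rho v,
      forall t, 0 <= t -> rho t 0 * v t 0 = mhat t 0
    & forall t, 0 <= t -> enthalpy (pot p) (rho t l) (v t l) = hhat t l].

Definition smallness (v : R -> R -> R) (vbar Ct : R) : Prop :=
  [/\ exists rho_t v_t : R -> R -> R,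
        [/\ LinfLp l +oo%E rho_t /\ LinfLp l +oo%E v_t,
            time_primitive l (rhat d) rho_t,
            time_primitive l (vhat d) v_t
          & (LinfLp_norm l +oo%E rho_t + LinfLp_norm l +oo%E v_t <= Ct%:E)%E],
      forall t x, 0 <= t -> Omega l x -> `|vhat d t x| <= vbar
    & forall t x, 0 <= t -> Omega l x -> `|v t x| <= vbar].

Definition noise_norm2 : R := fine (LinfLp_norm l 2%:E (noise d)) ^+ 2.

End Reference.

Definition inner (R : realType) (l : R) (f g : R -> R) : R :=
  \int[lebesgue_measure]_(x in Omega l) (f x * g x).

Section Grid.
Context (R : realType) (l : R) (M : nat).

Definition mesh : R := l / M%:R.
Definition node (i : nat) : R := i%:R * mesh.

Definition Qh (q : R -> R) : Prop :=
  forall i, (i < M)%N -> exists c, forall x, node i < x < node i.+1 -> q x = c.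

(* Agreement of the affine pieces at the nodes makes r continuous on Omega. *)
Definition Rh (r : R -> R) : Prop :=
  r 0 = 0 /\
  forall i, (i < M)%N -> exists a b, forall x,
    node i <= x <= node i.+1 -> r x = a + b * x.

Definition cell (x : R) : nat := minn (Num.truncn (x / mesh)) M.-1.

(* L^2-projection onto Qh, i.e. cell averages; see Pih_Qh and Pih_orth. *)
Definition Pih (f : R -> R) (x : R) : R :=
  mesh^-1 * \int[lebesgue_measure]_(y in `[node (cell x), node (cell x).+1]) f y.

Definition Ih (f : R -> R) (x : R) : R :=
  f (node (cell x)) +
  (x - node (cell x)) / mesh * (f (node (cell x).+1) - f (node (cell x))).

End Grid.

Local Lemma integrable_glue (dd : measure_display) (T : measurableType dd)
    (R : realType) (nu : {measure set T -> \bar R}) (A B : set T) (F : T -> R) :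
  measurable A -> measurable B -> [disjoint A & B] ->
  nu.-integrable A (EFin \o F) -> nu.-integrable B (EFin \o F) ->
  nu.-integrable (A `|` B) (EFin \o F).
Proof.
move=> mA mB AB /integrableP[mF1 iF1] /integrableP[mF2 iF2].
have mF := (measurable_funU _ mA mB).2 (conj mF1 mF2).
apply/integrableP; split => //; rewrite ge0_integral_setU//.
  by rewrite lte_add_pinfty.
exact: measurableT_comp mF.
Qed.

Section GridFacts.
Context (R : realType) (l : R) (M : nat) (l_gt0 : 0 < l) (M_gt0 : (0 < M)%N).

Local Notation lmu := (@lebesgue_measure R).
Local Notation nd := (node l M).

Lemma mesh_gt0 : 0 < mesh l M.
Proof. by rewrite /mesh divr_gt0// ltr0n. Qed.

Lemma nodeS i : nd i.+1 = nd i + mesh l M.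
Proof. by rewrite /node -natr1 mulrDl mul1r. Qed.

Lemma nodeB i : nd i.+1 - nd i = mesh l M.
Proof. by rewrite nodeS addrAC subrr add0r. Qed.

Lemma node_lt i : nd i < nd i.+1.
Proof. by rewrite nodeS ltrDl mesh_gt0. Qed.

Lemma node_ge0 i : 0 <= nd i.
Proof. by rewrite /node mulr_ge0// ltW// mesh_gt0. Qed.

Lemma node0 : nd 0 = 0.
Proof. by rewrite /node mul0r. Qed.

Lemma node_last : nd M = l.
Proof. by rewrite /node /mesh mulrCA divff ?mulr1// pnatr_eq0 -lt0n. Qed.

Lemma cellE i x : (i < M)%N -> nd i <= x < nd i.+1 -> cell l M x = i.
Proof.
move=> iM /andP[ix xi]; rewrite /cell (@truncn_def _ _ i).
  by apply/minn_idPl; rewrite -ltnS prednK.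
by rewrite ler_pdivlMr ?mesh_gt0// ltr_pdivrMr ?mesh_gt0// ix.
Qed.

Lemma Pih_Qh f : Qh l M (Pih l M f).
Proof.
move=> i iM; exists ((mesh l M)^-1 *
    \int[lmu]_(y in `[nd i, nd i.+1]) f y) => x /andP[ix xi].
by rewrite /Pih (@cellE i)// (ltW ix).
Qed.

Lemma Ih_node f i : (i <= M)%N -> Ih l M f (nd i) = f (nd i).
Proof.
rewrite leq_eqVlt => /predU1P[->|iM]; last first.
  by rewrite /Ih (@cellE i) ?lexx ?node_lt// subrr !mul0r addr0.
have -> : Ih l M f (nd M) = Ih l M f (nd M.-1.+1) by rewrite prednK.
rewrite /Ih; have -> : cell l M (nd M.-1.+1) = M.-1.
  rewrite /cell /node mulfK ?gt_eqF ?mesh_gt0// natrK.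
  by apply/minn_idPr; rewrite prednK ?leq_pred.
rewrite nodeB divff ?gt_eqF ?mesh_gt0// mul1r.
by rewrite prednK// addrC subrK.
Qed.

Lemma Ih_affine f i x : (i < M)%N -> nd i <= x <= nd i.+1 ->
  Ih l M f x = f (nd i) + (x - nd i) / mesh l M * (f (nd i.+1) - f (nd i)).
Proof.
move=> iM /andP[ix]; rewrite le_eqVlt => /predU1P[->|xi]; last first.
  by rewrite /Ih (@cellE i)// ix.
rewrite Ih_node// nodeB divff ?gt_eqF ?mesh_gt0//.
by rewrite mul1r addrC subrK.
Qed.

Lemma Ih_Rh f : Rh l M (fun x => Ih l M f x - f 0).
Proof.
split; first by have := Ih_node f (leq0n M); rewrite node0 => ->; rewrite subrr.
move=> i iM; pose b := (f (nd i.+1) - f (nd i)) / mesh l M.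
exists (f (nd i) - nd i * b - f 0), b => x xi.
rewrite (@Ih_affine _ i)//.
have -> : (x - nd i) / mesh l M * (f (nd i.+1) - f (nd i)) = (x - nd i) * b.
  by rewrite /b mulrAC mulrA.
by rewrite mulrBl; lra.
Qed.

Local Lemma Rintegral_glue (a b c : R) (F : R -> R) : a <= b -> b <= c ->
  lmu.-integrable `[a, c] (EFin \o F) ->
  \int[lmu]_(x in `[a, c]) F x =
  \int[lmu]_(x in `[a, b]) F x + \int[lmu]_(x in `]b, c]) F x.
Proof.
move=> ab bc iF; rewrite -(@Rintegral_itvB _ F (BLeft a) (BRight c) b)//.
by rewrite addrC subrK.
Qed.

Local Lemma integrable_itvr (a b : R) (F : R -> R) : a < b ->
  lmu.-integrable `]a, b[ (EFin \o F) -> lmu.-integrable `]a, b] (EFin \o F).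
Proof.
move=> ab iF.
have -> : [set` `]a, b]] = [set` `]a, b[] `|` [set b] by rewrite setUitv1.
apply: integrable_glue => //.
  by apply/disj_setPS => x [] /=; rewrite in_itv/= => /andP[_ +] xb;
    rewrite xb ltxx.
apply/integrableP; split; first exact: measurable_fun_set1.
by rewrite integral_set1.
Qed.

Local Lemma cell_aux (f q : R -> R) k : Qh l M q -> (k < M)%N ->
  lmu.-integrable `[nd k, nd k.+1] (EFin \o f) ->
  [/\ lmu.-integrable `]nd k, nd k.+1] (EFin \o (fun x => Pih l M f x * q x)),
      lmu.-integrable `]nd k, nd k.+1] (EFin \o (fun x => f x * q x))
    & \int[lmu]_(x in `]nd k, nd k.+1]) (Pih l M f x * q x) =
      \int[lmu]_(x in `]nd k, nd k.+1]) (f x * q x)].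
Proof.
move=> qQ kM fi; have [c qc] := qQ _ kM.
set I := \int[lmu]_(y in `[nd k, nd k.+1]) f y.
have fio : lmu.-integrable `]nd k, nd k.+1[ (EFin \o f).
  by apply: integrableS fi => //; apply: subset_itv; rewrite bnd_simp.
have PE : {in [set` `]nd k, nd k.+1[],
    (fun x => Pih l M f x * q x) =1 cst ((mesh l M)^-1 * I * c)}.
  move=> x; rewrite inE/= in_itv/= => xk; rewrite qc//.
  by rewrite /Pih (@cellE k)//; case/andP: xk => /ltW -> ->.
have FE : {in [set` `]nd k, nd k.+1[], (fun x => f x * q x) =1
    (fun x => f x * c)}.
  by move=> x; rewrite inE/= in_itv/= => xk; rewrite qc.
have i1 : lmu.-integrable `]nd k, nd k.+1[
    (EFin \o (fun x => Pih l M f x * q x)).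
  apply: (@eq_integrable _ _ _ lmu _ _ (cst ((mesh l M)^-1 * I * c)%:E)) => //.
    by move=> x xk /=; rewrite PE.
  apply/integrableP; split; first exact: measurable_cst.
  rewrite integral_cst//= lebesgue_measure_itv/= lte_fin node_lt.
  by rewrite -EFinB -EFinM ltry.
have i2' : lmu.-integrable `]nd k, nd k.+1[ (EFin \o (fun x => f x * c)).
  by apply: (@integrableZr _ _ _ lmu _ _ c (EFin \o f)).
have i2 : lmu.-integrable `]nd k, nd k.+1[ (EFin \o (fun x => f x * q x)).
  by apply: eq_integrable i2' => // x xk /=; rewrite FE.
split; [exact: integrable_itvr (node_lt k) i1|exact: integrable_itvr (node_lt k) i2|].
rewrite -Rintegral_itv_bndo_bndc// -[RHS]Rintegral_itv_bndo_bndc//.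
rewrite [LHS](@eq_Rintegral _ _ _ lmu _ (cst ((mesh l M)^-1 * I * c)))//.
rewrite [RHS](@eq_Rintegral _ _ _ lmu _ (fun x => f x * c))//.
have mE : fine (lmu `]nd k, nd k.+1[) = mesh l M.
  by rewrite lebesgue_measure_itv/= lte_fin node_lt -EFinB/= nodeB.
have IE : \int[lmu]_(x in `]nd k, nd k.+1[) f x = I.
  rewrite Rintegral_itv_bndo_bndc// Rintegral_itv_obnd_cbnd//.
  by apply: integrableS fi => //; apply: subset_itv; rewrite bnd_simp.
rewrite RintegralZr// Rintegral_cst// IE mE.
have := mesh_gt0; move: (mesh l M) => e e_gt0.
by rewrite [LHS]mulrC -!mulrA mulVKf ?gt_eqF.
Qed.

(* Pih f is the L^2-orthogonal projection of f onto Qh. *)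
Lemma Pih_orth f q : lmu.-integrable (Omega l) (EFin \o f) -> Qh l M q ->
  inner l (Pih l M f) q = inner l f q.
Proof.
move=> fi qQ; rewrite /inner /Omega.
suff: forall k, (k <= M)%N -> [/\
    lmu.-integrable `[0, nd k] (EFin \o (fun x => Pih l M f x * q x)),
    lmu.-integrable `[0, nd k] (EFin \o (fun x => f x * q x))
  & \int[lmu]_(x in `[0, nd k]) (Pih l M f x * q x) =
    \int[lmu]_(x in `[0, nd k]) (f x * q x)] by move=> /(_ M (leqnn M)); rewrite node_last => -[].
elim=> [_|k ih kM].
  rewrite node0 set_itv1 !Rintegral_set1; split => //;
  by apply/integrableP; split; [exact: measurable_fun_set1|rewrite integral_set1].
have [ih1 ih2 ih3] := ih (ltnW kM).
have le_nl : nd k.+1 <= l.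
  by rewrite -[leRHS]node_last /node ler_wpM2r ?ler_nat// ltW// mesh_gt0.
have [|c1 c2 c3] := cell_aux qQ kM (f := f).
  apply: integrableS fi => //; first exact: measurable_itv.
  move=> x; rewrite /Omega/= !in_itv/= => /andP[ax xb].
  by rewrite (le_trans (node_ge0 k) ax) (le_trans xb le_nl).
have kk : nd k <= nd k.+1 by rewrite ltW// node_lt.
have E : [set` `[0, nd k.+1]] = [set` `[0, nd k]] `|` [set` `]nd k, nd k.+1]].
  by rewrite -itv_bndbnd_setU// bnd_simp ?node_ge0.
have dj : [disjoint [set` `[0, nd k]] & [set` `]nd k, nd k.+1]]].
  apply/disj_setPS => x [] /=; rewrite !in_itv/= => /andP[_ xb] /andP[bx _].
  by move: (lt_le_trans bx xb); rewrite ltxx.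
have I1 : lmu.-integrable `[0, nd k.+1]
    (EFin \o (fun x => Pih l M f x * q x)).
  by rewrite E; apply: integrable_glue.
have I2 : lmu.-integrable `[0, nd k.+1] (EFin \o (fun x => f x * q x)).
  by rewrite E; apply: integrable_glue.
split => //.
rewrite (Rintegral_glue (node_ge0 k) kk I1) (Rintegral_glue (node_ge0 k) kk I2).
by rewrite ih3 c3.
Qed.

End GridFacts.

(* A state is a pair (density, velocity) of functions on Omega. *)
Definition state (R : realType) : Type := ((R -> R) * (R -> R))%type.

Definition dist2 (R : realType) (l : R) (u w : state R) : R :=
  inner l (u.1 \- w.1) (u.1 \- w.1) + inner l (u.2 \- w.2) (u.2 \- w.2).

Definition bdiff (R : realType) (tau : R) (a : nat -> R) (n : nat) : R :=
  (a n - a n.-1) / tau.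

Definition vel (R : realType) (rho m : R -> R) : R -> R :=
  fun x => m x / rho x.

Section Scheme.
Context (R : realType) (p : param R) (d : refdata R).
Context (M : nat) (tau : R) (rho m : nat -> R -> R).

Local Notation l := (ell p).
Local Notation t n := (n%:R * tau).

Definition vh (n : nat) : R -> R := vel (rho n) (m n).
Definition hh (n : nat) : R -> R := fun x => enthalpy (pot p) (rho n x) (vh n x).
Definition uh (n : nat) : state R := (rho n, vh n).

Definition mass_eq (n : nat) : Prop :=
  forall q, Qh l M q ->
    inner l (fun x => bdiff tau (rho^~ x) n) q + inner l (derive1 (m n)) q
    = inner l (Pih l M (src1 d (t n))) q.

Definition momentum_eq (n : nat) : Prop :=
  forall r, Rh l M r ->
    inner l (fun x => bdiff tau (vh^~ x) n) r
    - inner l (hh n) (derive1 r)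
    + hhat p d (t n) l * r l
    + gam p * inner l (fun x => `|vh n x| * vh n x) r
    + muo p * inner l (fun x => vh n x -
        (Ih l M (vhat d (t n)) x + Ih l M (noise d (t n)) x)) r
    = inner l (src2 d (t n)) r.

Definition scheme : Prop :=
  (forall n, Qh l M (rho n) /\ Rh l M (fun x => m n x - mhat d (t n) 0)) /\
  (forall n, (0 < n)%N -> mass_eq n /\ momentum_eq n).

(* Elements of Qh are only defined up to their values at the nodes. *)
Definition discrete_bounds (vbar : R) : Prop :=
  forall n i x, (i < M)%N -> node l M i < x < node l M i.+1 ->
    rho_lo p <= rho n x <= rho_hi p /\ `|vh n x| <= vbar.

End Scheme.

Section ProjectedReference.
Context (R : realType) (p : param R) (d : refdata R) (M : nat) (tau : R).

Local Notation l := (ell p).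
Local Notation t n := (n%:R * tau).

Definition uref (n : nat) : state R := (rhat d (t n), vhat d (t n)).

Definition uhat_h (n : nat) : state R :=
  (Pih l M (rhat d (t n)),
   vel (Pih l M (rhat d (t n))) (Ih l M (mhat d (t n)))).

Definition hhat_h (n : nat) : R -> R :=
  fun x => enthalpy (pot p) ((uhat_h n).1 x) ((uhat_h n).2 x).

End ProjectedReference.

Section Energy.
Context (R : realType) (p : param R).

Local Notation l := (ell p).

Definition energy (u : state R) : R :=
  \int[lebesgue_measure]_(x in Omega l)
    (2^-1 * u.1 x * u.2 x ^+ 2 + pot p (u.1 x)).

Definition relative_energy (u w : state R) : R :=
  energy u - energy w
  - (inner l (fun x => enthalpy (pot p) (w.1 x) (w.2 x)) (u.1 \- w.1)
     + inner l (w.1 \* w.2) (u.2 \- w.2)).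

Definition neg_mass (rho : R -> R) (x : R) : R :=
  - \int[lebesgue_measure]_(y in `[0, x]) rho y.

Definition Gh (u w : state R) : R :=
  inner l (neg_mass u.1 \- neg_mass w.1) (u.2 \- w.2).

Definition mod_energy (delta : R) (u w : state R) : R :=
  relative_energy u w + delta * Gh u w.

Definition dissipation (u w : state R) : R :=
  4^-1 * gam p *
  inner l (fun x => w.1 x * (u.2 x - w.2 x))
          (fun x => (u.2 x - w.2 x) * (`|u.2 x| + `|w.2 x|)).

End Energy.

Section Constants.
Context (R : realType) (p : param R) (d : refdata R).
Context (vbar tau0 h0 : R).

Local Notation l := (ell p).

Definition admissible (M : nat) (tau : R) (rho m : nat -> R -> R) : Prop :=
  [/\ (0 < M)%N, mesh l M <= h0, 0 < tau <= tau0,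
      scheme p d M tau rho m & discrete_bounds p M rho m vbar].

Definition norm_equivalence (delta c0 C0 : R) : Prop :=
  forall M tau rho m, admissible M tau rho m -> forall n,
    c0 * dist2 l (uh rho m n) (uhat_h p d M tau n)
      <= mod_energy p delta (uh rho m n) (uhat_h p d M tau n)
      <= C0 * dist2 l (uh rho m n) (uhat_h p d M tau n).

Definition dissipation_constants (delta alpha C1 C2 C3 C4 : R) : Prop :=
  forall M tau rho m, admissible M tau rho m -> forall n, (0 < n)%N ->
    let u := uh rho m in
    let w := uhat_h p d M tau in
    bdiff tau (fun k => mod_energy p delta (u k) (w k)) n
    <= - C1 * dist2 l (u n) (w n)
       + (alpha + tau0) * C2 * dist2 l (u n.-1) (w n.-1)
       - 2^-1 * dissipation p (u n) (w n)
       + (1 + alpha^-1) * (tau ^+ 2 + mesh l M ^+ 2) * C3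
       + muo p ^+ 2 * C4 / alpha * noise_norm2 p d
       + bdiff tau (fun k =>
           inner l (hhat p d (k%:R * tau) \- hhat_h p d M tau k)
                   ((u k).1 \- (w k).1)) n.

End Constants.

Definition decay_factor (R : realType) (tau tau0 alpha C1 C2 c0 C0 : R) : R :=
  (2 + tau * (C1 * C0^-1)) / (2 + tau * ((alpha + tau0) * C2 * c0^-1)).

(* Main.v *)
(* The discrete solution is compared with the projected reference state by the relative
   energy, to which delta times the pairing of the velocity error with the antiderivative of
   the density error is added.  Testing the momentum balance with the mass flux error damps
   the velocity error through the observer gain mu; testing it with the
   antiderivative turns the pressure difference into damping of the density error, by convexity
   of P.  For small velocities all remaining terms are absorbed, while the consistency errors
   of the projections are O(tau + h); this is first order because the reference solution is
   Lipschitz in time and space together with the mixed difference quotients of rho, v and h.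
   The consistency error of the enthalpy is kept as a discrete time derivative, since its
   increment is O(tau h).  Discrete Gronwall for the energy minus this term gives the decay
   factor w, half of the dissipation being spent on the correction. *)
Require Import Defs.
From mathcomp Require Import all_boot all_order all_algebra.
From mathcomp Require Import all_classical all_reals all_analysis.
From mathcomp Require Import measurable_realfun ess_sup_inf ring lra.

Set Implicit Arguments.
Unset Strict Implicit.
Unset Printing Implicit Defensive.

Import Order.TTheory GRing.Theory Num.Theory.
Import numFieldNormedType.Exports.

Local Open Scope classical_set_scope.
Local Open Scope ring_scope.

(** * Bounded measurable functions on an interval *)

(** The density and velocity errors jump at the nodes and are no admissible test functions; the
    momentum error and the antiderivative of the density error lie in [Rh]. With the former, the
    pressure pairs with the derivative of the momentum error, which the mass balance converts into
    the increment of the density error, as the discrete chain rule for the relative energy requires.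

    Convexity and the implicit step leave minus the squared increments of the errors. They pay for
    the product of increments created by the [delta] term, hence one of the bounds on [delta]. The
    motion of the reference state costs old error times [Ct], so [Ct] must be small against the
    damping. The chain rule also evaluates [pot] slightly outside [[rho_lo, rho_hi]], hence the
    margin [kap] and [tau0 = kap / Ct].

    Slopes of test functions are not controlled as [h] tends to 0. Residuals must therefore be
    bounded by the L1 norm of the test function alone, which is why time increments of the enthalpy
    must be Lipschitz in space. *)

Definition bmeas (R : realType) (a b : R) (f : R -> R) : Prop :=
  measurable_fun `[a, b] f /\
  exists B, {ae lebesgue_measure, forall x, `[a, b]%classic x -> `|f x| <= B}.

Notation intg a b f := (Rintegral lebesgue_measure `[a, b] f).

Section BoundedMeasurable.
Context {R : realType}.
Implicit Types (a b c : R) (f g : R -> R).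
Local Notation lmu := (@lebesgue_measure R).

Lemma aeS (P Q : R -> Prop) : (forall x, P x -> Q x) ->
  {ae lmu, forall x, P x} -> {ae lmu, forall x, Q x}.
Proof. exact: (@filterS _ _ (ae_filter_ringOfSetsType lmu)). Qed.

Lemma aeS2 (P Q S : R -> Prop) : (forall x, P x -> Q x -> S x) ->
  {ae lmu, forall x, P x} -> {ae lmu, forall x, Q x} -> {ae lmu, forall x, S x}.
Proof. exact: (@filterS2 _ _ (ae_filter_ringOfSetsType lmu)). Qed.

(** A bound outside a null set is what an essential supremum supplies for weak derivatives, so
    [bmeas] asks for no more; on a bounded interval it already gives integrability. The class is
    closed under the algebraic operations, which makes the later integrals linear and monotone
    without separate integrability proofs. *)
Lemma bm_integrable a b f : bmeas a b f -> lmu.-integrable `[a, b] (EFin \o f).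
Proof.
move=> [mf [B fB]]; apply/integrableP; split; first exact/measurable_EFinP.
have B0 : (0 <= `|B|%:E :> \bar R)%E by rewrite lee_fin.
apply: (@le_lt_trans _ _ (\int[lmu]_(x in `[a, b]) (cst `|B|%:E) x)%E).
  apply: ae_ge0_le_integral => //.
  - by apply/measurable_EFinP/measurableT_comp.
  - apply: aeS fB => x xB xI; rewrite /= lee_fin.
    by rewrite (le_trans (xB xI))// ler_norm.
rewrite integral_cst//= lebesgue_measure_itv/=; case: ifP => _.
  by rewrite -EFinB -EFinM ltry.
by rewrite mule0 ltry.
Qed.

Lemma bm_ae a b f B : measurable_fun `[a, b] f ->
  (forall x, a <= x <= b -> `|f x| <= B) -> bmeas a b f.
Proof.
move=> mf fB; split => //; exists B; apply: aeW => x /=.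
by rewrite in_itv/=; exact: fB.
Qed.

Lemma bm_cst a b c : bmeas a b (fun=> c).
Proof. by apply: (@bm_ae _ _ _ `|c|) => //; exact: measurable_cst. Qed.

Lemma bmD a b f g : bmeas a b f -> bmeas a b g ->
  bmeas a b (fun x => f x + g x).
Proof.
move=> [mf [B fB]] [mg [C gC]]; split; first exact: measurable_funD.
exists (B + C); apply: aeS2 fB gC => x fB gC xI.
by rewrite (le_trans (ler_normD _ _))// lerD ?fB ?gC.
Qed.

Lemma bmM a b f g : bmeas a b f -> bmeas a b g ->
  bmeas a b (fun x => f x * g x).
Proof.
move=> [mf [B fB]] [mg [C gC]]; split; first exact: measurable_funM.
exists (B * C); apply: aeS2 fB gC => x fB gC xI.
by rewrite normrM ler_pM ?fB ?gC.
Qed.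

Lemma bmN a b f : bmeas a b f -> bmeas a b (fun x => - f x).
Proof.
move=> [mf [B fB]]; split; first exact: measurableT_comp.
by exists B; apply: aeS fB => x fB xI; rewrite normrN fB.
Qed.

Lemma bmB a b f g : bmeas a b f -> bmeas a b g ->
  bmeas a b (fun x => f x - g x).
Proof. by move=> bf bg; apply: bmD => //; exact: bmN. Qed.

Lemma bmZ a b k f : bmeas a b f -> bmeas a b (fun x => k * f x).
Proof. by move=> bf; apply: bmM => //; exact: bm_cst. Qed.

Lemma bm_norm a b f : bmeas a b f -> bmeas a b (fun x => `|f x|).
Proof.
move=> [mf [B fB]]; split; first exact: measurableT_comp.
by exists B; apply: aeS fB => x fB xI; rewrite normr_id fB.
Qed.

Lemma bmX2 a b f : bmeas a b f -> bmeas a b (fun x => f x ^+ 2).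
Proof.
move=> bf; rewrite (_ : (fun x => _) = (fun x => f x * f x)); first exact: bmM.
by apply/funext => x; rewrite expr2.
Qed.

Lemma bm_sub a b a' b' f : a <= a' -> b' <= b -> bmeas a b f -> bmeas a' b' f.
Proof.
move=> aa bb [mf [B fB]].
have sub : [set` `[a', b']] `<=` [set` `[a, b]].
  by apply: subset_itv; rewrite bnd_simp.
split; first exact: measurable_funS mf.
by exists B; apply: aeS fB => x fB xI; apply/fB/sub.
Qed.

Lemma eq_intg a b f g : (forall x, a <= x <= b -> f x = g x) ->
  intg a b f = intg a b g.
Proof.
by move=> fg; apply: eq_Rintegral => x; rewrite inE/= in_itv/=; exact: fg.
Qed.

Lemma intgD a b f g : bmeas a b f -> bmeas a b g ->
  intg a b (fun x => f x + g x) = intg a b f + intg a b g.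
Proof. by move=> /bm_integrable ? /bm_integrable ?; rewrite RintegralD. Qed.

Lemma intgB a b f g : bmeas a b f -> bmeas a b g ->
  intg a b (fun x => f x - g x) = intg a b f - intg a b g.
Proof. by move=> /bm_integrable ? /bm_integrable ?; rewrite RintegralB. Qed.

Lemma intgZ a b k f : bmeas a b f ->
  intg a b (fun x => k * f x) = k * intg a b f.
Proof. by move=> /bm_integrable ?; rewrite RintegralZl. Qed.

Lemma intgN a b f : bmeas a b f ->
  intg a b (fun x => - f x) = - intg a b f.
Proof.
move=> bf; rewrite -mulN1r -intgZ//; apply: eq_intg => x _.
by rewrite mulN1r.
Qed.

Lemma intg_cst a b c : a <= b -> intg a b (fun=> c) = c * (b - a).
Proof.
move=> ab; have mE : fine (lmu `[a, b]) = b - a.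
  rewrite lebesgue_measure_itv/= lte_fin; case: ltP => ab'; first by rewrite -EFinB.
  by have -> : a = b; [apply/eqP; rewrite eq_le ab ab'|rewrite subrr].
by rewrite Rintegral_cst// mE.
Qed.

Lemma intg_ge0 a b f : bmeas a b f ->
  {ae lmu, forall x, `[a, b]%classic x -> 0 <= f x} -> 0 <= intg a b f.
Proof.
move=> bf f0; rewrite /Rintegral.
have -> : (\int[lmu]_(x in `[a, b]) (f x)%:E =
           \int[lmu]_(x in `[a, b]) (`|f x|%:E))%E; last first.
  by rewrite fine_ge0// integral_ge0.
apply: ae_eq_integral => //.
- by apply/measurable_EFinP; case: bf.
- by apply/measurable_EFinP/measurableT_comp => //; case: bf.
- by apply: aeS f0 => x f0 /f0 ?; rewrite ger0_norm.
Qed.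

Lemma le_intg_ae a b f g : bmeas a b f -> bmeas a b g ->
  {ae lmu, forall x, `[a, b]%classic x -> f x <= g x} ->
  intg a b f <= intg a b g.
Proof.
move=> bf bg fg; rewrite -subr_ge0 -intgB//; apply: intg_ge0; first exact: bmB.
by apply: aeS fg => x fg /fg; rewrite subr_ge0.
Qed.

Lemma le_intg a b f g : bmeas a b f -> bmeas a b g ->
  (forall x, a <= x <= b -> f x <= g x) -> intg a b f <= intg a b g.
Proof.
move=> bf bg fg; apply: le_intg_ae => //; apply: aeW => x /=.
by rewrite in_itv/=; exact: fg.
Qed.

Lemma eq_intg_ae a b f g : bmeas a b f -> bmeas a b g ->
  {ae lmu, forall x, `[a, b]%classic x -> f x = g x} ->
  intg a b f = intg a b g.
Proof.
move=> bf bg fg; apply/eqP; rewrite eq_le !le_intg_ae//;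
  by apply: aeS fg => x fg /fg ->.
Qed.

Lemma ler_norm_intg a b f : bmeas a b f ->
  `|intg a b f| <= intg a b (fun x => `|f x|).
Proof. by move=> /bm_integrable ?; exact: le_normr_Rintegral. Qed.

Lemma intg_bound a b f K : a <= b -> bmeas a b f ->
  {ae lmu, forall x, `[a, b]%classic x -> `|f x| <= K} ->
  `|intg a b f| <= K * (b - a).
Proof.
move=> ab bf fK; rewrite -intg_cst//; apply: le_trans (ler_norm_intg bf) _.
by apply: le_intg_ae => //; [exact: bm_norm|exact: bm_cst].
Qed.

Lemma intg_boundW a b f K : a <= b -> bmeas a b f ->
  (forall x, a <= x <= b -> `|f x| <= K) -> `|intg a b f| <= K * (b - a).
Proof.
move=> ab bf fK; apply: intg_bound => //; apply: aeW => x /=.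
by rewrite in_itv/=; exact: fK.
Qed.

Lemma intg_split a b c f : a <= c -> c <= b -> bmeas a b f ->
  intg a b f = intg a c f + intg c b f.
Proof.
move=> ac cb bf; have := @Rintegral_itvB _ f (BLeft a) (BRight b) c (bm_integrable bf).
rewrite !bnd_simp => /(_ ac cb).
rewrite Rintegral_itv_obnd_cbnd; last first.
  apply: integrableS (bm_integrable bf) => //.
  by apply: subset_itv; rewrite bnd_simp.
by move=> <-; rewrite addrC subrK.
Qed.

Lemma intg_xx a f : intg a a f = 0.
Proof. by rewrite set_itv1 Rintegral_set1. Qed.

Lemma bm_lip a b f L : (forall x y, a <= x <= b -> a <= y <= b ->
   `|f x - f y| <= L * `|x - y|) -> bmeas a b f.
Proof.
move=> fL; have [ab|ba] := leP a b; last first.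
  by rewrite /bmeas set_itv_ge ?bnd_simp -?ltNge//; split;
    [exact: measurable_fun_set0|exists 0; exact: aeW].
have L0 : 0 <= `|L| by [].
apply: (@bm_ae _ _ _ (`|f a| + `|L| * (b - a))).
  apply: subspace_continuous_measurable_fun => //.
  apply/subspace_continuousP => x /=; rewrite in_itv/= => xI.
  apply/cvgrPdist_le => e e0.
  have L1 : 0 < `|L| + 1 by rewrite ltr_wpDl.
  rewrite near_withinE; near=> y => yI0.
  have yI : a <= y <= b by move: yI0; rewrite /= in_itv.
  rewrite (le_trans (fL _ _ xI yI))//.
  rewrite (@le_trans _ _ ((`|L| + 1) * `|x - y|))//.
    by rewrite ler_wpM2r// (le_trans (ler_norm _))// lerDl.
  rewrite -ler_pdivlMl//; near: y.
  by apply: cvgr_dist_le => //; rewrite mulr_gt0// invr_gt0.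
move=> x /[dup] xI /andP[ax xb]; rewrite -lerBlDl.
rewrite (le_trans (lerB_dist _ _))// (le_trans (fL _ _ xI _)) ?lexx ?ab//.
rewrite (@le_trans _ _ (`|L| * `|x - a|))// ?ler_wpM2r ?ler_norm//.
by rewrite ler_wpM2l// ger0_norm ?subr_ge0// lerB.
Unshelve. all: by end_near. Qed.

End BoundedMeasurable.

(** * Increment estimates by subdivision *)

Section IncrementLemma.
Context {R : realType}.
Implicit Types (a b x y K : R).

(* Subdividing [a, b] into n equal parts makes the quadratic error K (b-a)^2/n. *)
Lemma increment_le (F G : R -> R) a b K : a <= b ->
  (forall x y, a <= y -> y <= x -> x <= b ->
     `|F x - F y| <= G x - G y + K * (x - y) ^+ 2) ->
  `|F b - F a| <= G b - G a.
Proof.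
move=> ab FG; apply/ler_addgt0Pr => e e0.
pose Q := `|K| * (b - a) ^+ 2.
have Q0 : 0 <= Q by rewrite mulr_ge0// sqr_ge0.
pose n := (Num.truncn (Q / e)).+1.
have nQ : Q / n%:R <= e.
  rewrite ler_pdivrMr ?ltr0n// mulrC -ler_pdivrMr//.
  by rewrite ltW// truncnS_gt// divr_ge0// ltW.
pose dl := (b - a) / n%:R.
have dl0 : 0 <= dl by rewrite divr_ge0// subr_ge0.
pose pt k := a + k%:R * dl.
have ptS k : pt k.+1 = pt k + dl by rewrite /pt -natr1 mulrDl mul1r addrA.
have ptn : pt n = b by rewrite /pt /dl mulrC divfK ?pnatr_eq0//; lra.
have pt_ge k : a <= pt k by rewrite lerDl mulr_ge0.
have pt_le k : (k <= n)%N -> pt k <= b.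
  by move=> kn; rewrite -ptn lerD2l ler_wpM2r// ler_nat.
have : forall k, (k <= n)%N ->
    `|F (pt k) - F a| <= G (pt k) - G a + k%:R * (`|K| * dl ^+ 2).
  elim=> [_|k ih kn]; first by rewrite /pt !mul0r !addr0 !subrr normr0.
  have := FG (pt k.+1) (pt k) (pt_ge k) _ (pt_le _ kn).
  rewrite {1}ptS lerDl => /(_ dl0) h.
  have -> : F (pt k.+1) - F a = (F (pt k.+1) - F (pt k)) + (F (pt k) - F a) by lra.
  rewrite (le_trans (ler_normD _ _))//.
  have hK : K * (pt k.+1 - pt k) ^+ 2 <= `|K| * dl ^+ 2.
    by rewrite ptS addrAC subrr add0r ler_wpM2r ?sqr_ge0// ler_norm.
  rewrite -natr1 mulrDl mul1r; have := ih (ltnW kn); move: h hK.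
  move: (F _ - _) (F _ - _) => u v; lra.
move=> /(_ n (leqnn n)); rewrite ptn => /le_trans; apply; rewrite lerD2l.
have -> : n%:R * (`|K| * dl ^+ 2) = Q / n%:R; last by [].
rewrite /Q /dl; field; rewrite pnatr_eq0//.
Qed.

End IncrementLemma.

(** * Gluing, antiderivatives and a Poincare inequality *)

Section Pieces.
Context {R : realType}.
Implicit Types (a b c : R) (f g : R -> R).
Local Notation lmu := (@lebesgue_measure R).

Lemma bm_glue a c b f : a <= c -> c <= b ->
  bmeas a c f -> bmeas c b f -> bmeas a b f.
Proof.
move=> ac cb [mf1 [B1 fB1]] [mf2 [B2 fB2]].
have E : [set` `[a, b]] = [set` `[a, c]] `|` [set` `[c, b]].
  apply/seteqP; split => x /=; rewrite !in_itv/=; last lra.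
  by case: (leP x c) => xc /andP[-> xb]; [left|right]; rewrite // xb ltW.
split; first by rewrite E; apply/measurable_funU.
exists (Num.max B1 B2); apply: aeS2 fB1 fB2 => x f1 f2.
by rewrite E le_max => -[/f1|/f2] ->; rewrite ?orbT.
Qed.

(** Elements of [Qh] and derivatives of piecewise affine functions are known inside a cell only. Two
    endpoint values, whatever they are, change neither measurability nor boundedness. *)
Lemma bm_open a b f g : bmeas a b g ->
  (forall x, a < x < b -> f x = g x) -> bmeas a b f.
Proof.
move=> [mg [B gB]] fg; have [ab|ba] := ltP a b; last first.
  apply: (@bm_lip _ _ _ _ 0) => x y xab yab.
  have -> : x = y by lra.
  by rewrite !subrr normr0 mulr0.
have E : [set` `[a, b]] = [set` `]a, b[] `|` ([set a] `|` [set b]).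
  apply/seteqP; split => x /=; rewrite !in_itv/=.
    move=> /andP[]; rewrite le_eqVlt => /predU1P[<-|->]; first by right; left.
    by rewrite le_eqVlt => /predU1P[->|->]; [right; right|left].
  by move=> [/andP[/ltW -> /ltW ->]//|[]->]; rewrite lexx ltW.
split.
  rewrite E; apply/measurable_funU => //; first exact: measurableU.
  split; last by apply/measurable_funU => //; split; exact: measurable_fun_set1.
  apply: (@eq_measurable_fun _ _ _ _ _ g).
    by move=> x; rewrite inE/= in_itv/= => xab; rewrite fg.
  by apply: measurable_funS mg => //; apply: subset_itv; rewrite bnd_simp.
exists (Num.max B (Num.max `|f a| `|f b|)); apply: aeS gB => x gB xab.
rewrite !le_max; move: (xab); rewrite E => -[|[]] /=.
- by rewrite in_itv/= => /fg ->; rewrite gB.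
- by move=> ->; rewrite lexx orbT.
- by move=> ->; rewrite lexx !orbT.
Qed.

Lemma ae_neq2 (u v : R) : {ae lmu, forall z, z != u /\ z != v}.
Proof.
exists [set u; v]; split.
- by apply: measurableU; exact: measurable_set1.
- apply: countable_lebesgue_measure0; apply: finite_set_countable.
  by rewrite finite_setU; split; exact: finite_set1.
- by move=> z /= /not_andP[] /negP; rewrite negbK => /eqP ->; [left|right].
Qed.

(** Cauchy-Schwarz against the constant 1, read off from the nonnegative integral of [(f - c) ^+ 2]
    over [[a, x]], with [c] the mean of [f] there. *)
Lemma poincare_aux a b f x : a <= x <= b -> bmeas a b f ->
  (intg a x f) ^+ 2 <= (b - a) * intg a b (fun y => f y ^+ 2).
Proof.
move=> /andP[ax xb] bf.
have bf2 := bmX2 bf.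
have bfx := bm_sub (lexx a) xb bf.
have bfx2 := bmX2 bfx.
have I2 : intg a b (fun y => f y ^+ 2) >= intg a x (fun y => f y ^+ 2).
  rewrite (intg_split ax xb bf2) lerDl intg_ge0//.
    exact: bm_sub ax (lexx b) bf2.
  by apply: aeW => y _; exact: sqr_ge0.
set J := intg a x f.
have [xa|xa] := eqVneq x a.
  rewrite /J xa intg_xx expr0n/= mulr_ge0 ?subr_ge0 ?(le_trans ax xb)//.
  by rewrite intg_ge0//; apply: aeW => y _; exact: sqr_ge0.
have xa0 : 0 < x - a by rewrite subr_gt0 lt_neqAle eq_sym xa.
pose c := J / (x - a).
have : 0 <= intg a x (fun y => (f y - c) ^+ 2).
  apply: intg_ge0; last by apply: aeW => y _; exact: sqr_ge0.
  by apply: bmX2; apply: bmB => //; exact: bm_cst.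
rewrite (@eq_intg _ _ _ (fun y => (f y - c) ^+ 2) (fun y => f y ^+ 2 -
   (2 * c * f y - c ^+ 2))); last by move=> y _ /=; ring.
rewrite intgB//; last by apply: bmB; [exact: bmZ|exact: bm_cst].
rewrite intgB//; [|exact: bmZ|exact: bm_cst].
rewrite intgZ// intg_cst// -/J.
have -> : 2 * c * J - c ^+ 2 * (x - a) = J ^+ 2 / (x - a).
  by rewrite /c; field; rewrite gt_eqF.
rewrite subr_ge0 ler_pdivrMr// => h.
rewrite (le_trans h)// mulrC ler_pM ?lerD2r ?(ltW xa0)//.
by rewrite intg_ge0//; apply: aeW => y _; exact: sqr_ge0.
Qed.

Lemma prim_lip a b f : bmeas a b f -> exists L, forall x y,
  a <= x <= b -> a <= y <= b -> `|intg a x f - intg a y f| <= L * `|x - y|.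
Proof.
move=> [mf [B fB]]; exists B => x y xab yab.
wlog yx : x y xab yab / y <= x.
  by have [yx|/ltW xy] := leP y x; [exact|rewrite distrC (distrC x); exact].
have bx : bmeas a x f.
  by apply: (@bm_sub _ a b); [|lra|split => //; exists B].
rewrite (intg_split _ yx bx); last by lra.
rewrite addrAC subrr add0r (ger0_norm (_ : 0 <= x - y)) ?subr_ge0//.
apply: intg_bound => //; first by apply: bm_sub bx; [lra|].
apply: aeS fB => z fB; rewrite /= in_itv/= => zy; apply: fB.
by rewrite /= in_itv/=; lra.
Qed.

Lemma bm_prim a b f : bmeas a b f -> bmeas a b (fun x => intg a x f).
Proof. by move=> /prim_lip [L fL]; exact: bm_lip fL. Qed.

Lemma poincare a b f : a <= b -> bmeas a b f ->
  intg a b (fun x => (intg a x f) ^+ 2) <=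
    (b - a) ^+ 2 * intg a b (fun y => f y ^+ 2).
Proof.
move=> ab bf; rewrite expr2 mulrAC -intg_cst//; apply: le_intg.
- exact/bmX2/bm_prim.
- exact: bm_cst.
- by move=> x xab; exact: poincare_aux.
Qed.

End Pieces.

(** * Cells of the grid *)

Section Cells.
Context {R : realType} (l : R) (M : nat) (l_gt0 : 0 < l) (M_gt0 : (0 < M)%N).
Local Notation lmu := (@lebesgue_measure R).
Local Notation nd := (node l M).

Lemma node_mono i j : (i <= j)%N -> nd i <= nd j.
Proof. by move=> ij; rewrite ler_wpM2r ?ler_nat// ltW// mesh_gt0. Qed.

Lemma node_le_l i : (i <= M)%N -> nd i <= l.
Proof. by move=> /node_mono; rewrite (node_last l M_gt0). Qed.

Lemma cellP x : 0 <= x <= l -> exists2 i, (i < M)%N & nd i <= x <= nd i.+1.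
Proof.
move=> /andP[x0 xl]; have h0 := mesh_gt0 l_gt0 M_gt0.
have [xlt|xge] := ltP x l; last first.
  (* The endpoint [l] lies in no half-open cell; it is assigned to the last closed one. *)
  exists M.-1; first by rewrite prednK.
  rewrite prednK// node_last// xl andbT (le_trans _ xge)//.
  by rewrite node_le_l// leq_pred.
pose i := Num.truncn (x / mesh l M).
have /andP[ix xi] : i%:R <= x / mesh l M < i.+1%:R.
  by apply: truncn_itv; rewrite divr_ge0// ltW.
have ix' : nd i <= x by rewrite /node -ler_pdivlMr.
exists i; last by rewrite ix' /node -ler_pdivrMr// ltW.
rewrite ltnNge; apply/negP => /node_mono.
by rewrite node_last// => /le_trans/(_ ix'); rewrite leNgt xlt.
Qed.

Lemma bm_cells f : (forall i, (i < M)%N -> bmeas (nd i) (nd i.+1) f) ->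
  bmeas 0 l f.
Proof.
move=> bf; rewrite -[X in bmeas _ X](node_last l M_gt0).
have : forall k, (k <= M)%N -> bmeas 0 (nd k) f; last by apply.
elim=> [_|k ih kM].
  rewrite node0; apply: (@bm_lip _ _ _ _ 0) => x y x0 y0.
  have -> : x = y by lra.
  by rewrite !subrr normr0 mulr0.
apply: (@bm_glue _ _ (nd k)); rewrite ?(node_ge0 l_gt0)//.
- by rewrite ltW// node_lt.
- exact: ih (ltnW kM).
- exact: bf.
Qed.

Lemma ae_cells (Q : R -> Prop) :
  (forall i x, (i < M)%N -> nd i < x < nd i.+1 -> Q x) ->
  {ae lmu, forall x, `[0, l]%classic x -> Q x}.
Proof.
move=> HQ; have cnd : countable (nd @` [set: nat]).
  exact: sub_countable (card_image_le _ _) (countableP _).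
exists (nd @` [set: nat]); split.
- by apply: countable_measurable => //= y; exact: measurable_set1.
- exact: countable_lebesgue_measure0.
- move=> x /= nx; apply: contrapT => nnd; apply: nx.
  rewrite in_itv/= => /cellP[i iM /andP[ix xi]]; apply: (HQ i) => //.
  rewrite !lt_neqAle ix xi !andbT; apply/andP; split; apply/eqP => e.
    by apply: nnd; exists i.
  by apply: nnd; exists i.+1.
Qed.

(** A substitute for the fundamental theorem of calculus when [F] is regular only inside cells: the
    quadratic error vanishes under refinement of each cell, and the cells telescope. With [G]
    constant it shows that [F] is constant. *)
Lemma increment_cells (F G : R -> R) K :
  (forall i x y, (i < M)%N -> nd i <= y -> y <= x -> x <= nd i.+1 ->
     `|F x - F y| <= G x - G y + K * (x - y) ^+ 2) ->
  forall x, 0 <= x <= l -> `|F x - F 0| <= G x - G 0.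
Proof.
move=> FG.
have step k x : (k < M)%N -> nd k <= x <= nd k.+1 ->
    `|F x - F (nd k)| <= G x - G (nd k).
  move=> kM /andP[kx xk]; apply: (@increment_le _ _ _ _ _ K kx) => u v kv vu ux.
  by apply: (FG k) => //; exact: le_trans ux xk.
have nodes k : (k <= M)%N -> `|F (nd k) - F 0| <= G (nd k) - G 0.
  elim: k => [_|k ih kM]; first by rewrite node0 !subrr normr0.
  have := step k (nd k.+1) kM; rewrite lexx ltW ?node_lt// => /(_ isT) h.
  have := ih (ltnW kM); move: h => h1 h2.
  have -> : F (nd k.+1) - F 0 = (F (nd k.+1) - F (nd k)) + (F (nd k) - F 0) by lra.
  by rewrite (le_trans (ler_normD _ _))//; lra.
move=> x /cellP[k kM kx]; have h1 := step k x kM kx.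
have h2 := nodes k (ltnW kM).
have -> : F x - F 0 = (F x - F (nd k)) + (F (nd k) - F 0) by lra.
by rewrite (le_trans (ler_normD _ _))//; lra.
Qed.

End Cells.

(** * Fubini on a rectangle and weak derivatives *)

Section ProductMeasure.
Context {R : realType}.
Local Notation lmu := (@lebesgue_measure R).
Implicit Types (A : set (R * R)) (g : R -> R -> R).

Lemma ae_null_sections (A : set (measurableTypeR R * measurableTypeR R)) :
  measurable A -> ((lmu \x lmu)%E A = 0%E) ->
  {ae lmu, forall t, lmu (xsection A t) = 0%E}.
Proof.
move=> mA A0.
have mf : measurable_fun setT (lmu \o xsection A).
  exact: measurable_fun_xsection.
have : ae_eq lmu setT (lmu \o xsection A) (cst 0%E).
  apply/ae_eq_integral_abs => //.
  rewrite -[RHS]A0 /product_measure1; apply: eq_integral => x _.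
  by rewrite gee0_abs.
by apply: aeS => t /(_ I).
Qed.

Lemma ae_prod (Q : R * R -> Prop) :
  {ae (lmu \x lmu)%E, forall z : R * R, Q z} ->
  {ae lmu, forall t, {ae lmu, forall x, Q (t, x)}}.
Proof.
move=> [A [mA A0 QA]]; apply: aeS (ae_null_sections mA A0) => t At.
exists (xsection A t); split => //; first exact: measurable_xsection.
move=> x /= nQ; rewrite /xsection/= inE; apply: QA => //.
Qed.

(** By Tonelli both iterated integrals of the indicator of [A] agree, so null sections in one
    direction force null sections in the other. *)
Lemma ae_swap (A : set (measurableTypeR R * measurableTypeR R)) : measurable A ->
  {ae lmu, forall t, {ae lmu, forall x, ~ A (t, x)}} ->
  {ae lmu, forall x, {ae lmu, forall t, ~ A (t, x)}}.
Proof.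
move=> mA At.
have A0 : (\int[lmu]_t (lmu (xsection A t)) = 0)%E.
  transitivity (\int[lmu]_t `|lmu (xsection A t)|)%E.
    by apply: eq_integral => x _; rewrite gee0_abs.
  apply/(@ae_eq_integral_abs _ _ _ lmu setT _ (lmu \o xsection A)) => //.
    exact: measurable_fun_xsection.
  apply: aeS At => t [B [mB B0 AB]] _ /=.
  apply/eqP; rewrite eq_le measure_ge0 andbT -B0.
  apply: le_measure; rewrite ?inE//; first exact: measurable_xsection.
  by move=> x; rewrite /xsection/= inE => Atx; apply: AB => /=; apply.
have B0 : (\int[lmu]_x (lmu (ysection A x)) = 0)%E.
  rewrite -A0; have := indic_fubini_tonelli lmu lmu mA.
  by rewrite indic_fubini_tonelli_FE// indic_fubini_tonelli_GE// => ->.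
have mf : measurable_fun setT (lmu \o ysection A).
  exact: measurable_fun_ysection.
have : ae_eq lmu setT (lmu \o ysection A) (cst 0%E).
  apply/ae_eq_integral_abs => //; rewrite -[RHS]B0; apply: eq_integral => x _.
  by rewrite gee0_abs.
apply: aeS => x /(_ I)/= Bx; exists (ysection A x); split => //.
  exact: measurable_ysection.
by move=> t /= /contrapT; rewrite /ysection/= inE.
Qed.

Lemma measurable_cylinder (l : R) :
  @measurable _ (measurableTypeR R * measurableTypeR R)%type (cylinder l).
Proof.
rewrite (_ : cylinder l = `[0, +oo[%classic `*` `[0, l]%classic).
  by apply: measurableX.
by apply/seteqP; split => -[t x]/=; rewrite /Omega /= !in_itv/= andbT.
Qed.

Lemma measurable_secx (l : R) g t : 0 <= t ->
  measurable_fun (cylinder l) (fun z : R * R => g z.1 z.2) ->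
  measurable_fun `[0, l] (g t).
Proof.
move=> t0 mg; apply: (@measurable_comp _ _ _ _ _ _ (cylinder l)
    (fun z : R * R => g z.1 z.2) _ (fun x => (t, x))) => //.
- exact: measurable_cylinder.
- by move=> _ [x xl <-]; split.
- apply: measurableT_comp (measurable_pair1 t) _ => //.
Qed.

Lemma measurable_sect (l : R) g x : `[0, l]%classic x ->
  measurable_fun (cylinder l) (fun z : R * R => g z.1 z.2) ->
  measurable_fun (`[0, +oo[%classic : set R) (g^~ x).
Proof.
move=> xl mg; apply: (@measurable_comp _ _ _ _ _ _ (cylinder l)
    (fun z : R * R => g z.1 z.2) _ (fun t => (t, x))) => //.
- exact: measurable_cylinder.
- by move=> _ [t + <-]; rewrite /= in_itv/= andbT; split.
- apply: measurableT_comp (measurable_pair2 x) _ => //.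
Qed.

(** The norm in [LinfLp] takes its supremum over time last, so its bounds read: for almost every
    [t], for almost every [x]. Lipschitz estimates in time at a fixed [x] require the opposite
    order. *)
Lemma ae_swap_cyl (l C : R) g :
  measurable_fun (cylinder l) (fun z : R * R => g z.1 z.2) ->
  {ae lmu, forall t, 0 <= t ->
    {ae lmu, forall x, `[0, l]%classic x -> `|g t x| <= C}} ->
  {ae lmu, forall x, `[0, l]%classic x ->
    {ae lmu, forall t, 0 <= t -> `|g t x| <= C}}.
Proof.
move=> mg gC.
pose A : set (measurableTypeR R * measurableTypeR R) :=
  cylinder l `&` [set z | C < `|g z.1 z.2|].
have mA : measurable A.
  have mng : measurable_fun (cylinder l) (fun z : R * R => `|g z.1 z.2|).
    exact: measurableT_comp mg.
  have := mng (@measurable_cylinder l) [set` `]C, +oo[] (measurable_itv _).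
  congr measurable; apply/seteqP; split => z [zc /=];
    by rewrite in_itv/= andbT.
have : {ae lmu, forall x, {ae lmu, forall t, ~ A (t, x)}}.
  apply: ae_swap => //; apply: aeS gC => t gC.
  have [t0|t0] := leP 0 t.
    apply: aeS (gC t0) => x gx [[_ xl]] /=; rewrite ltNge => /negP; apply.
    exact: gx.
  by apply: aeW => x [[/=]]; rewrite leNgt t0.
apply: aeS => x nA xl; apply: aeS nA => t nA t0.
by rewrite leNgt; apply/negP => h; apply: nA; split.
Qed.

Lemma bounded_rect_integrable (D : set (measurableTypeR R * measurableTypeR R))
    (F : R * R -> R) (B : R) : measurable D -> ((lmu \x lmu)%E D < +oo)%E ->
  measurable_fun D F -> (forall z, D z -> `|F z| <= B) ->
  (lmu \x lmu)%E.-integrable D (EFin \o F).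
Proof.
move=> mD Doo mF FB; apply/integrableP; split; first exact/measurable_EFinP.
apply: (@le_lt_trans _ _ (\int[(lmu \x lmu)%E]_(x in D) (cst `|B|%:E) x)%E).
  apply: ge0_le_integral => //.
  - by apply/measurable_EFinP/measurableT_comp.
  - by move=> z zD; rewrite /= lee_fin (le_trans (FB z zD))// ler_norm.
by rewrite integral_cst//= lte_mul_pinfty// lee_fin.
Qed.

(** [G] extends the integrand by zero, so Fubini on the whole plane applies; [FE] and [GE] recognise
    its partial integrals as integrals over the sides. The integrals of the statement are
    real-valued, so [fu] and [fy] provide the finiteness that lets [fine] be undone. *)
Lemma fubini_rect (s t a b B : R) g :
  measurable_fun (`[s, t]%classic `*` `[a, b]%classic :
      set (measurableTypeR R * measurableTypeR R)) (fun z : R * R => g z.1 z.2) ->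
  (forall u y, s <= u <= t -> a <= y <= b -> `|g u y| <= B) ->
  [/\ bmeas s t (fun u => intg a b (g u)),
      bmeas a b (fun y => intg s t (g^~ y)) &
      intg s t (fun u => intg a b (g u)) = intg a b (fun y => intg s t (g^~ y))].
Proof.
move=> mg gB.
pose D : set (measurableTypeR R * measurableTypeR R) :=
  `[s, t]%classic `*` `[a, b]%classic.
have mD : measurable D by exact: measurableX.
have Doo : ((lmu \x lmu)%E D < +oo)%E.
  have fin c e : (lmu `[c, e] < +oo)%E.
    by rewrite lebesgue_measure_itv/=; case: ifP => _; rewrite ?ltry// -EFinB ltry.
  rewrite /D product_measure1E//; apply: lte_mul_pinfty => //; last exact: fin.
  by rewrite ge0_fin_numE//; exact: fin.
have gi : (lmu \x lmu)%E.-integrable D (EFin \o (fun z : R * R => g z.1 z.2)).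
  apply: (@bounded_rect_integrable D _ B) => //.
  by move=> [u y] [/=]; rewrite !in_itv/=; exact: gB.
pose G := (EFin \o (fun z : R * R => g z.1 z.2)) \_ D.
have Gi : (lmu \x lmu)%E.-integrable setT G.
  by apply/(@integrable_mkcond _ (measurableTypeR R * measurableTypeR R)%type R
    (lmu \x lmu)%E D).
have FE u : fubini_F lmu G u =
    (if u \in `[s, t] then \int[lmu]_(y in `[a, b]) (g u y)%:E else 0)%E.
  rewrite /fubini_F; case: ifPn => us.
    rewrite [RHS]integral_mkcond; apply: eq_integral => y _.
    rewrite /G !patchE; congr (if _ then _ else _); apply/idP/idP.
      by rewrite !inE => -[].
    by rewrite !inE => yab; split => //=.
  apply: integral0_eq => y _; rewrite /G patchE; case: ifPn => //.
  by rewrite inE => -[/=]; rewrite (negbTE us).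
have GE y : fubini_G lmu G y =
    (if y \in `[a, b] then \int[lmu]_(u in `[s, t]) (g u y)%:E else 0)%E.
  rewrite /fubini_G; case: ifPn => yab.
    rewrite [RHS]integral_mkcond; apply: eq_integral => u _.
    rewrite /G !patchE; congr (if _ then _ else _); apply/idP/idP.
      by rewrite !inE => -[].
    by rewrite !inE => us; split => //=.
  apply: integral0_eq => u _; rewrite /G patchE; case: ifPn => //.
  by rewrite inE => -[_/=]; rewrite (negbTE yab).
have secu u : s <= u <= t -> bmeas a b (g u).
  move=> us; apply: (@bm_ae _ _ _ _ B); last by move=> y; exact: gB.
  apply: (@measurable_comp _ _ _ _ _ _ D
      (fun z : R * R => g z.1 z.2) _ (fun x => (u, x))) => //.
    by move=> _ [y yab <-]; split => //=; rewrite in_itv.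
  by apply: measurableT_comp (measurable_pair1 u) _.
have secy y : a <= y <= b -> bmeas s t (g^~ y).
  move=> us; apply: (@bm_ae _ _ _ _ B); last by move=> u ?; exact: gB.
  apply: (@measurable_comp _ _ _ _ _ _ D
      (fun z : R * R => g z.1 z.2) _ (fun u => (u, y))) => //.
    by move=> _ [u yab <-]; split => //=; rewrite in_itv.
  by apply: measurableT_comp (measurable_pair2 y) _.
have fu u : s <= u <= t ->
    (\int[lmu]_(y in `[a, b]) (g u y)%:E)%E \is a fin_num.
  by move=> us; apply: integrable_fin_num => //; exact/bm_integrable/secu.
have fy y : a <= y <= b ->
    (\int[lmu]_(u in `[s, t]) (g u y)%:E)%E \is a fin_num.
  by move=> us; apply: integrable_fin_num => //; exact/bm_integrable/secy.
have mFu : measurable_fun `[s, t] (fun u => intg a b (g u)).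
  apply: (@eq_measurable_fun _ _ _ _ _ (fun u => fine (fubini_F lmu G u))).
    by move=> u; rewrite inE/= => us; rewrite FE us.
  apply: measurable_funTS; apply: measurableT_comp => //.
  exact: measurable_fubini_F Gi.
have mGy : measurable_fun `[a, b] (fun y => intg s t (g^~ y)).
  apply: (@eq_measurable_fun _ _ _ _ _ (fun y => fine (fubini_G lmu G y))).
    by move=> u; rewrite inE/= => us; rewrite GE us.
  apply: measurable_funTS; apply: measurableT_comp => //.
  exact: measurable_fubini_G Gi.
split.
- apply: (@bm_ae _ _ _ _ (`|B| * `|b - a|)) => // u us.
  have [ab|ba] := leP a b; last first.
    by rewrite set_itv_ge ?bnd_simp -?ltNge// Rintegral_set0 normr0 mulr_ge0.
  rewrite (ger0_norm (_ : 0 <= b - a)) ?subr_ge0//.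
  by apply: intg_boundW (secu _ us) _ => // y yab; rewrite (le_trans _ (ler_norm _))// gB.
- apply: (@bm_ae _ _ _ _ (`|B| * `|t - s|)) => // y yab.
  have [ab|ba] := leP s t; last first.
    by rewrite set_itv_ge ?bnd_simp -?ltNge// Rintegral_set0 normr0 mulr_ge0.
  rewrite (ger0_norm (_ : 0 <= t - s)) ?subr_ge0//.
  by apply: intg_boundW (secy _ yab) _ => // u us; rewrite (le_trans _ (ler_norm _))// gB.
- rewrite /Rintegral; congr fine.
  transitivity (\int[lmu]_u fubini_F lmu G u)%E.
    rewrite integral_mkcond; apply: eq_integral => u _; rewrite FE patchE mem_setE.
    by case: ifPn => // us; rewrite fineK// fu.
  transitivity (\int[lmu]_y fubini_G lmu G y)%E; first exact: Fubini Gi.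
  rewrite [RHS]integral_mkcond; apply: eq_integral => y _; rewrite GE patchE mem_setE.
  by case: ifPn => // us; rewrite fineK// fy.
Qed.

End ProductMeasure.

(** * From mixed norms to almost everywhere bounds *)

Section NormBounds.
Context {R : realType}.
Local Notation lmu := (@lebesgue_measure R).
Implicit Types (l : R) (g D E f : R -> R -> R).

Lemma ae_muTime (Q : R -> Prop) : {ae @muTime R, forall t, Q t} ->
  {ae lmu, forall t, 0 <= t -> Q t}.
Proof.
move=> [A [mA A0 QA]]; exists (A `&` [set` `[0, +oo[]); split => //.
  by apply: measurableI => //; exact: measurable_itv.
move=> t /= /not_implyP[t0 nQ]; split; first exact: QA.
by rewrite /= in_itv/= t0.
Qed.

Lemma ae_muOmega l (Q : R -> Prop) : {ae muOmega l, forall x, Q x} ->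
  {ae lmu, forall x, `[0, l]%classic x -> Q x}.
Proof.
move=> [A [mA A0 QA]]; exists (A `&` Omega l); split => //.
  by apply: measurableI => //; exact: measurable_itv.
by move=> t /= /not_implyP[t0 nQ]; split => //; exact: QA.
Qed.

Lemma ess_sup_ltoo (f : R -> \bar R) : (ess_sup (@muTime R) f < +oo)%E ->
  exists C, {ae lmu, forall t, 0 <= t -> (f t <= C%:E)%E}.
Proof.
move=> foo; pose C := Num.max (fine (ess_sup (@muTime R) f)) 0.
have fC : (ess_sup (@muTime R) f <= C%:E)%E.
  case: (ess_sup _ _) foo @C => [r _|//|_] /=; last exact: leNye.
  by rewrite lee_fin le_max lexx.
by exists C; apply: ae_muTime; exact/ess_supP.
Qed.

Lemma Noo_le l (f : R -> R) (C : \bar R) : 0 < l ->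
  ('N[muOmega l]_+oo[EFin \o f] <= C)%E ->
  {ae lmu, forall x, `[0, l]%classic x -> (`|f x|%:E <= C)%E}.
Proof.
move=> l0; rewrite unlock /= /muOmega.
(* The sup norm is defined by cases on the total mass and is an essential supremum only when that
   mass is positive, which is where [0 < l] enters. *)
have -> : (0 < mrestr lmu (mOmega l) setT)%E.
  rewrite /mrestr setTI /Omega lebesgue_measure_itv/= lte_fin l0.
  by rewrite -EFinB lte_fin subr0.
by move=> /ess_supP; exact: ae_muOmega.
Qed.

(** Meant for functions whose measurability is known on [[0, l]] only. The integral of a nonnegative
    function is a supremum over simple functions below it, and a simple function below the patched
    [f] is also below [f]. *)
Lemma le_integral_restr l (f : R -> \bar R) : (forall x, 0 <= f x)%E ->
  (\int[lmu]_(x in `[0%R, l]) f x <= \int[muOmega l]_x f x)%E.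
Proof.
move=> f0; have -> : (\int[lmu]_(x in `[0%R, l]) f x =
    \int[muOmega l]_(x in `[0%R, l]) f x)%E.
  apply: eq_measure_integral => A mA Al.
  by change (lmu A = lmu (A `&` Omega l)); rewrite (setIidl Al).
rewrite ge0_integralE// ge0_integralTE//.
apply: le_ereal_sup => _ [h hf <-]; exists h => // x.
apply: le_trans (hf x) _; rewrite patchE; case: ifP => // _; exact: f0.
Qed.

(** Kept in the extended reals: the real-valued integral of a function with infinite integral is the
    default value 0, and a real inequality would not exclude that case. *)
Definition L1bounded l (f : R -> R) (C : R) : Prop :=
  (\int[lmu]_(x in `[0%R, l]) `|f x|%:E <= C%:E)%E.

Lemma L1bounded_oo l (f : R -> R) C : 0 < l -> measurable_fun `[0, l] f ->
  {ae lmu, forall x, `[0, l]%classic x -> (`|f x|%:E <= C%:E)%E} ->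
  L1bounded l f (C * l).
Proof.
move=> l0 mf fC.
have bf : bmeas 0 l f.
  by split => //; exists C; apply: aeS fC => x fC /fC; rewrite lee_fin.
have le1 : intg 0 l (fun x => `|f x|) <= C * l.
  rewrite -[in leRHS](subr0 l) -(intg_cst C (ltW l0)).
  apply: le_intg_ae; [exact: bm_norm|exact: bm_cst|].
  by apply: aeS fC => x fC /fC; rewrite lee_fin.
rewrite /L1bounded -[leLHS]fineK ?lee_fin//.
by apply: integrable_fin_num => //; exact/bm_integrable/bm_norm.
Qed.

Lemma N2_sqr l (f : R -> R) C : ('N[muOmega l]_2%:E[EFin \o f] <= C%:E)%E ->
  (\int[lmu]_(x in `[0%R, l]) (f x ^+ 2)%:E <= (C ^+ 2)%:E)%E.
Proof.
move=> h; have N0 := @Lnorm_ge0 _ _ _ (muOmega l) 2%:E (EFin \o f).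
have C0 : 0 <= C by rewrite -lee_fin (le_trans N0).
have /= E : (\int[muOmega l]_x (f x ^+ 2)%:E = 'N[muOmega l]_2%:E[EFin \o f] `^ 2)%E.
  rewrite poweR_Lnorm//; apply: eq_integral => x _ /=.
  by rewrite powR_mulrn// real_normK// num_real.
apply: le_trans (le_integral_restr l _) _.
  by move=> x; rewrite lee_fin sqr_ge0.
rewrite E -(powR_mulrn 2 C0) -poweR_EFin; apply: gt0_ler_poweR => //.
  by rewrite in_itv/= N0 leey.
by rewrite in_itv/= lee_fin C0 leey.
Qed.

(** The crude [|f| <= 1 + f ^+ 2] plays the role of Cauchy-Schwarz, since only the existence of a
    bound matters later. *)
Lemma L1bounded_2 l (f : R -> R) C : 0 < l -> measurable_fun `[0, l] f ->
  ('N[muOmega l]_2%:E[EFin \o f] <= C%:E)%E -> L1bounded l f (l + C ^+ 2).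
Proof.
move=> l0 mf /N2_sqr h.
apply: (@le_trans _ _ (\int[lmu]_(x in `[0%R, l]) (1%:E + (f x ^+ 2)%:E))%E).
  apply: ge0_le_integral => //.
  - by apply/measurable_EFinP/measurableT_comp.
  - apply: emeasurable_funD => //.
    by apply/measurable_EFinP; exact: measurable_funX.
  - move=> x xl; rewrite -EFinD lee_fin -real_normK ?num_real//.
    by have := sqr_ge0 (`|f x| - 1); have := normr_ge0 (f x); nra.
rewrite ge0_integralD//.
- rewrite EFinD leeD//; rewrite integral_cst//= mul1e.
  by rewrite lebesgue_measure_itv/= lte_fin l0 -EFinB subr0.
- by move=> x xl; rewrite lee_fin sqr_ge0.
- by apply/measurable_EFinP; exact: measurable_funX.
Qed.

Lemma LinfLp_L1 l q g : 0 < l -> q = 2%:E \/ q = +oo%E -> LinfLp l q g ->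
  exists C, {ae lmu, forall t, 0 <= t -> L1bounded l (g t) C}.
Proof.
move=> l0 qE [mg /ess_sup_ltoo[C gC]]; case: qE gC => -> gC.
  exists (l + C ^+ 2); apply: aeS gC => t gC t0; apply: L1bounded_2 => //.
    exact: measurable_secx mg.
  exact: gC.
exists (C * l); apply: aeS gC => t gC t0; apply: L1bounded_oo => //.
  exact: measurable_secx mg.
by apply: Noo_le => //; exact: gC.
Qed.

Lemma LinfLoo_ae l g : 0 < l -> LinfLp l +oo g ->
  exists C, {ae lmu, forall t, 0 <= t ->
    {ae lmu, forall x, `[0, l]%classic x -> `|g t x| <= C}}.
Proof.
move=> l0 [mg /ess_sup_ltoo[C gC]]; exists C; apply: aeS gC => t gC t0.
by apply: aeS (Noo_le l0 (gC t0)) => x h /h; rewrite lee_fin.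
Qed.

Lemma L1bounded_intg l (f : R -> R) C x : measurable_fun `[0, l] f ->
  L1bounded l f C -> 0 <= x <= l -> `|intg 0 x f| <= C.
Proof.
move=> mf fC /andP[x0 xl]; have sub : [set` `[0, x]] `<=` [set` `[0, l]].
  by apply: subset_itv; rewrite bnd_simp.
have mfx : measurable_fun `[0, x] f by exact: measurable_funS mf.
have le1 : (\int[lmu]_(y in `[0%R, x]) `|f y|%:E <= C%:E)%E.
  apply: le_trans fC; apply: ge0_subset_integral => //.
  by apply/measurable_EFinP/measurableT_comp.
have fi : lmu.-integrable `[0, x] (EFin \o f).
  apply/integrableP; split; first exact/measurable_EFinP.
  by apply: le_lt_trans le1 _; rewrite ltry.
rewrite (le_trans (le_normr_Rintegral _ fi))// -lee_fin /Rintegral fineK//.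
apply: integrable_fin_num => //; apply/integrableP; split.
  by apply/measurable_EFinP/measurableT_comp.
apply: le_lt_trans (ltry C); apply: le_trans le1.
by under eq_integral do rewrite /= normr_id.
Qed.

(** The embedding of [W^{1,1}] into bounded functions: two values of [f] differ by at most [2 * C],
    and averaging [|f x| <= |f y| + 2 * C] over [y] brings in the mean of [|f|], at most [C / l]. *)
Lemma sup_bound l (f e : R -> R) C : 0 < l ->
  measurable_fun `[0, l] f -> measurable_fun `[0, l] e ->
  (forall x, 0 <= x <= l -> f x = f 0 + intg 0 x e) ->
  L1bounded l f C -> L1bounded l e C ->
  forall x, 0 <= x <= l -> `|f x| <= C / l + 2 * C.
Proof.
move=> l0 mf me fe fC eC x xl.
have f0 y : 0 <= y <= l -> `|f y - f 0| <= C.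
  by move=> yl; rewrite fe// addrAC subrr add0r (L1bounded_intg me eC).
have bf : bmeas 0 l f.
  apply: (@bm_ae _ _ _ _ (`|f 0| + C)) => // y yl.
  have -> : f y = f 0 + (f y - f 0) by lra.
  by rewrite (le_trans (ler_normD _ _))// lerD2l f0.
have le1 : intg 0 l (fun=> `|f x|) <= intg 0 l (fun y => `|f y| + 2 * C).
  apply: le_intg; [exact: bm_cst|apply: bmD; [exact: bm_norm|exact: bm_cst]|].
  move=> y yl; rewrite -lerBlDl; apply: le_trans (lerB_dist _ _) _.
  have -> : f x - f y = (f x - f 0) - (f y - f 0) by lra.
  rewrite (le_trans (ler_normB _ _))//; have := f0 x xl; have := f0 y yl; lra.
move: le1; rewrite (intgD (bm_norm bf) (bm_cst 0 l (2 * C))).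
rewrite !(intg_cst _ (ltW l0)) subr0 => le1.
have le2 : intg 0 l (fun y => `|f y|) <= C.
  rewrite -lee_fin /Rintegral fineK//.
  by apply: integrable_fin_num => //; exact/bm_integrable/bm_norm.
rewrite -(ler_pM2r l0) mulrDl divfK ?gt_eqF//.
by rewrite (le_trans le1)// lerD2r.
Qed.

(** An interval of positive length cannot lie in a null set. It is taken to the right of [t] so that
    [s] stays nonnegative. Combined with continuity in time, this extends almost-every-time bounds
    to all times. *)
Lemma ae_dense (P : R -> Prop) : {ae lmu, forall t, 0 <= t -> P t} ->
  forall t e, 0 <= t -> 0 < e -> exists s, [/\ 0 <= s, `|t - s| <= e & P s].
Proof.
move=> [A [mA A0 PA]] t e t0 e0; apply: contrapT => nP.
have sub : [set` `]t, t + e[] `<=` A.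
  move=> s; rewrite /= in_itv/= => /andP[ts ste]; apply: PA => /= Ps.
  apply: nP; exists s; split; first lra; last by apply: Ps; lra.
  by rewrite ler0_norm; lra.
have : (lmu `]t, (t + e)%R[ <= 0)%E by rewrite -A0; apply: le_measure; rewrite ?inE.
rewrite lebesgue_measure_itv/= lte_fin ltrDl e0 -EFinB lee_fin; lra.
Qed.

Lemma time_lip (f g : R -> R) C :
  measurable_fun ([set` `[0, +oo[] : set R) g ->
  {ae lmu, forall t, 0 <= t -> `|g t| <= C} ->
  (forall t, 0 <= t -> f t = f 0 + intg 0 t g) ->
  forall s t, 0 <= s -> 0 <= t -> `|f t - f s| <= C * `|t - s|.
Proof.
move=> mg gC fg.
suff main s t : 0 <= s -> s <= t -> `|f t - f s| <= C * `|t - s|.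
  move=> s t s0 t0; have [st|/ltW ts] := leP s t; first exact: main.
  by rewrite distrC (distrC t); exact: main.
move=> s0 st; have t0 := le_trans s0 st.
have bg : bmeas 0 t g.
  split; last by exists C; apply: aeS gC => u gC; rewrite /= in_itv/= => /andP[/gC].
  by apply: measurable_funS mg => // u; rewrite /= !in_itv/= andbT => /andP[].
rewrite (fg t)// (fg s)// (intg_split s0 st bg).
rewrite (ger0_norm (_ : 0 <= t - s)) ?subr_ge0//.
rewrite (_ : _ - _ = intg s t g); last by lra.
apply: intg_bound => //; first exact: bm_sub bg.
by apply: aeS gC => u gC; rewrite /= in_itv/= => /andP[su _]; apply: gC; lra.
Qed.

Lemma ae_point (a b : R) (Q : R -> Prop) : a < b ->
  {ae lmu, forall x, `[a, b]%classic x -> Q x} ->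
  forall x e, a <= x <= b -> 0 < e ->
  exists y, [/\ a <= y <= b, `|x - y| <= e & Q y].
Proof.
move=> ab [A [mA A0 QA]] x e xab e0; apply: contrapT => nP.
pose c := Num.max a (x - e); pose d := Num.min b (x + e).
have cd : c < d by rewrite /c /d; case: (leP a); case: (leP b); lra.
have sub : [set` `]c, d[] `<=` A.
  move=> s; rewrite /= in_itv/= /c /d gt_max lt_min => /andP[/andP[h1 h2] /andP[h3 h4]].
  apply: QA => /= Ps; apply: nP; exists s; split; first lra.
    by rewrite ler_norml; lra.
  by apply: Ps; rewrite in_itv/=; lra.
have : (lmu `]c, d[ <= 0)%E by rewrite -A0; apply: le_measure; rewrite ?inE.
by rewrite lebesgue_measure_itv/= lte_fin cd -EFinB lee_fin; lra.
Qed.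

End NormBounds.

(** * Lipschitz bounds from Sobolev regularity *)

Section Regularity.
Context {R : realType}.
Local Notation lmu := (@lebesgue_measure R).
Implicit Types (l : R) (f g : R -> R -> R).

(** By [sup_bound] the time derivative [D 1] is bounded uniformly in [x] at almost every time, and
    integrating it at fixed [x] gives the Lipschitz bound. The bound on [f] itself also holds at
    first for almost every time only; the Lipschitz bound carries it to the others, with an error
    [e] that is arbitrary. *)
Lemma W1_time l q f : 0 < l -> q = 2%:E \/ q = +oo%E -> Wkinf_W1 l 1 q f ->
  exists C, [/\ 0 <= C,
    measurable_fun (cylinder l) (fun z : R * R => f z.1 z.2),
    forall t x, 0 <= t -> 0 <= x <= l -> `|f t x| <= C &
    forall s t x, 0 <= s -> 0 <= t -> 0 <= x <= l ->
      `|f t x - f s x| <= C * `|t - s|].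
Proof.
move=> l0 qE [D [E [D0 DE sp tp]]].
have supD i : (i <= 1)%N -> exists C, {ae lmu, forall t, 0 <= t ->
    forall x, 0 <= x <= l -> `|D i t x| <= C}.
  move=> i1; have [Di Ei] := DE i i1.
  have [C1 DC] := LinfLp_L1 l0 qE Di; have [C2 EC] := LinfLp_L1 l0 qE Ei.
  pose C := Num.max C1 C2; exists (C / l + 2 * C).
  apply: aeS2 DC EC => t DC EC t0; apply: (@sup_bound _ l (D i t) (E i t)) => //.
  - exact: measurable_secx t0 Di.1.
  - exact: measurable_secx t0 Ei.1.
  - by move=> x xl; exact: (sp i i1 t x t0 xl).
  - by apply: le_trans (DC t0) _; rewrite lee_fin le_max lexx.
  - by apply: le_trans (EC t0) _; rewrite lee_fin le_max lexx orbT.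
have [C0 DC0] := supD 0%N isT; have [C1 DC1] := supD 1%N isT.
have [Df _] := DE 0%N isT; have [Df1 _] := DE 1%N isT.
have tl s t x : 0 <= s -> 0 <= t -> 0 <= x <= l ->
    `|f t x - f s x| <= C1 * `|t - s|.
  move=> s0 t0 xl; apply: (@time_lip _ (f^~ x) (D 1%N ^~ x)) => //.
  - exact: measurable_sect Df1.1.
  - by apply: aeS DC1 => u h u0; exact: h.
  - move=> u u0; have := tp 0%N isT u x u0; by rewrite D0; apply.
exists (Num.max `|C0| (`|C1|)); split.
- by rewrite le_max normr_ge0.
- by case: Df; rewrite D0.
- move=> t x t0 xl; apply/ler_addgt0Pr => e e0.
  have C10 : 0 < `|C1| + 1 by rewrite ltr_wpDl.
  have [|s [s0 st sC]] := ae_dense DC0 t0 (e := e / (`|C1| + 1)).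
    by rewrite divr_gt0.
  have -> : f t x = f s x + (f t x - f s x) by lra.
  rewrite (le_trans (ler_normD _ _))// lerD//.
    by rewrite le_max (le_trans _ (ler_norm _))//; have := sC x xl; rewrite D0.
  rewrite (le_trans (tl s t x s0 t0 xl))//.
  rewrite (@le_trans _ _ ((`|C1| + 1) * `|t - s|))//.
    by rewrite ler_wpM2r// (le_trans (ler_norm _))// lerDl.
  by rewrite mulrC -ler_pdivlMr.
- move=> s t x s0 t0 xl; rewrite (le_trans (tl s t x s0 t0 xl))//.
  by rewrite ler_wpM2r// le_max (ler_norm C1) orbT.
Qed.

Lemma space_lip_of_ae l (f e : R -> R) C : measurable_fun `[0, l] e ->
  {ae lmu, forall x, `[0, l]%classic x -> `|e x| <= C} ->
  (forall x, 0 <= x <= l -> f x = f 0 + intg 0 x e) ->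
  forall x y, 0 <= x <= l -> 0 <= y <= l -> `|f x - f y| <= C * `|x - y|.
Proof.
move=> me eC fe x y xl yl.
wlog yx : x y xl yl / y <= x.
  by have [yx|/ltW xy] := leP y x; [exact|rewrite distrC (distrC x); exact].
have bx : bmeas 0 x e.
  by apply: (@bm_sub _ 0 l); [|lra|split => //; exists C].
have y0 : 0 <= y by lra.
rewrite (fe x)// (fe y)// (intg_split y0 yx bx).
rewrite (_ : _ - _ = intg y x e); last by lra.
rewrite (ger0_norm (_ : 0 <= x - y)) ?subr_ge0//.
apply: intg_bound => //; first by apply: bm_sub bx.
by apply: aeS eC => z eC; rewrite /= in_itv/= => zy; apply: eC; rewrite /= in_itv/=; lra.
Qed.

(** The mixed derivative [E 1] is essentially bounded, so [D 1] is Lipschitz in space at almost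
    every time; integrating its space differences from [s] to [t] produces the product
    [|t - s| * |x - y|]. The plain space bound is first known at almost every time and extended by
    continuity in time. *)
Lemma W1oo_space l f : 0 < l -> Wkinf_W1 l 1 +oo f ->
  exists C, [/\ 0 <= C,
    forall t x y, 0 <= t -> 0 <= x <= l -> 0 <= y <= l ->
      `|f t x - f t y| <= C * `|x - y| &
    forall s t x y, 0 <= s -> 0 <= t -> 0 <= x <= l -> 0 <= y <= l ->
      `|f t x - f s x - (f t y - f s y)| <= C * `|t - s| * `|x - y|].
Proof.
move=> l0 WF; have [K [K0 mf fK tl]] := W1_time l0 (or_intror erefl) WF.
case: WF => D [E [D0 DE sp tp]].
have lipD i : (i <= 1)%N -> exists C, {ae lmu, forall t, 0 <= t ->
    forall x y, 0 <= x <= l -> 0 <= y <= l ->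
      `|D i t x - D i t y| <= C * `|x - y|}.
  move=> i1; have [Di Ei] := DE i i1.
  have [C EC] := LinfLoo_ae l0 Ei; exists C; apply: aeS EC => t EC t0.
  apply: (@space_lip_of_ae _ (D i t) (E i t)) (EC t0) _.
    exact: measurable_secx t0 Ei.1.
  by move=> x xl; exact: (sp i i1 t x t0 xl).
have [C0 DC0] := lipD 0%N isT; have [C1 DC1] := lipD 1%N isT.
have [Df1 Ef1] := DE 1%N isT.
have [B DB] : exists B, {ae lmu, forall t, 0 <= t ->
    forall x, 0 <= x <= l -> `|D 1%N t x| <= B}.
  have [B1 h1] := LinfLp_L1 l0 (or_intror erefl) Df1.
  have [B2 h2] := LinfLp_L1 l0 (or_intror erefl) Ef1.
  pose B := Num.max B1 B2; exists (B / l + 2 * B).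
  apply: aeS2 h1 h2 => t h1 h2 t0; apply: (@sup_bound _ l (D 1%N t) (E 1%N t)) => //.
  - exact: measurable_secx t0 Df1.1.
  - exact: measurable_secx t0 Ef1.1.
  - by move=> x xl; exact: (sp 1%N isT t x t0 xl).
  - by apply: le_trans (h1 t0) _; rewrite lee_fin le_max lexx.
  - by apply: le_trans (h2 t0) _; rewrite lee_fin le_max lexx orbT.
have mD1 x : 0 <= x <= l -> measurable_fun (`[0, +oo[%classic : set R) (D 1%N ^~ x).
  by move=> xl; apply: (@measurable_sect _ l); [rewrite /= in_itv|case: Df1].
have bD1 t x : 0 <= x <= l -> bmeas 0 t (D 1%N ^~ x).
  move=> xl; split; last first.
    by exists B; apply: aeS DB => u DB; rewrite /= in_itv/= => /andP[u0 _]; exact: DB.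
  by apply: measurable_funS (mD1 x xl) => // u; rewrite /= !in_itv/= andbT => /andP[].
exists (Num.max `|C0| `|C1|); split.
- by rewrite le_max normr_ge0.
- move=> t x y t0 xl yl.
  rewrite (@le_trans _ _ (`|C0| * `|x - y|))//; last first.
    by rewrite ler_wpM2r// le_max lexx.
  apply/ler_addgt0Pr => e e0.
  have K10 : 0 < 2 * K + 1 by lra.
  have [|s [s0 st sC]] := ae_dense DC0 t0 (e := e / (2 * K + 1)).
    by rewrite divr_gt0.
  have -> : f t x - f t y =
     (f s x - f s y) + ((f t x - f s x) - (f t y - f s y)) by lra.
  rewrite (le_trans (ler_normD _ _))// lerD//.
    have := sC x y xl yl; rewrite D0 => /le_trans; apply.
    by rewrite ler_wpM2r// ler_norm.
  rewrite (le_trans (ler_normB _ _))//.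
  have := tl s t x s0 t0 xl; have := tl s t y s0 t0 yl => h1 h2.
  have : (2 * K + 1) * `|t - s| <= e by rewrite mulrC -ler_pdivlMr.
  have := normr_ge0 (t - s); move: h1 h2.
  move: `|t - s| `|f t x - f s x| `|f t y - f s y| => p q r.
  clear -K0; nra.
- move=> s t x y s0 t0 xl yl.
  rewrite (@le_trans _ _ ((`|C1| * `|x - y|) * `|t - s|))//; last first.
    rewrite mulrAC ler_wpM2r// ler_wpM2r// le_max lexx orbT//.
  rewrite (_ : _ - _ = (f t x - f t y) - (f s x - f s y)); last by lra.
  apply: (@time_lip _ (fun u => f u x - f u y) (fun u => D 1%N u x - D 1%N u y)) => //.
  - by apply: measurable_funB; exact: mD1.
  - apply: aeS DC1 => u h u0; rewrite (le_trans (h u0 x y xl yl))//.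
    by rewrite ler_wpM2r// ler_norm.
  - move=> u u0; rewrite intgB; [|exact: bD1|exact: bD1].
    have := tp 0%N isT u x u0; have := tp 0%N isT u y u0; rewrite D0.
    move=> /(_ yl) -> /(_ xl) ->; by move: (Rintegral _ _ _) (Rintegral _ _ _) => I J; ring.
Qed.

(** Keeps the constant [C] itself, whereas [W1_time] returns some constant: the smallness of [Ct] is
    used quantitatively. After the exchange of exceptional sets the bound holds for almost every
    [x], and continuity in space extends it to all [x]. *)
Lemma small_time_lip l f g C L : 0 < l -> LinfLp l +oo g ->
  (LinfLp_norm l +oo g <= C%:E)%E -> time_primitive l f g ->
  (forall t x y, 0 <= t -> 0 <= x <= l -> 0 <= y <= l ->
      `|f t x - f t y| <= L * `|x - y|) ->
  forall s t x, 0 <= s -> 0 <= t -> 0 <= x <= l ->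
    `|f t x - f s x| <= C * `|t - s|.
Proof.
move=> l0 [mg _] /ess_supP/ae_muTime gC tp fL.
have gC' : {ae lmu, forall t, 0 <= t ->
    {ae lmu, forall x, `[0, l]%classic x -> `|g t x| <= C}}.
  apply: aeS gC => t gC t0.
  by apply: aeS (Noo_le l0 (gC t0)) => x h /h; rewrite lee_fin.
have gCx := ae_swap_cyl mg gC'.
have good : {ae lmu, forall x, `[0, l]%classic x -> forall s t, 0 <= s -> 0 <= t ->
    `|f t x - f s x| <= C * `|t - s|}.
  apply: aeS gCx => x gCx xl; apply: (@time_lip _ (f^~ x) (g^~ x)).
  - exact: measurable_sect mg.
  - exact: gCx.
  - by move=> t t0; exact: tp.
move=> s t x s0 t0 xl; apply/ler_addgt0Pr => e e0.
have L10 : 0 < 2 * `|L| + 1 by rewrite ltr_wpDl// mulr_ge0.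
have [|y [yl xy yC]] := ae_point l0 good xl (e := e / (2 * `|L| + 1)).
  by rewrite divr_gt0.
have -> : f t x - f s x = (f t y - f s y) + ((f t x - f t y) - (f s x - f s y)).
  by move: (f t x) (f s x) (f t y) (f s y) => p q r k; lra.
rewrite (le_trans (ler_normD _ _))// lerD//; first exact: yC.
rewrite (le_trans (ler_normB _ _))//.
have h1 := fL t x y t0 xl yl; have h2 := fL s x y s0 xl yl.
have h3 : (2 * `|L| + 1) * `|x - y| <= e by rewrite mulrC -ler_pdivlMr.
have h4 : L * `|x - y| <= `|L| * `|x - y| by rewrite ler_wpM2r// ler_norm.
have h5 := normr_ge0 (x - y).
move: h1 h2 h3 h4 h5; move: `|x - y| `|f t x - f t y| `|f s x - f s y| `|L| => p q r k.
move=> h1 h2 h3 h4 h5; rewrite (le_trans _ h3)// mulrDl mul1r; clear -h1 h2 h4 h5; lra.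
Qed.

End Regularity.

(** * Difference quotients *)

Section MeanValue.
Context {R : realType}.
Implicit Types (phi psi chi xi : R -> R) (c d x y B : R).

Definition deriv_on c d phi psi : Prop :=
  forall x, c <= x <= d -> is_derive x 1 phi (psi x).

Lemma mvt_on c d phi psi x y : deriv_on c d phi psi -> c <= y -> y <= x -> x <= d ->
  exists2 z, y <= z <= x & phi x - phi y = psi z * (x - y).
Proof.
move=> dphi cy yx xd.
have [| |z + E] := @MVT_segment _ phi psi y x yx.
- by move=> u; rewrite in_itv/= => /andP[u1 u2]; apply: dphi; lra.
- apply: derivable_within_continuous => u; rewrite in_itv/= => u12.
  by have [] : is_derive u 1 phi (psi u) by apply: dphi; lra.
- by rewrite in_itv/= => zI; exists z.
Qed.

Lemma mvt_lip c d phi psi B : deriv_on c d phi psi ->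
  (forall x, c <= x <= d -> `|psi x| <= B) ->
  forall x y, c <= x <= d -> c <= y <= d -> `|phi x - phi y| <= B * `|x - y|.
Proof.
move=> dphi psiB x y; wlog yx : x y / y <= x.
  move=> H xI yI; have [yx|/ltW xy] := leP y x; first exact: H.
  by rewrite distrC (distrC x); exact: H.
move=> xI yI; have [|||z zI ->] := mvt_on dphi (x := x) (y := y); [lra..|].
by rewrite normrM ler_wpM2r// psiB//; lra.
Qed.

(** Subtracting from [phi] its slope at [y] and the quadratic leaves [k], whose derivative has the
    sign of [t - y] because [psi] grows at rate at least [B]. Hence [k] is smallest at [y]. *)
Lemma bregman_ge c d phi psi chi B : deriv_on c d phi psi -> deriv_on c d psi chi ->
  (forall x, c <= x <= d -> B <= chi x) ->
  forall x y, c <= x <= d -> c <= y <= d ->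
    B / 2 * (x - y) ^+ 2 <= phi x - phi y - psi y * (x - y).
Proof.
move=> dphi dpsi chiB x y xI yI.
pose k t := phi t - (psi y * t + B / 2 * (t - y) ^+ 2).
pose dk t := psi t - (psi y + B * (t - y)).
have dkE : deriv_on c d k dk.
  move=> t tI; have ? := dphi t tI; rewrite /k /dk; apply: is_derive_eq.
  by rewrite /GRing.scale/=; field.
have psiE t u : c <= u -> u <= t -> t <= d -> B * (t - u) <= psi t - psi u.
  move=> cu ut td; have [z zI ->] := mvt_on dpsi cu ut td.
  by rewrite ler_wpM2r ?subr_ge0//; apply: chiB; lra.
suff : 0 <= k x - k y.
  rewrite /k subrr expr0n/= mulr0 addr0.
  move: (phi x) (phi y) (psi y) => p q r h; rewrite -subr_ge0.
  suff -> : p - q - r * (x - y) - B / 2 * (x - y) ^+ 2 =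
    p - (r * x + B / 2 * (x - y) ^+ 2) - (q - r * y) by [].
  by field.
have [yx|xy] := leP y x.
  have [|||z zI ->] := mvt_on dkE (x := x) (y := y); [lra..|].
  rewrite mulr_ge0 ?subr_ge0// /dk.
  have := psiE z y; have [-> -> ->] : [/\ c <= y, y <= z & z <= d] by split; lra.
  by move=> /(_ isT isT isT); rewrite lerBrDl.
have [|||z zI e] := mvt_on dkE (x := y) (y := x); [lra..|].
rewrite -opprB e -mulNr; apply: mulr_ge0; last by rewrite subr_ge0 ltW.
rewrite /dk.
have := psiE y z; have [-> -> ->] : [/\ c <= z, z <= y & y <= d] by split; lra.
move=> /(_ isT isT isT); have : B * (z - y) = - (B * (y - z)) by ring.
move: (psi z) (psi y) (B * (z - y)) (B * (y - z)) => p q r s -> h; lra.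
Qed.

Lemma bregman_le c d phi psi chi B : deriv_on c d phi psi -> deriv_on c d psi chi ->
  (forall x, c <= x <= d -> chi x <= B) ->
  forall x y, c <= x <= d -> c <= y <= d ->
    phi x - phi y - psi y * (x - y) <= B / 2 * (x - y) ^+ 2.
Proof.
move=> dphi dpsi chiB x y xI yI.
have := @bregman_ge c d (fun t => - phi t) (fun t => - psi t) (fun t => - chi t) (- B).
move=> /(_ _ _ _ x y xI yI) h.
have {}h : - B / 2 * (x - y) ^+ 2 <= - phi x - - phi y - (- psi y) * (x - y).
  apply: h => z zI; first by have ? := dphi z zI; apply: is_deriveN.
    by have ? := dpsi z zI; apply: is_deriveN.
  by rewrite lerN2 chiB.
rewrite -lerN2; move: h; move: (phi x) (phi y) (psi y) => p q r h.
rewrite (le_trans _ (le_trans h _))// le_eqVlt; apply/orP; left; apply/eqP; ring.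
Qed.

(** At fixed increment [e], the derivative of the remainder in its base point is the first-order
    remainder of [psi], at most [B / 2 * e ^+ 2] by the two preceding lemmas. This prices the motion
    of the reference density during a time step. *)
Lemma bregman_lip c d phi psi chi xi B : deriv_on c d phi psi ->
  deriv_on c d psi chi -> deriv_on c d chi xi ->
  (forall x, c <= x <= d -> `|xi x| <= B) ->
  forall r1 r2 e, c <= r1 <= d -> c <= r2 <= d ->
    c <= r1 + e <= d -> c <= r2 + e <= d ->
    `|(phi (r1 + e) - phi r1 - psi r1 * e) - (phi (r2 + e) - phi r2 - psi r2 * e)|
      <= B / 2 * e ^+ 2 * `|r1 - r2|.
Proof.
move=> dphi dpsi dchi xiB r1 r2 e r1I r2I r1e r2e.
(* The base points [r] for which [r] and [r + e] both lie in [[c, d]] form this interval. *)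
pose c' := Num.max c (c - e); pose d' := Num.min d (d - e).
have cd' r : (c' <= r <= d') = (c <= r <= d) && (c <= r + e <= d).
  rewrite /c' /d' ge_max le_min; apply/idP/idP.
    by move=> /andP[/andP[h1 h2] /andP[h3 h4]]; apply/andP; split; lra.
  move=> /andP[h1 h2].
  by apply/andP; split; apply/andP; split; lra.
apply: (@mvt_lip c' d' (fun r => phi (r + e) - phi r - psi r * e)
   (fun r => psi (r + e) - psi r - chi r * e)); rewrite ?cd' ?r1I ?r2I//.
  move=> r; rewrite cd' => /andP[rI reI].
  have h1 := dphi _ rI; have h2 := dpsi _ rI.
  have h3 : is_derive r 1 (fun r => phi (r + e)) (psi (r + e)).
    have := dphi _ reI => h.
    have hs : is_derive r 1 (fun r : R => r + e) 1.
      by apply: is_derive_eq; rewrite addr0.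
    have := @is_derive1_comp _ phi (fun r => r + e) r (psi (r + e)) 1 h hs.
    by rewrite mulr1.
  by apply: is_derive_eq; rewrite /GRing.scale/=; ring.
move=> r; rewrite cd' => /andP[rI reI].
have B1 z : c <= z <= d -> xi z <= B.
  by move=> /xiB; apply: le_trans; rewrite ler_norm.
have B2 z : c <= z <= d -> - B <= xi z.
  by move=> /xiB; rewrite ler_norml => /andP[].
have := bregman_le dpsi dchi B1 reI rI; have := bregman_ge dpsi dchi B2 reI rI.
rewrite (_ : r + e - r = e); last by ring.
rewrite ler_norml; move: (psi _) (psi _) (chi _) => p q s h1 h2.
by apply/andP; split => //; rewrite (le_trans _ h1)// le_eqVlt; apply/orP; left; apply/eqP; ring.
Qed.

Lemma cont_bounded c d phi : c <= d -> {within `[c, d], continuous phi} ->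
  exists B, forall x, c <= x <= d -> `|phi x| <= B.
Proof.
move=> cd cphi; have [u _ uM] := EVT_max cd cphi; have [v _ vM] := EVT_min cd cphi.
exists (Num.max `|phi u| `|phi v|) => x xI.
have h1 := uM x; have h2 := vM x; rewrite in_itv/= in h1 h2.
rewrite le_max; have := h1 xI; have := h2 xI; have := ler_norm (phi u).
have := ler_norm (- phi v); rewrite normrN => k1 k2 k3 k4.
have [p0|p0] := leP 0 (phi x).
  by rewrite ger0_norm// (le_trans k4 k2).
by rewrite ltr0_norm//; apply/orP; right; lra.
Qed.

End MeanValue.

(** * Mixed differences of products and compositions *)

Section MixedDifferences.
Context {R : realType}.
Implicit Types (K dl ep B : R).

(* X and Y are compared at two times 1, 2 at distance dl; ep is the distance
   in space between X and Y.  The last bound controls the difference of the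
   time increments. *)
Definition mixed K dl ep (X1 X2 Y1 Y2 : R) : Prop :=
  [/\ [/\ `|X1| <= K, `|X2| <= K, `|Y1| <= K & `|Y2| <= K],
      `|X1 - X2| <= K * dl /\ `|Y1 - Y2| <= K * dl,
      `|X1 - Y1| <= K * ep /\ `|X2 - Y2| <= K * ep
    & `|X1 - X2 - (Y1 - Y2)| <= K * dl * ep].

Lemma mixed_weaken K K' dl ep X1 X2 Y1 Y2 : 0 <= dl -> 0 <= ep -> K <= K' ->
  mixed K dl ep X1 X2 Y1 Y2 -> mixed K' dl ep X1 X2 Y1 Y2.
Proof.
move=> dl0 ep0 KK [[h1 h2 h3 h4] [h5 h6] [h7 h8] h9].
have hd : K * dl <= K' * dl by rewrite ler_wpM2r.
have he : K * ep <= K' * ep by rewrite ler_wpM2r.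
have hde : K * dl * ep <= K' * dl * ep by rewrite ler_wpM2r.
split; first by split; exact: le_trans KK.
- by split; exact: le_trans hd.
- by split; exact: le_trans he.
- exact: le_trans hde.
Qed.

Lemma mixedD K dl ep X1 X2 Y1 Y2 X1' X2' Y1' Y2' :
  mixed K dl ep X1 X2 Y1 Y2 -> mixed K dl ep X1' X2' Y1' Y2' ->
  mixed (2 * K) dl ep (X1 + X1') (X2 + X2') (Y1 + Y1') (Y2 + Y2').
Proof.
move=> [[a1 a2 a3 a4] [a5 a6] [a7 a8] a9] [[b1 b2 b3 b4] [b5 b6] [b7 b8] b9].
have add (x y k : R) : `|x| <= k -> `|y| <= k -> `|x + y| <= 2 * k.
  by move=> xk yk; rewrite (le_trans (ler_normD _ _))//; lra.
split; first by split; exact: add.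
- by rewrite -mulrA; split; rewrite opprD addrACA; exact: add.
- by rewrite -mulrA; split; rewrite opprD addrACA; exact: add.
- rewrite -mulrA -mulrA (mulrA K).
  rewrite (_ : _ - _ = (X1 - X2 - (Y1 - Y2)) + (X1' - X2' - (Y1' - Y2'))); last by ring.
  exact: add.
Qed.

(** Discrete product rule: the difference of increments splits into four terms, each of order
    [dl * ep], and the factor 4 counts them. *)
Lemma mixedM K dl ep X1 X2 Y1 Y2 X1' X2' Y1' Y2' : 0 <= K -> 0 <= dl -> 0 <= ep ->
  mixed K dl ep X1 X2 Y1 Y2 -> mixed K dl ep X1' X2' Y1' Y2' ->
  mixed (4 * K ^+ 2) dl ep (X1 * X1') (X2 * X2') (Y1 * Y1') (Y2 * Y2').
Proof.
move=> K0 dl0 ep0 [[a1 a2 a3 a4] [a5 a6] [a7 a8] a9] [[b1 b2 b3 b4] [b5 b6] [b7 b8] b9].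
have mul (x y k h : R) : `|x| <= k -> `|y| <= h -> `|x * y| <= k * h.
  by move=> xk yk; rewrite normrM ler_pM.
have K2 : K * K <= 4 * K ^+ 2 by rewrite expr2; have := mulr_ge0 K0 K0; lra.
have dif (x y x' y' e : R) : 0 <= e -> `|x| <= K -> `|y'| <= K -> `|x - y| <= K * e ->
    `|x' - y'| <= K * e -> `|x * x' - y * y'| <= 4 * K ^+ 2 * e.
  move=> e0 h1 h2 h3 h4; rewrite (_ : _ - _ = x * (x' - y') + (x - y) * y'); last by ring.
  rewrite (le_trans (ler_normD _ _))//.
  have := mul _ _ _ _ h1 h4; have := mul _ _ _ _ h3 h2.
  have := mulr_ge0 (mulr_ge0 K0 K0) e0; move: `|_ * _| `|_ * _| => p q; nra.
split.
- by split; rewrite (le_trans _ K2)//; exact: mul.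
- by split; apply: dif.
- by split; apply: dif.
- rewrite (_ : _ - _ = ((X1 - X2 - (Y1 - Y2)) * X1' + (Y1 - Y2) * (X1' - Y1')) +
    ((X2 - Y2) * (X1' - X2') + Y2 * (X1' - X2' - (Y1' - Y2')))); last by ring.
  have s1 := mul _ _ _ _ a9 b1; have s2 := mul _ _ _ _ a6 b7.
  have s3 := mul _ _ _ _ a8 b5; have s4 := mul _ _ _ _ a4 b9.
  rewrite (le_trans (ler_normD _ _))//.
  have t1 := ler_normD ((X1 - X2 - (Y1 - Y2)) * X1') ((Y1 - Y2) * (X1' - Y1')).
  have t2 := ler_normD ((X2 - Y2) * (X1' - X2')) (Y2 * (X1' - X2' - (Y1' - Y2'))).
  rewrite (_ : 4 * K ^+ 2 * dl * ep = (K * dl * ep * K + K * dl * (K * ep)) +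
    (K * ep * (K * dl) + K * (K * dl * ep))); last by ring.
  by rewrite lerD// (le_trans t1, le_trans t2)// lerD.
Qed.

(** The pairs [X2, X1] and [Y2, Y1] are joined by segments with a common parameter, and the mean
    value theorem is applied once, to the difference [k]. The same intermediate [t] then occurs on
    both segments, so the slopes [psi] are compared at points at distance at most [K * ep]; two
    separate mean values would lose the factor [ep]. *)
Lemma mixed_comp c d (phi psi chi : R -> R) B K dl ep X1 X2 Y1 Y2 :
  0 <= B -> 0 <= K -> 0 <= dl -> 0 <= ep ->
  deriv_on c d phi psi -> deriv_on c d psi chi ->
  (forall x, c <= x <= d -> [/\ `|phi x| <= B, `|psi x| <= B & `|chi x| <= B]) ->
  [/\ c <= X1 <= d, c <= X2 <= d, c <= Y1 <= d & c <= Y2 <= d] ->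
  mixed K dl ep X1 X2 Y1 Y2 ->
  mixed (B + B * K + B * K ^+ 2) dl ep (phi X1) (phi X2) (phi Y1) (phi Y2).
Proof.
move=> B0 K0 dl0 ep0 dphi dpsi bd [X1I X2I Y1I Y2I] [[a1 a2 a3 a4] [a5 a6] [a7 a8] a9].
have BK := mulr_ge0 B0 K0; have BK2 := mulr_ge0 BK K0.
have psiB x : c <= x <= d -> `|psi x| <= B by case/bd.
have chiB x : c <= x <= d -> `|chi x| <= B by case/bd.
have lip (x y e : R) : 0 <= e -> c <= x <= d -> c <= y <= d -> `|x - y| <= K * e ->
    `|phi x - phi y| <= (B + B * K + B * K ^+ 2) * e.
  move=> e0 xI yI xy; rewrite (le_trans (mvt_lip dphi psiB xI yI))//.
  rewrite (@le_trans _ _ (B * (K * e)))// ?ler_wpM2l//.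
  by rewrite mulrA ler_wpM2r// expr2 (mulrA B) addrAC lerDr addr_ge0.
have Bl : B <= B + B * K + B * K ^+ 2 by rewrite expr2 (mulrA B) -addrA lerDl addr_ge0.
split.
- by split; rewrite (le_trans _ Bl)//; [case: (bd X1)|case: (bd X2)|case: (bd Y1)|case: (bd Y2)].
- by split; apply: lip.
- by split; apply: lip.
pose g (u v t : R) := v + t * (u - v).
have gI (u v t : R) : c <= u <= d -> c <= v <= d -> 0 <= t <= 1 -> c <= g u v t <= d.
  by rewrite /g; clear; nra.
pose k (t : R) := phi (g X1 X2 t) - phi (g Y1 Y2 t).
pose dk (t : R) := psi (g X1 X2 t) * (X1 - X2) - psi (g Y1 Y2 t) * (Y1 - Y2).
have dg (u v t : R) : is_derive t 1 (g u v) (u - v).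
  by rewrite /g; apply: is_derive_eq; rewrite /GRing.scale/=; ring.
have dkE : deriv_on 0 1 k dk.
  move=> t tI.
  have h1 := @is_derive1_comp _ phi (g X1 X2) t _ _ (dphi _ (gI _ _ _ X1I X2I tI)) (dg X1 X2 t).
  have h2 := @is_derive1_comp _ phi (g Y1 Y2) t _ _ (dphi _ (gI _ _ _ Y1I Y2I tI)) (dg Y1 Y2 t).
  exact: is_deriveB.
have g1 (u v : R) : g u v 1 = u by rewrite /g mul1r addrC subrK.
have g0 (u v : R) : g u v 0 = v by rewrite /g mul0r addr0.
have [|||t tI] := mvt_on dkE (x := 1) (y := 0); rewrite ?lexx ?ler01//.
rewrite /k !g1 !g0 subr0 mulr1 /dk => E.
rewrite (_ : _ - _ = phi X1 - phi Y1 - (phi X2 - phi Y2)); last by ring.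
rewrite E.
have g1I := gI _ _ _ X1I X2I tI; have g2I := gI _ _ _ Y1I Y2I tI.
have gg : `|g X1 X2 t - g Y1 Y2 t| <= K * ep.
  rewrite (_ : _ - _ = (1 - t) * (X2 - Y2) + t * (X1 - Y1)); last by rewrite /g; ring.
  rewrite (le_trans (ler_normD _ _))// !normrM; case/andP: tI => t0 t1.
  rewrite (ger0_norm (_ : 0 <= 1 - t)) ?subr_ge0// (ger0_norm t0).
  by move: t0 t1; clear - a7 a8; move: a7 a8; move: `|X2 - Y2| `|X1 - Y1| (K * ep) => p q r; nra.
rewrite (_ : _ - _ = psi (g X1 X2 t) * (X1 - X2 - (Y1 - Y2)) +
   (psi (g X1 X2 t) - psi (g Y1 Y2 t)) * (Y1 - Y2)); last by ring.
have s1 : `|psi (g X1 X2 t) * (X1 - X2 - (Y1 - Y2))| <= B * (K * dl * ep).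
  by rewrite normrM ler_pM// psiB.
have s2 : `|(psi (g X1 X2 t) - psi (g Y1 Y2 t)) * (Y1 - Y2)| <= B * (K * ep) * (K * dl).
  rewrite normrM ler_pM// (le_trans (mvt_lip dpsi chiB g1I g2I))//.
  by rewrite ler_wpM2l.
rewrite (le_trans (ler_normD _ _))// (le_trans (lerD s1 s2))//.
rewrite -subr_ge0 (_ : _ - _ = B * (dl * ep)); first by rewrite !mulr_ge0.
by ring.
Qed.

End MixedDifferences.

(** * Piecewise affine functions and integration by parts *)

Section PiecewiseAffine.
Context {R : realType} (l : R) (M : nat) (l_gt0 : 0 < l) (M_gt0 : (0 < M)%N).
Local Notation nd := (node l M).
Implicit Types (r h d X : R -> R).

Lemma derive1_affine (r : R -> R) (u v a b x : R) : u < x < v ->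
  (forall y, u <= y <= v -> r y = a + b * y) -> derive1 r x = b.
Proof.
move=> /andP[ux xv] rE; rewrite derive1E.
have H : is_derive x 1 (fun y : R => a + b * y) b.
  by apply: is_derive_eq; rewrite /GRing.scale/=; ring.
rewrite (@near_eq_derive _ _ _ _ (fun y => a + b * y)); first by case: H.
near=> y; apply: rE; apply/andP; split.
- by apply: ltW; near: y; exact: lt_nbhsr.
- by apply: ltW; near: y; exact: lt_nbhsl.
Unshelve. all: by end_near. Qed.

Lemma Rh_slopes r : Rh l M r -> exists B, 0 <= B /\
  forall i, (i < M)%N -> exists a b, [/\ `|b| <= B,
    forall x, nd i <= x <= nd i.+1 -> r x = a + b * x &
    forall x, nd i < x < nd i.+1 -> derive1 r x = b].
Proof.
move=> [_ rA].
suff : forall k, (k <= M)%N -> exists B, 0 <= B /\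
  forall i, (i < k)%N -> exists a b, [/\ `|b| <= B,
    forall x, nd i <= x <= nd i.+1 -> r x = a + b * x &
    forall x, nd i < x < nd i.+1 -> derive1 r x = b] by move=> /(_ M (leqnn M)).
elim=> [_|k ih kM]; first by exists 0.
have [B [B0 HB]] := ih (ltnW kM); have [a [b rE]] := rA k kM.
exists (Num.max B `|b|); split; first by rewrite le_max B0.
move=> i; rewrite ltnS leq_eqVlt => /predU1P[->|/HB[a' [b' [bB' h1 h2]]]].
  exists a, b; split => //; first by rewrite le_max lexx orbT.
  by move=> x xI; exact: derive1_affine xI rE.
by exists a', b'; split => //; rewrite le_max bB'.
Qed.

Lemma bm_Rh r : Rh l M r -> bmeas 0 l r /\ bmeas 0 l (derive1 r).
Proof.
move=> /Rh_slopes[B [B0 HB]]; split; apply: (bm_cells l_gt0 M_gt0) => i iM;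
  have [a [b [bB rE dE]]] := HB i iM.
  by apply: (@bm_lip _ _ _ _ `|b|) => x y xI yI; rewrite !rE// -normrM;
    rewrite (_ : _ - _ = b * (x - y)) ?lexx//; ring.
by apply: bm_open dE; exact: bm_cst.
Qed.

Lemma Rh_primitive r x : Rh l M r -> 0 <= x <= l -> intg 0 x (derive1 r) = r x.
Proof.
move=> rR; have [r0 _] := rR; have [br bdr] := bm_Rh rR.
move: rR => /Rh_slopes[B [B0 HB]] xl.
have := @increment_cells _ l M l_gt0 M_gt0 (fun x => intg 0 x (derive1 r) - r x) (fun=> 0) 0.
move=> /(_ _ x xl) h; apply/eqP; rewrite -subr_eq0 -normr_le0.
have {h} := h; rewrite intg_xx r0 !subr0; apply.
move=> i u v iM iv vu ui; have [a [b [bB rE dE]]] := HB i iM.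
have i0 := node_ge0 l_gt0 M_gt0 i.
have il : nd i.+1 <= l by apply: node_le_l.
have bu : bmeas 0 u (derive1 r) by apply: bm_sub bdr => //; lra.
rewrite (intg_split _ vu bu); last by lra.
rewrite !rE; [|lra|lra].
have -> : intg v u (derive1 r) = intg v u (fun=> b).
  apply: eq_intg_ae; [by apply: bm_sub bu => //; lra|exact: bm_cst|].
  apply: aeS (ae_neq2 v u).
  move=> z [zv zu]; rewrite /= in_itv/= => zI; apply: dE; lra.
rewrite intg_cst// mul0r addr0.
rewrite (_ : _ - _ = 0) ?normr0//.
by move: (Rintegral _ _ _) => I; ring.
Qed.

Section ByParts.
Variables (r h : R -> R) (L : R).
Hypotheses (rR : Rh l M r) (L0 : 0 <= L).
Hypothesis hL : forall x y, 0 <= x <= l -> 0 <= y <= l -> `|h x - h y| <= L * `|x - y|.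

Let bh : bmeas 0 l h. Proof. exact: bm_lip hL. Qed.
Let br : bmeas 0 l r. Proof. by have [] := bm_Rh rR. Qed.
Let bdr : bmeas 0 l (derive1 r). Proof. by have [] := bm_Rh rR. Qed.

Let F x := intg 0 x (fun y => h y * derive1 r y) - h x * r x.

(** Within a cell, the integral of [h] times the slope of [r] equals [h x] times the increment of
    [r] up to a quadratic error. The first-order part left in [F] is [(h y - h x) * r y], with the
    increment on [h] and no slope of [r]. *)
Let F_increment : exists K, 0 <= K /\ forall i x y, (i < M)%N ->
  nd i <= y -> y <= x -> x <= nd i.+1 ->
  `|F x - F y - (h y - h x) * r y| <= K * (x - y) ^+ 2 /\
  (forall z, y <= z <= x -> `|r z - r y| <= K * (x - y)).
Proof.
have [B [B0 HB]] := Rh_slopes rR; exists (Num.max (L * B) B); split.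
  by rewrite le_max B0 orbT.
move=> i x y iM iy yx xi; have [a [b [bB rE dE]]] := HB i iM; split; last first.
  move=> z zI; rewrite !rE; [|lra|lra].
  rewrite (_ : _ - _ = b * (z - y)); last by ring.
  rewrite normrM ler_pM// ?le_max ?bB ?orbT// ger0_norm; lra.
have i0 := node_ge0 l_gt0 M_gt0 i.
have il : nd i.+1 <= l by apply: node_le_l.
have bhr : bmeas 0 l (fun y => h y * derive1 r y) by exact: bmM.
have bhx : bmeas 0 x (fun y => h y * derive1 r y) by apply: bm_sub bhr => //; lra.
have bhyx : bmeas y x (fun y => h y * derive1 r y) by apply: bm_sub bhx => //; lra.
have bhb : bmeas y x (fun z => h z * b - h x * b).
  apply: bmB; last exact: bm_cst.
  by apply: bmM; [apply: bm_sub bh; lra|exact: bm_cst].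
rewrite /F (intg_split _ yx bhx); last by lra.
have -> : intg y x (fun y => h y * derive1 r y) =
    intg y x (fun z => h z * b - h x * b) + h x * b * (x - y).
  rewrite -intg_cst// -intgD//; last exact: bm_cst.
  apply: eq_intg_ae => //; first by apply: bmD => //; exact: bm_cst.
  apply: aeS (ae_neq2 y x).
    move=> z [zv zu]; rewrite /= in_itv/= => zI; rewrite (dE z); last lra.
    by rewrite subrK.
have : `|intg y x (fun z => h z * b - h x * b)| <= L * (x - y) * B * (x - y).
  apply: intg_boundW => // z zI; rewrite -mulrBl normrM ler_pM//.
  rewrite (le_trans (hL _ _))//; [lra|lra|].
  by rewrite ler_wpM2l// ler0_norm; lra.
rewrite !rE; [|lra|lra].
move: (intg y x _) => I hI.
rewrite (_ : _ - _ = I); last by move: (Rintegral _ _ _) => J; ring.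
rewrite (le_trans hI)// (_ : _ * _ = L * B * (x - y) ^+ 2); last by ring.
by rewrite ler_wpM2r ?sqr_ge0// le_max lexx.
Qed.

(** Integration by parts for [h] merely Lipschitz, as time increments of the enthalpy are. Only the
    size of [r] survives on the right, not its slopes, which is the form in which residuals can be
    absorbed. *)
Lemma Rh_parts_le :
  `|intg 0 l (fun y => h y * derive1 r y) - h l * r l| <=
  L * intg 0 l (fun x => `|r x|).
Proof.
have [K [K0 HK]] := F_increment.
have br' := bm_norm br.
have := @increment_cells _ l M l_gt0 M_gt0 F (fun x => L * intg 0 x (fun x => `|r x|)) (K + L * K).
move=> /(_ _ l) H.
have : `|F l - F 0| <= L * intg 0 l (fun x => `|r x|) - L * intg 0 0 (fun x => `|r x|).
  apply: H; last by rewrite lexx ltW.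
  move=> i x y iM iy yx xi; have [h1 h2] := HK i x y iM iy yx xi.
  have i0 := node_ge0 l_gt0 M_gt0 i.
  have il : nd i.+1 <= l by apply: node_le_l.
  have brx : bmeas 0 x (fun x => `|r x|) by apply: bm_sub br' => //; lra.
  have bryx : bmeas y x (fun x => `|r x|) by apply: bm_sub brx => //; lra.
  have h3 : (`|r y| - K * (x - y)) * (x - y) <= intg y x (fun x => `|r x|).
    rewrite -intg_cst//; apply: le_intg => //; first exact: bm_cst.
    move=> z zI; have := h2 z zI; have := lerB_dist (r y) (r z).
    rewrite (distrC (r y)); move: `|r y| `|r z| `|r z - r y| => p q s; lra.
  have h4 : `|(h y - h x) * r y| <= L * (x - y) * `|r y|.
    rewrite normrM ler_wpM2r// (le_trans (hL _ _))//; [lra|lra|].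
    by rewrite ler_wpM2l// ler0_norm; lra.
  rewrite (intg_split _ yx brx); last by lra.
  rewrite (_ : F x - F y = (F x - F y - (h y - h x) * r y) + (h y - h x) * r y); last by ring.
  rewrite (le_trans (ler_normD _ _))//.
  have h5 := ler_wpM2l L0 h3.
  move: h1 h4 h5; move: `|_ * _| `|_ - _ - _| `|r y| (intg y x _) (intg 0 y _) => p q s I J.
  move=> h1 h4 h5; rewrite (le_trans (lerD h1 h4))//.
  rewrite -subr_ge0 (_ : _ - _ = L * I - L * ((s - K * (x - y)) * (x - y))); last by ring.
  by rewrite subr_ge0.
rewrite /F !intg_xx (proj1 rR) !mulr0 !subr0.
by apply.
Qed.

(** When [h] is a primitive of [X], the first-order part of the increment of [F] is cancelled by
    that of the integral of [X * r]; the sum has quadratic increments and is therefore constant. *)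
Lemma Rh_parts X : (forall x, 0 <= x <= l -> `|X x| <= L) ->
  measurable_fun `[0, l] X -> (forall x, 0 <= x <= l -> h x = h 0 + intg 0 x X) ->
  intg 0 l (fun y => X y * r y) =
    h l * r l - intg 0 l (fun y => h y * derive1 r y).
Proof.
move=> XL mX hX; have [K [K0 HK]] := F_increment.
have bX : bmeas 0 l X by exact: bm_ae XL.
have bXr := bmM bX br.
have := @increment_cells _ l M l_gt0 M_gt0
  (fun x => F x + intg 0 x (fun y => X y * r y)) (fun=> 0) (K + L * K).
move=> /(_ _ l) H.
have : `|F l + intg 0 l (fun y => X y * r y) - (F 0 + intg 0 0 (fun y => X y * r y))| <= 0 - 0.
  apply: H; last by rewrite lexx ltW.
  move=> i x y iM iy yx xi; have [h1 h2] := HK i x y iM iy yx xi.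
  have i0 := node_ge0 l_gt0 M_gt0 i.
  have il : nd i.+1 <= l by apply: node_le_l.
  have bx : bmeas 0 x (fun y => X y * r y) by apply: bm_sub bXr => //; lra.
  have by' : bmeas y x (fun y => X y * r y) by apply: bm_sub bx => //; lra.
  have bXyx : bmeas y x X by apply: bm_sub bX => //; lra.
  have bXx : bmeas 0 x X by apply: bm_sub bX => //; lra.
  have bryx : bmeas y x r by apply: bm_sub br => //; lra.
  have hxy : h x - h y = intg y x X.
    rewrite (hX x); last lra; rewrite (hX y); last lra.
    by rewrite (intg_split _ yx bXx); [move: (Rintegral _ _ _) (Rintegral _ _ _) => I J; ring|lra].
  have bXc : bmeas y x (fun z => X z * (r z - r y)).
    by apply: bmM => //; apply: bmB => //; exact: bm_cst.
  have h3 : intg y x (fun y => X y * r y) =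
      intg y x (fun z => X z * (r z - r y)) + r y * (h x - h y).
    rewrite hxy -intgZ// -intgD//; last exact: bmZ.
    by apply: eq_intg => z _; ring.
  have h4 : `|intg y x (fun z => X z * (r z - r y))| <= L * (K * (x - y)) * (x - y).
    apply: intg_boundW => // z zI; rewrite normrM ler_pM//; last exact: h2.
    by apply: XL; lra.
  rewrite (intg_split _ yx bx); last by lra.
  rewrite h3; move: h1 h4; move: (intg y x _) (intg 0 y _) => I J h1 h4.
  rewrite (_ : _ - _ = (F x - F y - (h y - h x) * r y) + I); last by ring.
  rewrite (le_trans (ler_normD _ _))// (le_trans (lerD h1 h4))//.
  by rewrite subrr add0r le_eqVlt; apply/orP; left; apply/eqP; ring.
rewrite subrr normr_le0 /F !intg_xx (proj1 rR) !mulr0 !subr0 addr0 subr0 => /eqP.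
by move: (Rintegral _ _ _) (Rintegral _ _ _) => I J E; apply/eqP; rewrite -subr_eq0 -[X in _ == X]E; apply/eqP; ring.
Qed.

End ByParts.

End PiecewiseAffine.

(** * Residuals of the reference solution *)

Section Residuals.
Context {R : realType}.
Local Notation lmu := (@lebesgue_measure R).
Implicit Types (l a b s t : R) (f ft X S : R -> R -> R).

(** The increment of [f] is the time integral of [ft]; Fubini moves the time integral outside, and
    the equation replaces [ft] by [S - X]. [V] is the resulting space pairing frozen at one time,
    and [C] bounds its oscillation over the step. *)
Lemma transport l f ft X S (phi : R -> R) a b s t V C B :
  0 <= a -> a <= b -> b <= l -> 0 <= s -> s <= t ->
  Linf_loc l ft -> Linf_loc l X -> time_primitive l f ft ->
  {ae lmu, forall u, {ae lmu, forall y, cylinder l (u, y) ->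
    ft u y + X u y = S u y}} ->
  measurable_fun `[a, b] phi -> (forall y, a <= y <= b -> `|phi y| <= B) ->
  (forall u, s <= u <= t -> bmeas a b (S u)) ->
  (forall u, s <= u <= t ->
    `|intg a b (fun y => (S u y - X u y) * phi y) - V| <= C) ->
  `|intg a b (fun y => (f t y - f s y) * phi y) - (t - s) * V| <= C * (t - s).
Proof.
move=> a0 ab bl s0 st [mft ftB] [mX XB] tp eqn mphi phiB bS SV.
have [Bf hBf] := ftB t; have [BX hBX] := XB t.
have bphi : bmeas a b phi by exact: bm_ae phiB.
have sub : [set` `[a, b]] `<=` [set` `[0, l]] by apply: subset_itv; rewrite bnd_simp.
have ut u : s <= u <= t -> 0 <= u <= t by case/andP => su ->; rewrite (le_trans s0 su).
have ut0 u : s <= u <= t -> 0 <= u by move=> /ut/andP[].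
have yl y : a <= y <= b -> Omega l y.
  by case/andP => ay yb; rewrite /Omega /= in_itv/= (le_trans a0 ay) (le_trans yb bl).
have bft u : s <= u <= t -> bmeas a b (ft u).
  move=> ust; apply: (@bm_ae _ _ _ _ Bf).
    by apply: measurable_funS (measurable_secx _ mft) => //; exact: ut0.
  by move=> y yab; apply: hBf; [exact: ut|exact: yl].
have bX u : s <= u <= t -> bmeas a b (X u).
  move=> ust; apply: (@bm_ae _ _ _ _ BX).
    by apply: measurable_funS (measurable_secx _ mX) => //; exact: ut0.
  by move=> y yab; apply: hBX; [exact: ut|exact: yl].
have bfty y : a <= y <= b -> bmeas 0 t (ft^~ y).
  move=> yab; apply: (@bm_ae _ _ _ _ Bf); last by move=> u u0t; apply: hBf (yl y yab).
  apply: measurable_funS (measurable_sect (yl y yab) mft) => //.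
  by move=> u; rewrite /= !in_itv/= andbT => /andP[].
have fE y : a <= y <= b -> f t y - f s y = intg s t (ft^~ y).
  move=> yab; have yO := yl y yab; rewrite (tp t y)//; last exact: le_trans s0 st.
  rewrite (tp s y)// (intg_split s0 st (bfty y yab)).
  by move: (Rintegral _ _ _) (Rintegral _ _ _) => I J; ring.
have [|u y ust yab|g1 g2 g3] := @fubini_rect _ s t a b (Bf * B) (fun u y => ft u y * phi y).
- apply: measurable_funM.
    apply: measurable_funS mft; first exact: measurable_cylinder.
    move=> [u y] [/=]; rewrite !in_itv/= => ust yab.
    by split; [exact: ut0|exact: yl].
  apply: (@measurable_comp _ _ _ _ _ _ `[a, b] phi _ (@snd R R)) => //.
  - by move=> _ [[u y] [/= _ yab] <-].
  - exact: measurable_funTS.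
- rewrite normrM ler_pM//; last exact: phiB.
  by apply: hBf; [exact: ut|exact: yl].
have -> : intg a b (fun y => (f t y - f s y) * phi y) =
    intg s t (fun u => intg a b (fun y => ft u y * phi y)).
  rewrite g3; apply: eq_intg => y yab; rewrite fE// mulrC -intgZ.
    by apply: eq_intg => u _; rewrite mulrC.
  exact: bm_sub s0 (lexx t) (bfty y yab).
rewrite (mulrC (t - s)) -(intg_cst V st) -(intgB g1 (bm_cst _ _ _)).
apply: (intg_bound st (bmB g1 (bm_cst _ _ _))).
apply: aeS eqn => u eqn; rewrite /= in_itv/= => ust.
suff -> : intg a b (fun y => ft u y * phi y) = intg a b (fun y => (S u y - X u y) * phi y).
  exact: SV.
apply: eq_intg_ae; first exact: bmM (bft u ust) bphi.
  by apply: bmM bphi; apply: bmB; [exact: bS|exact: bX].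
apply: aeS eqn => y eqn; rewrite /= in_itv/= => yab.
by rewrite -eqn ?addrK//; split; [exact: ut0|exact: yl].
Qed.

Lemma mixed_cst (K dl ep c : R) : 0 <= K -> 0 <= dl -> 0 <= ep -> `|c| <= K ->
  mixed K dl ep c c c c.
Proof. by move=> K0 dl0 ep0 cK; split => //; rewrite !subrr normr0 ?mulr_ge0. Qed.

(** Difference quotients are used in place of derivatives because this form passes through products,
    smooth compositions, cell averages and nodal interpolation. *)
Definition mixed_lip l (K : R) f : Prop := forall s t x y,
  0 <= s -> 0 <= t -> 0 <= x <= l -> 0 <= y <= l ->
  mixed K `|t - s| `|x - y| (f t x) (f s x) (f t y) (f s y).

Lemma mixed_lip_space l K f t x y : mixed_lip l K f -> 0 <= t ->
  0 <= x <= l -> 0 <= y <= l -> `|f t x - f t y| <= K * `|x - y|.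
Proof. by move=> fK t0 xl yl; have [_ _ [+ _] _] := fK t t x y t0 t0 xl yl. Qed.

Lemma mixed_lip_time l K f s t x : mixed_lip l K f -> 0 <= s -> 0 <= t ->
  0 <= x <= l -> `|f t x - f s x| <= K * `|t - s|.
Proof. by move=> fK s0 t0 xl; have [_ [+ _] _ _] := fK s t x x s0 t0 xl xl. Qed.

Lemma mixed_lip_bm l K f t : mixed_lip l K f -> 0 <= t -> bmeas 0 l (f t).
Proof.
by move=> fK t0; apply: (@bm_lip _ _ _ _ K) => x y xl yl; exact: mixed_lip_space fK t0 xl yl.
Qed.

Lemma mixed_lip_bound l K f t x : mixed_lip l K f -> 0 <= t -> 0 <= x <= l ->
  `|f t x| <= K.
Proof. by move=> fK t0 xl; have [[+ _ _ _] _ _ _] := fK t t x x t0 t0 xl xl. Qed.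

(** Freezing the flux at time [t] costs the mixed difference of [m] over [[s, t]] and [[a, b]]. Its
    factor [b - a] cancels the later division by the cell length. *)
Lemma mass_residual l K K1 f ft (m mx s1 : R -> R -> R) :
  0 < l -> 0 <= K -> 0 <= K1 -> Linf_loc l ft -> Linf_loc l mx ->
  time_primitive l f ft -> space_primitive l m mx ->
  {ae lmu, forall u, {ae lmu, forall y, cylinder l (u, y) ->
    ft u y + mx u y = s1 u y}} ->
  mixed_lip l K m -> (forall t, 0 <= t -> bmeas 0 l (s1 t)) ->
  (forall s t x, 0 <= s -> 0 <= t -> 0 <= x <= l ->
    `|s1 t x - s1 s x| <= K1 * `|t - s|) ->
  forall s t a b, 0 <= s -> s <= t -> 0 <= a -> a <= b -> b <= l ->
  `|intg a b (fun y => f t y - f s y)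
    - (t - s) * (intg a b (s1 t) - (m t b - m t a))|
  <= (K + K1) * (b - a) * (t - s) ^+ 2.
Proof.
move=> l0 K0 K10 ftL mxL tp sp eqn mK bs1 s1L s t a b s0 st a0 ab bl.
have bs u : 0 <= u -> bmeas a b (s1 u) by move=> u0; apply: bm_sub (bs1 u u0).
have bmx u : s <= u <= t -> bmeas 0 b (mx u).
  have [mmx mxB] := mxL; have [B hB] := mxB t; move=> ust.
  apply: (@bm_ae _ _ _ _ B).
    apply: measurable_funS (measurable_secx _ mmx) => //; last lra.
    by apply: subset_itv; rewrite bnd_simp.
  move=> y /andP[y0 yb]; have /andP[su ut] := ust; apply: hB.
    by rewrite (le_trans s0 su).
  by rewrite /Omega /= in_itv/= y0 (le_trans yb).
rewrite (expr2 (t - s)) mulrA.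
have := @transport l f ft mx s1 (fun=> 1) a b s t
  (intg a b (s1 t) - (m t b - m t a)) ((K + K1) * (b - a) * (t - s)) 1 a0 ab bl
  s0 st ftL mxL tp eqn (measurable_cst _) _ _ _.
rewrite [X in _ -> _ -> _ -> `|X - _| <= _](@eq_intg _ a b _ (fun y => f t y - f s y)); last first.
  by move=> y _; rewrite mulr1.
apply.
- by move=> y _; rewrite normr1.
- by move=> u ust; apply: bs; lra.
move=> u ust; have u0 : 0 <= u by lra.
have bmxab : bmeas a b (mx u) by apply: bm_sub (bmx u ust).
rewrite (@eq_intg _ a b _ (fun y => s1 u y - mx u y)); last by move=> y _; rewrite mulr1.
rewrite intgB//; last by exact: bs.
have -> : intg a b (mx u) = m u b - m u a.
  rewrite (sp u b)//; last by rewrite /Omega /= in_itv/=; lra.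
  rewrite (sp u a)//; last by rewrite /Omega /= in_itv/=; lra.
  rewrite (intg_split a0 ab (bmx u ust)).
  by move: (Rintegral _ _ _) (Rintegral _ _ _) => I J; ring.
have h1 : `|intg a b (s1 u) - intg a b (s1 t)| <= K1 * (t - s) * (b - a).
  rewrite -intgB//; [|exact: bs|by apply: bs; lra].
  apply: intg_boundW => //; first by apply: bmB; apply: bs; lra.
  move=> y yab; rewrite (le_trans (s1L t u y _ _ _))//; [lra|lra|].
  by rewrite ler_wpM2l// distrC ger0_norm ?lerD2l ?lerN2 ?subr_ge0; by case/andP: ust.
have h2 : `|(m t b - m u b) - (m t a - m u a)| <= K * (t - s) * (b - a).
  have [_ _ _ h] := mK u t b a u0 (le_trans s0 st) ltac:(lra) ltac:(lra).
  rewrite (le_trans h)// (ger0_norm (_ : 0 <= b - a)); last lra.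
  rewrite ler_wpM2r; [by []|lra|].
  by rewrite ler_wpM2l// ger0_norm; lra.
move: h1 h2; move: (intg a b (s1 u)) (intg a b (s1 t)) => I J h1 h2.
rewrite (_ : _ - _ = (I - J) + ((m t b - m u b) - (m t a - m u a))); last by ring.
rewrite (le_trans (ler_normD _ _))// (le_trans (lerD h1 h2))//.
by rewrite le_eqVlt; apply/orP; left; apply/eqP; ring.
Qed.

Lemma absM_lip (K x y : R) : `|x| <= K -> `|y| <= K ->
  `| `|x| * x - `|y| * y| <= 2 * K * `|x - y|.
Proof.
move=> xK yK; rewrite (_ : _ - _ = `|x| * (x - y) + (`|x| - `|y|) * y); last by ring.
rewrite (le_trans (ler_normD _ _))// !normrM normr_id.
have h1 : `| `|x| - `|y| | <= `|x - y| by exact: ler_dist_dist.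
have h2 := ler_pM (normr_ge0 _) (normr_ge0 _) h1 yK.
have h3 := ler_wpM2r (normr_ge0 (x - y)) xK.
rewrite (le_trans (lerD h3 h2))// le_eqVlt; apply/orP; left; apply/eqP; ring.
Qed.

(** Freezing the enthalpy at time [t] leaves [h u - h t] paired with the slope of [r]. By the mixed
    bound this increment has space Lipschitz constant [K * (t - s)], and [Rh_parts_le] trades the
    slope for the L1 norm of [r]. *)
Lemma momentum_residual l K K2 (g : R) v vt (h hx s2 : R -> R -> R) :
  0 < l -> 0 <= K -> 0 <= K2 -> 0 <= g -> Linf_loc l vt -> Linf_loc l hx ->
  time_primitive l v vt -> space_primitive l h hx ->
  {ae lmu, forall u, {ae lmu, forall y, cylinder l (u, y) ->
    vt u y + hx u y + g * `|v u y| * v u y = s2 u y}} ->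
  mixed_lip l K v -> mixed_lip l K h -> (forall t, 0 <= t -> bmeas 0 l (s2 t)) ->
  (forall s t x, 0 <= s -> 0 <= t -> 0 <= x <= l ->
    `|s2 t x - s2 s x| <= K2 * `|t - s|) ->
  forall M r s t, (0 < M)%N -> Rh l M r -> 0 <= s -> s <= t ->
  `|intg 0 l (fun y => (v t y - v s y) * r y)
    - (t - s) * (intg 0 l (fun y => (s2 t y - g * (`|v t y| * v t y)) * r y)
      + intg 0 l (fun y => h t y * derive1 r y) - h t l * r l)|
  <= (K2 + g * (2 * K ^+ 2) + K) * intg 0 l (fun y => `|r y|) * (t - s) ^+ 2.
Proof.
move=> l0 K0 K20 g0 vtL hxL tp sp eqn vK hK bs2 s2L M r s t M0 rR s0 st.
have [br bdr] := bm_Rh l0 M0 rR; have t0 := le_trans s0 st.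
have [Br rB] : exists B, forall y, 0 <= y <= l -> `|r y| <= B.
  have [L hL] := prim_lip bdr; exists (`|L| * l) => y yl.
  have := hL y 0 yl ltac:(rewrite lexx ltW//).
  rewrite (Rh_primitive l0 M0 rR yl) intg_xx !subr0 => /le_trans; apply.
  rewrite (@le_trans _ _ (`|L| * `|y|))// ?ler_wpM2r ?ler_norm//.
  by rewrite ler_wpM2l// ger0_norm; lra.
pose S u y := s2 u y - g * (`|v u y| * v u y).
have bS u : 0 <= u -> bmeas 0 l (S u).
  move=> u0; have bv := mixed_lip_bm vK u0.
  by apply: bmB; [exact: bs2|apply: bmZ; apply: bmM => //; exact: bm_norm].
have eqn' : {ae lmu, forall u, {ae lmu, forall y, cylinder l (u, y) ->
    vt u y + hx u y = S u y}}.
  apply: aeS eqn => u eqn; apply: aeS eqn => y eqn yc.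
  by rewrite /S -(eqn yc); ring.
rewrite (expr2 (t - s)) mulrA.
apply: (@transport l v vt hx S r 0 l s t _ _ Br (lexx 0) (ltW l0) (lexx l) s0 st
  vtL hxL tp eqn') => //.
- by case: br.
- by move=> u ust; apply: bS; lra.
move=> u ust; have u0 : 0 <= u by lra.
have [mhx hxB] := hxL; have [B hB] := hxB t.
have bhx : bmeas 0 l (hx u).
  apply: (@bm_ae _ _ _ _ B); first exact: measurable_secx mhx.
  move=> y yl; have /andP[_ ut] := ust; apply: hB; first by rewrite u0.
  by rewrite /Omega /= in_itv.
have parts : intg 0 l (fun y => hx u y * r y) =
    h u l * r l - intg 0 l (fun y => h u y * derive1 r y).
  apply: (@Rh_parts _ l M l0 M0 r (h u) (Num.max K B)) => //.
  - by rewrite le_max K0.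
  - move=> x y xl yl; rewrite (le_trans (mixed_lip_space hK u0 xl yl))//.
    by rewrite ler_wpM2r// le_max lexx.
  - by move=> x xl; rewrite le_max hB ?orbT//; lra.
  - exact: measurable_secx mhx.
  - by move=> x xl; apply: sp.
have -> : intg 0 l (fun y => (S u y - hx u y) * r y) =
    intg 0 l (fun y => S u y * r y) - intg 0 l (fun y => hx u y * r y).
  rewrite -intgB; [|by apply: bmM => //; exact: bS|exact: bmM].
  by apply: eq_intg => y _; rewrite mulrBl.
rewrite parts.
have bhu := mixed_lip_bm hK u0; have bht := mixed_lip_bm hK t0.
have h1 : `|intg 0 l (fun y => S u y * r y) - intg 0 l (fun y => S t y * r y)| <=
    (K2 + g * (2 * K ^+ 2)) * (t - s) * intg 0 l (fun y => `|r y|).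
  rewrite -intgB; [|by apply: bmM => //; exact: bS..].
  rewrite -intgZ; last exact: bm_norm.
  have bD : bmeas 0 l (fun y => S u y * r y - S t y * r y).
    by apply: bmB; apply: bmM => //; exact: bS.
  apply: le_trans (ler_norm_intg bD) _; apply: le_intg; [exact: bm_norm| |].
    by apply: bmZ; exact: bm_norm.
  move=> y yl; rewrite -mulrBl normrM ler_wpM2r// /S.
  rewrite (_ : _ - _ = (s2 u y - s2 t y) + g * (`|v t y| * v t y - `|v u y| * v u y)); last by ring.
  rewrite (le_trans (ler_normD _ _))// mulrDl lerD//.
    rewrite (le_trans (s2L t u y _ _ _))// ler_wpM2l// ler0_norm; lra.
  rewrite normrM ger0_norm// -mulrA ler_wpM2l//.
  have va := mixed_lip_bound vK t0 yl; have vb := mixed_lip_bound vK u0 yl.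
  apply: le_trans (absM_lip va vb) _.
  rewrite (_ : 2 * K ^+ 2 * (t - s) = 2 * K * (K * (t - s))); last by ring.
  rewrite ler_wpM2l ?mulr_ge0//.
  rewrite (le_trans (mixed_lip_time vK u0 t0 yl))// ler_wpM2l// ger0_norm; lra.
have h2 : `|intg 0 l (fun y => (h u y - h t y) * derive1 r y) - (h u l - h t l) * r l| <=
    K * (t - s) * intg 0 l (fun y => `|r y|).
  apply: (Rh_parts_le l0 M0 rR (h := fun y => h u y - h t y)).
    by rewrite mulr_ge0// subr_ge0.
  move=> x y xl yl; have [_ _ _ H] := hK t u x y t0 u0 xl yl.
  apply: le_trans H _.
  by rewrite ler_wpM2r// ler_wpM2l// ler0_norm; lra.
have E : intg 0 l (fun y => (h u y - h t y) * derive1 r y) =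
    intg 0 l (fun y => h u y * derive1 r y) - intg 0 l (fun y => h t y * derive1 r y).
  rewrite -intgB; [|exact: bmM..].
  by apply: eq_intg => y _; rewrite mulrBl.
rewrite E in h2; move: h1 h2.
have -> : intg 0 l (fun y => S t y * r y) =
  intg 0 l (fun y => (s2 t y - g * (`|v t y| * v t y)) * r y) by [].
move: (intg 0 l (fun y => S u y * r y)) (intg 0 l (fun y => h u y * derive1 r y)) => I1 I2.
move: (intg 0 l (fun y => (_ - _) * r y)) (intg 0 l (fun y => h t y * derive1 r y)) => J1 J2.
move: (intg 0 l (fun y => `|r y|)) => N h1 h2.
rewrite (_ : _ - _ = (I1 - J1) + (I2 - J2 - (h u l - h t l) * r l)); last by ring.
rewrite (le_trans (ler_normD _ _))// (le_trans (lerD h1 h2))//.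
by rewrite le_eqVlt; apply/orP; left; apply/eqP; ring.
Qed.

End Residuals.

(** * The pressure potential near the admissible densities *)

Section Pressure.
Context {R : realType} (p : param R) (hp : valid_param p).

(** [kap] is the distance by which an argument of [pot p] may leave [[rho_lo, rho_hi]]: the discrete
    chain rule evaluates it at the new reference density plus the old error. *)
Record pressure_bounds (kap B : R) : Prop := PressureBounds {
  pb_kap : 0 < kap <= rho_lo p / 2;
  pb_B : 0 < B;
  pb_d0 : deriv_on (rho_lo p - kap) (rho_hi p + kap) (pot p) (derive1 (pot p));
  pb_d1 : deriv_on (rho_lo p - kap) (rho_hi p + kap) (derive1 (pot p)) (derive1n 2 (pot p));
  pb_d2 : deriv_on (rho_lo p - kap) (rho_hi p + kap) (derive1n 2 (pot p)) (derive1n 3 (pot p));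
  pb_bd : forall x, rho_lo p - kap <= x <= rho_hi p + kap ->
    [/\ `|derive1 (pot p) x| <= B, `|derive1n 2 (pot p) x| <= B,
        `|derive1n 3 (pot p) x| <= B & cP p / 2 <= derive1n 2 (pot p) x] }.

Lemma pressure_boundsP : exists kap B, pressure_bounds kap B.
Proof.
case: hp => _ sm [lo0 lohi _ cP0] cv _.
have der (n : nat) (x : R) : 0 < x -> is_derive x 1 (derive1n n (pot p)) (derive1n n.+1 (pot p) x).
  move=> x0; have h := sm n x x0; apply: DeriveDef; first exact: h.
  by rewrite derive1nS derive1E.
pose c := rho_lo p / 2; pose d := rho_hi p + rho_lo p / 2.
have bd (n : nat) : exists B, forall x : R, c <= x <= d -> `|derive1n n (pot p) x| <= B.
  apply: cont_bounded; first by rewrite /c /d; lra.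
  apply: derivable_within_continuous => u; rewrite in_itv/= /c => /andP[cu _].
  by apply: sm; lra.
have [B1 h1] := bd 1%N; have [B2 h2] := bd 2%N; have [B3 h3] := bd 3%N.
pose B := Num.max 1 (Num.max B1 (Num.max B2 B3)).
have B0 : 0 < B by rewrite lt_max ltr01.
(* The first entry keeps the densities positive; the second costs at most half of the convexity,
   since [P''] is [B]-Lipschitz. *)
pose kap := Num.min (rho_lo p / 2) (cP p / (2 * B)).
have k0 : 0 < kap by rewrite lt_min !divr_gt0// mulr_gt0.
have kl : kap <= rho_lo p / 2 by rewrite ge_min lexx.
have kB : B * kap <= cP p / 2.
  have h : kap <= cP p / (2 * B) by rewrite ge_min lexx orbT.
  have := ler_wpM2l (ltW B0) h.
  rewrite [X in _ <= X -> _](_ : _ = cP p / 2)//.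
  by field; rewrite gt_eqF.
have sub (x : R) : rho_lo p - kap <= x <= rho_hi p + kap -> c <= x <= d.
  by rewrite /c /d; lra.
have pos (x : R) : rho_lo p - kap <= x <= rho_hi p + kap -> 0 < x by move=> /sub; rewrite /c; lra.
have d2 : deriv_on (rho_lo p - kap) (rho_hi p + kap) (derive1n 2 (pot p)) (derive1n 3 (pot p)).
  by move=> x /pos x0; exact: der.
have P3 (x : R) : rho_lo p - kap <= x <= rho_hi p + kap -> `|derive1n 3 (pot p) x| <= B.
  by move=> /sub/h3 h; rewrite (le_trans h)// !le_max lexx !orbT.
exists kap, B; split; [by rewrite k0|exact: B0| | |exact: d2|].
- by move=> x /pos x0; exact: (der 0%N).
- by move=> x /pos x0; exact: (der 1%N).
move=> x xI; split.
- by rewrite (le_trans (h1 x (sub x xI)))// !le_max lexx !orbT.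
- by rewrite (le_trans (h2 x (sub x xI)))// !le_max lexx !orbT.
- exact: P3.
(* Clamping [x] to the admissible interval moves it by at most [kap]. *)
- have [y yI xy] : exists2 y, rho_lo p <= y <= rho_hi p & `|x - y| <= kap.
    have [xl|xl] := ltP x (rho_lo p).
      by exists (rho_lo p); [rewrite lexx ltW|rewrite ler_norml; lra].
    have [xh|xh] := leP x (rho_hi p).
      by exists x; [rewrite xl xh|rewrite subrr normr0 ltW].
    by exists (rho_hi p); [rewrite lexx ltW|rewrite ler_norml; lra].
  have yI' : rho_lo p - kap <= y <= rho_hi p + kap by lra.
  have := mvt_lip d2 P3 xI yI'; have := cv y yI.
  have := ler_wpM2l (ltW B0) xy; move: (derive1n 2 _ x) (derive1n 2 _ y) => u v a b.
  by rewrite ler_norml => /andP[h _]; move: a b h kB; move: (B * _) (B * _) => s r; lra.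
Qed.

End Pressure.

(** * Constants of the reference solution *)

Section ReferenceBounds.
Context {R : realType} (p : param R) (d : refdata R).
Local Notation l := (ell p).
Local Notation lmu := (@lebesgue_measure R).

Record reference_bounds (K Ct : R) : Prop := ReferenceBounds {
  rb_K : 0 < K;
  rb_rho : mixed_lip l K (rhat d);
  rb_v : mixed_lip l K (vhat d);
  rb_m : mixed_lip l K (mhat d);
  rb_h : mixed_lip l K (hhat p d);
  rb_rhoC : forall s t x, 0 <= s -> 0 <= t -> 0 <= x <= l ->
    `|rhat d t x - rhat d s x| <= Ct * `|t - s|;
  rb_vC : forall s t x, 0 <= s -> 0 <= t -> 0 <= x <= l ->
    `|vhat d t x - vhat d s x| <= Ct * `|t - s|;
  rb_s1 : forall t, 0 <= t -> bmeas 0 l (src1 d t);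
  rb_s2 : forall t, 0 <= t -> bmeas 0 l (src2 d t);
  rb_mass : forall s t a b, 0 <= s -> s <= t -> 0 <= a -> a <= b -> b <= l ->
    `|intg a b (fun y => rhat d t y - rhat d s y)
      - (t - s) * (intg a b (src1 d t) - (mhat d t b - mhat d t a))|
    <= K * (b - a) * (t - s) ^+ 2;
  rb_mom : forall M r s t, (0 < M)%N -> Rh l M r -> 0 <= s -> s <= t ->
    `|intg 0 l (fun y => (vhat d t y - vhat d s y) * r y)
      - (t - s) * (intg 0 l (fun y =>
            (src2 d t y - gam p * (`|vhat d t y| * vhat d t y)) * r y)
        + intg 0 l (fun y => hhat p d t y * derive1 r y) - hhat p d t l * r l)|
    <= K * intg 0 l (fun y => `|r y|) * (t - s) ^+ 2 }.

Lemma mixed_lip_weaken K K' f : K <= K' -> mixed_lip l K f -> mixed_lip l K' f.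
Proof. by move=> KK fK s t x y s0 t0 xl yl; apply: mixed_weaken KK (fK _ _ _ _ _ _ _ _). Qed.

Lemma W1oo_mixed f : 0 < l -> Wkinf_W1 l 1 +oo f -> exists K, 0 < K /\ mixed_lip l K f.
Proof.
move=> l0 fW; have [C1 [C10 _ b1 b2]] := W1_time l0 (or_intror erefl) fW.
have [C2 [C20 b3 b4]] := W1oo_space l0 fW.
pose K := C1 + C2 + 1; have K0 : 0 < K by rewrite /K; lra.
have K1 : C1 <= K by rewrite /K; lra.
have K2 : C2 <= K by rewrite /K; lra.
exists K; split => // s t x y s0 t0 xl yl; split.
- by split; apply: le_trans K1; exact: b1.
- by split; (apply: le_trans; [exact: b2|exact: ler_wpM2r]).
- by split; (apply: le_trans; [exact: b3|exact: ler_wpM2r]).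
- apply: le_trans; first exact: b4.
  by rewrite ler_wpM2r// ler_wpM2r.
Qed.

Lemma reference_boundsP (v : R -> R -> R) vbar Ct : valid_param p ->
  reference_solution p d -> reference_regular p d -> data_regular p d ->
  smallness p d v vbar Ct -> exists K, reference_bounds K Ct.
Proof.
move=> hp [_ [rt [mx [vt [hx [[rtL mxL vtL hxL] [rtP vtP] mxP hxP eqn]]]]]].
move=> [_ [rW vW] rB vB] [s1W s2W _ _] [[gr [gv [[grL gvL] grP gvP gC]]] vb _].
have [kap [B [k0 B0 d0 d1 d2 Pbd]]] := pressure_boundsP hp.
case: (hp) => -[l0 g0 mu0] _ [lo0 lohi _ _] _ _.
have [K1 [K10 rK]] := W1oo_mixed l0 rW; have [K2 [K20 vK]] := W1oo_mixed l0 vW.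
pose K3 := K1 + K2; have K30 : 0 < K3 by rewrite /K3; lra.
have {}rK : mixed_lip l K3 (rhat d) by apply: mixed_lip_weaken rK; rewrite /K3; lra.
have {}vK : mixed_lip l K3 (vhat d) by apply: mixed_lip_weaken vK; rewrite /K3; lra.
have mK : mixed_lip l (4 * K3 ^+ 2) (mhat d).
  move=> s t x y s0 t0 xl yl; apply: mixedM => //; first exact: ltW.
    exact: rK.
  exact: vK.
pose K4 := B + B * K3 + B * K3 ^+ 2.
have K40 : 0 < K4 by rewrite /K4 !addr_gt0// !mulr_gt0// exprn_gt0.
have pK : mixed_lip l K4 (fun t x => derive1 (pot p) (rhat d t x)).
  move=> s t x y s0 t0 xl yl.
  apply: (mixed_comp (ltW B0) (ltW K30) _ _ d1 d2) => //.
  - by move=> z /Pbd[h1 h2 h3 _]; split; [exact: h1|exact: h2|exact: h3].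
  - have rI (u z : R) : 0 <= u -> 0 <= z <= l ->
      rho_lo p - kap <= rhat d u z <= rho_hi p + kap.
      by move=> u0 zl; have := rB u z u0 zl; lra.
    by split; apply: rI.
  - exact: rK.
(* The additions make [K6] at least 1, so that the constant factor [2^-1] satisfies the same mixed
   bound as the square that it multiplies. *)
pose K5 := K3 + 1; have K50 : 0 < K5 by rewrite /K5; lra.
pose K6 := K5 + 4 * K5 ^+ 2; have K60 : 0 < K6.
  by rewrite /K6 addr_gt0// mulr_gt0// exprn_gt0.
have vK5 : mixed_lip l K5 (vhat d) by apply: mixed_lip_weaken vK; rewrite /K5; lra.
have vvK : mixed_lip l (4 * K5 ^+ 2) (fun t x => vhat d t x * vhat d t x).
  by move=> s t x y s0 t0 xl yl; apply: mixedM => //; [exact: ltW|exact: vK5..].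
have hvK : mixed_lip l (4 * K6 ^+ 2) (fun t x => 2^-1 * (vhat d t x * vhat d t x)).
  move=> s t x y s0 t0 xl yl; apply: mixedM => //; first exact: ltW.
    apply: mixed_cst => //; first exact: ltW.
    rewrite ger0_norm ?invr_ge0//; apply: (@le_trans _ _ 1); first by rewrite invf_le1// ler1n.
    by rewrite /K6 /K5; have := sqr_ge0 (K3 + 1); clear - p d K30; lra.
  by apply: mixed_weaken (vvK s t x y s0 t0 xl yl); rewrite // /K6;
    clear - p d K50; lra.
pose K7 := 4 * K6 ^+ 2 + K4.
have hK : mixed_lip l (2 * K7) (hhat p d).
  move=> s t x y s0 t0 xl yl; rewrite /hhat /enthalpy !expr2; apply: mixedD.
    by apply: mixed_weaken (hvK s t x y s0 t0 xl yl); rewrite // /K7; lra.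
  apply: mixed_weaken (pK s t x y s0 t0 xl yl); rewrite // /K7.
  by rewrite lerDr mulr_ge0// sqr_ge0.
have [S1 [S10 ms1 s1B s1T]] := W1_time l0 (or_introl erefl) s1W.
have [S2 [S20 ms2 s2B s2T]] := W1_time l0 (or_introl erefl) s2W.
have bs1 (t : R) : 0 <= t -> bmeas 0 l (src1 d t).
  move=> t0; apply: (@bm_ae _ _ _ _ S1); first exact: measurable_secx ms1.
  by move=> x xl; exact: s1B.
have bs2 (t : R) : 0 <= t -> bmeas 0 l (src2 d t).
  move=> t0; apply: (@bm_ae _ _ _ _ S2); first exact: measurable_secx ms2.
  by move=> x xl; exact: s2B.
pose K8 := K3 + 4 * K3 ^+ 2 + 2 * K7.
have K70 : 0 < K7 by rewrite /K7 ltr_wpDl// mulr_ge0// sqr_ge0.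
have K80 : 0 < K8.
  by rewrite /K8 addr_gt0// ?addr_gt0// mulr_gt0// exprn_gt0.
have [K38 m8 h8] : [/\ K3 <= K8, 4 * K3 ^+ 2 <= K8 & 2 * K7 <= K8].
  by rewrite /K8; have := sqr_ge0 K3; clear - p d K30 K70; split; lra.
have mK8 : mixed_lip l K8 (mhat d) by apply: mixed_lip_weaken mK.
have vK8 : mixed_lip l K8 (vhat d) by apply: mixed_lip_weaken vK.
have hK8 : mixed_lip l K8 (hhat p d) by apply: mixed_lip_weaken hK.
(* An essential supremum of a nonnegative function is nonnegative only over a set of positive
   measure, hence the measure of the time axis. The fact splits the smallness bound on the sum of
   two norms into a bound on each. *)
have norm_ge0 g : LinfLp l +oo g -> (0 <= LinfLp_norm l +oo g)%E.
  move=> _; apply: ess_sup_gee; last by apply: aeW => t; exact: Lnorm_ge0.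
  rewrite /muTime /= /mrestr setTI.
  by rewrite lebesgue_measure_itv/= ltry; exact: (ltry 0).
have grC : (LinfLp_norm l +oo gr <= Ct%:E)%E.
  by apply: le_trans gC; rewrite leeDl// norm_ge0.
have gvC : (LinfLp_norm l +oo gv <= Ct%:E)%E.
  by apply: le_trans gC; rewrite leeDr// norm_ge0.
have eqn' := ae_prod eqn.
pose Kf := K8 + S1 + (S2 + gam p * (2 * K8 ^+ 2) + K8).
have gK : 0 <= gam p * (2 * K8 ^+ 2).
  by rewrite mulr_ge0 ?(ltW g0)// mulr_ge0// sqr_ge0.
have [K8f massf momf] : [/\ K8 <= Kf, K8 + S1 <= Kf & S2 + gam p * (2 * K8 ^+ 2) + K8 <= Kf].
  by rewrite /Kf; clear - p d K80 S10 S20 gK; split; lra.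
exists Kf; split.
- exact: lt_le_trans K8f.
- by apply: mixed_lip_weaken rK; exact: le_trans K8f.
- exact: mixed_lip_weaken vK8.
- exact: mixed_lip_weaken mK8.
- exact: mixed_lip_weaken hK8.
- move=> s t x; apply: (small_time_lip l0 grL grC grP) => // u y z u0 yl zl.
  exact: mixed_lip_space rK u0 yl zl.
- move=> s t x; apply: (small_time_lip l0 gvL gvC gvP) => // u y z u0 yl zl.
  exact: mixed_lip_space vK u0 yl zl.
- exact: bs1.
- exact: bs2.
- move=> s t a b s0 st a0 ab bl.
  have := @mass_residual _ l K8 S1 (rhat d) rt (mhat d) mx (src1 d) l0 (ltW K80) S10
    rtL mxL rtP mxP _ mK8 bs1 s1T s t a b s0 st a0 ab bl.
  move=> /(_ _)/le_trans; apply.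
    by apply: aeS eqn' => u eqn'; apply: aeS eqn' => y h yc; have [] := h yc.
  by rewrite ler_wpM2r ?sqr_ge0// ler_wpM2r ?subr_ge0.
- move=> M r s t M0 rR s0 st.
  have := @momentum_residual _ l K8 S2 (gam p) (vhat d) vt (hhat p d) hx (src2 d)
    l0 (ltW K80) S20 (ltW g0) vtL hxL vtP hxP _ vK8 hK8 bs2 s2T M r s t M0 rR s0 st.
  move=> /(_ _)/le_trans; apply.
    by apply: aeS eqn' => u eqn'; apply: aeS eqn' => y h yc; have [] := h yc.
  rewrite ler_wpM2r ?sqr_ge0// ler_wpM2r//.
  exact: Rintegral_ge0.
Qed.

End ReferenceBounds.

(** * Projections of the reference solution *)

Lemma is_derive_inv (R : realType) (f : R -> R) (x df : R) : f x != 0 ->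
  is_derive x 1 f df -> is_derive x 1 (fun y => (f y)^-1) (- (f x) ^- 2 * df).
Proof.
move=> fx0 [fd fE]; apply: DeriveDef; first exact: derivableV.
by rewrite deriveV// fE.
Qed.

Section Averages.
Context {R : realType} (l : R) (M : nat) (l_gt0 : 0 < l) (M_gt0 : (0 < M)%N).
Local Notation nd := (node l M).
Local Notation h := (mesh l M).

Definition interior_point (i : nat) (x : R) : Prop := (i < M)%N /\ nd i < x < nd i.+1.

Lemma interior_sub i x y : interior_point i x -> nd i <= y <= nd i.+1 -> 0 <= y <= l.
Proof.
move=> [iM xI] yI; have := node_ge0 l_gt0 M_gt0 i; have := node_le_l l_gt0 M_gt0 iM; lra.
Qed.

Lemma interior_mem i x : interior_point i x -> 0 <= x <= l.
Proof. by move=> xI; apply: (interior_sub xI); case: xI => _; lra. Qed.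

Lemma PihE f i x : interior_point i x ->
  Pih l M f x = h^-1 * intg (nd i) (nd i.+1) f.
Proof. by move=> [iM xI]; rewrite /Pih (@cellE _ l M l_gt0 M_gt0 i)//; lra. Qed.

Lemma bm_cell i x f : interior_point i x -> bmeas 0 l f -> bmeas (nd i) (nd i.+1) f.
Proof.
move=> [iM xI]; have := node_ge0 l_gt0 M_gt0 i; have := node_le_l l_gt0 M_gt0 iM.
by move=> h1 h2; exact: bm_sub.
Qed.

Lemma Pih_dist f i x c e : interior_point i x -> bmeas 0 l f ->
  (forall y, nd i <= y <= nd i.+1 -> `|f y - c| <= e) -> `|Pih l M f x - c| <= e.
Proof.
move=> xI bf fc; rewrite (PihE _ xI); have bfc := bm_cell xI bf.
have h0 := mesh_gt0 l_gt0 M_gt0; have le_nd := ltW (node_lt l_gt0 M_gt0 i).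
have -> : c = h^-1 * intg (nd i) (nd i.+1) (fun=> c).
  by rewrite intg_cst// nodeB mulrCA mulVf ?mulr1// gt_eqF.
rewrite -mulrBr -intgB//; last exact: bm_cst.
rewrite normrM gtr0_norm ?invr_gt0// ler_pdivrMl// mulrC -(nodeB l M i).
by apply: intg_boundW => //; apply: bmB => //; exact: bm_cst.
Qed.

Lemma PihB f g i x : interior_point i x -> bmeas 0 l f -> bmeas 0 l g ->
  Pih l M (fun y => f y - g y) x = Pih l M f x - Pih l M g x.
Proof.
move=> xI bf bg; rewrite !(PihE _ xI) intgB ?mulrBr//; exact: bm_cell xI _.
Qed.

Lemma Pih_itv f i x c d : interior_point i x -> bmeas 0 l f ->
  (forall y, 0 <= y <= l -> c <= f y <= d) -> c <= Pih l M f x <= d.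
Proof.
move=> xI bf fcd; have : `|Pih l M f x - (c + d) / 2| <= (d - c) / 2.
  apply: (Pih_dist xI bf) => y yI; have := fcd y (interior_sub xI yI).
  by rewrite ler_norml; lra.
by rewrite ler_norml; lra.
Qed.

Lemma Ih_dist f i x c e : interior_point i x ->
  (forall y, nd i <= y <= nd i.+1 -> `|f y - c| <= e) -> `|Ih l M f x - c| <= e.
Proof.
move=> [iM xI] fc; rewrite (@Ih_affine _ l M l_gt0 M_gt0 f i x)//; last lra.
have h0 := mesh_gt0 l_gt0 M_gt0; have nS := nodeS l M i.
set th := (x - nd i) / h; have [th0 th1] : 0 <= th /\ th <= 1.
  by rewrite /th; split; [rewrite divr_ge0// ?subr_ge0 ?ltW//; lra|rewrite ler_pdivrMr//; lra].
clearbody th.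
have fa := fc (nd i) ltac:(rewrite lexx; lra).
have fb := fc (nd i.+1) ltac:(rewrite lexx; lra).
rewrite (_ : _ - c = (1 - th) * (f (nd i) - c) + th * (f (nd i.+1) - c)); last by ring.
have th2 : 0 <= 1 - th by rewrite subr_ge0.
rewrite (le_trans (ler_normD _ _))// !normrM (ger0_norm th2) (ger0_norm th0).
move: fa fb th0 th1; move: `|_ - _| `|_ - _| => p q; nra.
Qed.

Lemma IhB f g i x : interior_point i x ->
  Ih l M (fun y => f y - g y) x = Ih l M f x - Ih l M g x.
Proof. by move=> _; rewrite /Ih; ring. Qed.

Lemma interior_dist i x y : interior_point i x -> nd i <= y <= nd i.+1 -> `|x - y| <= h.
Proof. by move=> [iM xI] yI; have := nodeS l M i; rewrite ler_norml; lra. Qed.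

(** Treats averaging and interpolation at once through what they share: both commute with
    differences, and both send a function that is [e]-close to a constant on the cell to a value
    [e]-close to it. The mixed bound is the case of a time increment compared with its own value at
    [x]. *)
Lemma mixed_proj (T : (R -> R) -> R -> R) K f s t i x : interior_point i x ->
  0 <= s -> 0 <= t -> mixed_lip l K f ->
  (forall a c e, bmeas 0 l a ->
    (forall y, nd i <= y <= nd i.+1 -> `|a y - c| <= e) -> `|T a x - c| <= e) ->
  (forall a b, bmeas 0 l a -> bmeas 0 l b -> T (fun y => a y - b y) x = T a x - T b x) ->
  mixed K `|t - s| h (f t x) (f s x) (T (f t) x) (T (f s) x).
Proof.
move=> xI s0 t0 fK Td TB; have xl := interior_mem xI.
have K0 : 0 <= K by rewrite (le_trans _ (mixed_lip_bound fK t0 xl)).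
have bf u : 0 <= u -> bmeas 0 l (f u) by move=> u0; exact: mixed_lip_bm fK u0.
have yl y : nd i <= y <= nd i.+1 -> 0 <= y <= l by exact: interior_sub xI.
have bd u : 0 <= u -> `|f u x| <= K by move=> u0; exact: mixed_lip_bound fK u0 xl.
have bT u : 0 <= u -> `|T (f u) x| <= K.
  move=> u0; rewrite -[X in `|X|]subr0; apply: Td; first exact: bf.
  by move=> y yI; rewrite subr0; apply: mixed_lip_bound fK u0 (yl y yI).
have dT u : 0 <= u -> `|f u x - T (f u) x| <= K * h.
  move=> u0; rewrite distrC; apply: Td; first exact: bf.
  move=> y yI; apply: le_trans (mixed_lip_space fK u0 (yl y yI) xl) _.
  by rewrite ler_wpM2l// distrC; exact: interior_dist xI yI.
have TE : T (f t) x - T (f s) x = T (fun y => f t y - f s y) x.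
  by rewrite TB//; exact: bf.
have bts : bmeas 0 l (fun y => f t y - f s y) by apply: bmB; exact: bf.
split.
- by split; [exact: bd|exact: bd|exact: bT|exact: bT].
- split; first exact: mixed_lip_time fK s0 t0 xl.
  rewrite TE -[X in `|X|]subr0; apply: Td => // y yI.
  by rewrite subr0; exact: mixed_lip_time fK s0 t0 (yl y yI).
- by split; exact: dT.
- rewrite TE distrC; apply: Td => // y yI.
  have [_ _ _ H] := fK s t y x s0 t0 (yl y yI) xl.
  apply: le_trans H _; rewrite ler_wpM2l// ?mulr_ge0//.
  by rewrite distrC; exact: interior_dist xI yI.
Qed.

End Averages.

(** * The projected state *)

Section Projection.
Context {R : realType} (p : param R) (d : refdata R).
Local Notation l := (ell p).

(** Quotient rule for the projected velocity: a momentum increment of size [(rho_hi + 1) * Ct] over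
    a density at least [rho_lo], plus a momentum at most [rho_hi] times the increment of the inverse
    density. Both numerators rely on [vbar <= 1]. *)
Definition vref_lip : R := (rho_hi p + 1) / rho_lo p + rho_hi p / rho_lo p ^+ 2.

Record projection_bounds (K Ct vbar : R) : Prop := ProjectionBounds {
  pj_rho : forall M t i x, (0 < M)%N -> interior_point l M i x -> 0 <= t ->
    rho_lo p <= Pih l M (rhat d t) x <= rho_hi p;
  pj_v : forall M t i x, (0 < M)%N -> interior_point l M i x -> 0 <= t ->
    `|vel (Pih l M (rhat d t)) (Ih l M (mhat d t)) x| <= rho_hi p / rho_lo p * vbar;
  pj_rhoC : forall M s t i x, (0 < M)%N -> interior_point l M i x -> 0 <= s -> 0 <= t ->
    `|Pih l M (rhat d t) x - Pih l M (rhat d s) x| <= Ct * `|t - s|;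
  pj_vC : forall M s t i x, (0 < M)%N -> interior_point l M i x -> 0 <= s -> 0 <= t ->
    `|vel (Pih l M (rhat d t)) (Ih l M (mhat d t)) x
      - vel (Pih l M (rhat d s)) (Ih l M (mhat d s)) x|
    <= vref_lip * Ct * `|t - s|;
  pj_mrho : forall M t i x, (0 < M)%N -> interior_point l M i x -> 0 <= t ->
    `|rhat d t x - Pih l M (rhat d t) x| <= K * mesh l M;
  pj_Iv : forall M t i x, (0 < M)%N -> interior_point l M i x -> 0 <= t ->
    `|vhat d t x - Ih l M (vhat d t) x| <= K * mesh l M;
  pj_mv : forall M s t i x, (0 < M)%N -> interior_point l M i x -> 0 <= s -> 0 <= t ->
    mixed K `|t - s| (mesh l M) (vhat d t x) (vhat d s x)
      (vel (Pih l M (rhat d t)) (Ih l M (mhat d t)) x)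
      (vel (Pih l M (rhat d s)) (Ih l M (mhat d s)) x);
  pj_mh : forall M s t i x, (0 < M)%N -> interior_point l M i x -> 0 <= s -> 0 <= t ->
    mixed K `|t - s| (mesh l M) (hhat p d t x) (hhat p d s x)
      (enthalpy (pot p) (Pih l M (rhat d t) x)
         (vel (Pih l M (rhat d t)) (Ih l M (mhat d t)) x))
      (enthalpy (pot p) (Pih l M (rhat d s) x)
         (vel (Pih l M (rhat d s)) (Ih l M (mhat d s)) x)) }.

Lemma projection_boundsP K0 kap B Ct vbar : valid_param p ->
  pressure_bounds p kap B -> reference_bounds p d K0 Ct ->
  0 < vbar <= 1 -> 0 < Ct ->
  (forall t x, 0 <= t -> 0 <= x <= l -> rho_lo p <= rhat d t x <= rho_hi p) ->
  (forall t x, 0 <= t -> 0 <= x <= l -> `|vhat d t x| <= vbar) ->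
  exists K, 0 < K /\ projection_bounds K Ct vbar.
Proof.
move=> [[l0 g0 mu0] _ [lo0 lohi _ _] _ _] pb rb /andP[vb0 vb1] Ct0 rB vB.
have K00 := rb_K rb; have hi0 : 0 < rho_hi p by lra.
have bmr t : 0 <= t -> bmeas 0 l (rhat d t) by move=> t0; exact: mixed_lip_bm (rb_rho rb) t0.
pose r M t x := Pih l M (rhat d t) x; pose mh M t x := Ih l M (mhat d t) x.
have rI M t i x : (0 < M)%N -> interior_point l M i x -> 0 <= t ->
    rho_lo p <= r M t x <= rho_hi p.
  move=> M0 xI t0; apply: (Pih_itv l0 M0 xI (bmr t t0)) => y yl; exact: rB.
have rC M s t i x : (0 < M)%N -> interior_point l M i x -> 0 <= s -> 0 <= t ->
    `|r M t x - r M s x| <= Ct * `|t - s|.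
  move=> M0 xI s0 t0; rewrite /r -(PihB l0 M0 xI (bmr t t0) (bmr s s0)).
  rewrite -[X in `|X|]subr0; apply: (Pih_dist l0 M0 xI).
    by apply: bmB; exact: bmr.
  move=> y yI; rewrite subr0; apply: (rb_rhoC rb) => //.
  exact: interior_sub xI yI.
have mB t x : 0 <= t -> 0 <= x <= l -> `|mhat d t x| <= rho_hi p * vbar.
  move=> t0 xl; rewrite /mhat normrM ler_pM ?vB//.
  by have /andP[? ?] := rB t x t0 xl; rewrite ger0_norm// (le_trans (ltW lo0)).
have mhB M t i x : (0 < M)%N -> interior_point l M i x -> 0 <= t ->
    `|mh M t x| <= rho_hi p * vbar.
  move=> M0 xI t0; rewrite -[X in `|X|]subr0; apply: (Ih_dist l0 M0 xI) => y yI.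
  by rewrite subr0; apply: mB => //; exact: interior_sub xI yI.
have mC s t x : 0 <= s -> 0 <= t -> 0 <= x <= l ->
    `|mhat d t x - mhat d s x| <= (rho_hi p + 1) * Ct * `|t - s|.
  move=> s0 t0 xl; rewrite /mhat.
  rewrite (_ : _ - _ = rhat d t x * (vhat d t x - vhat d s x) +
    (rhat d t x - rhat d s x) * vhat d s x); last by ring.
  rewrite (le_trans (ler_normD _ _))// !normrM -mulrA mulrDl mul1r lerD//.
    rewrite ler_pM//; last exact: (rb_vC rb).
    by have /andP[? ?] := rB t x t0 xl; rewrite ger0_norm// (le_trans (ltW lo0)).
  rewrite -[leRHS]mulr1 ler_pM//; first exact: (rb_rhoC rb).
  by apply: le_trans vb1; exact: vB.
have mhC M s t i x : (0 < M)%N -> interior_point l M i x -> 0 <= s -> 0 <= t ->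
    `|mh M t x - mh M s x| <= (rho_hi p + 1) * Ct * `|t - s|.
  move=> M0 xI s0 t0; rewrite /mh -(IhB _ _ xI).
  rewrite -[X in `|X|]subr0; apply: (Ih_dist l0 M0 xI) => y yI.
  by rewrite subr0; apply: mC => //; exact: interior_sub xI yI.
have r_gt0 M t i x : (0 < M)%N -> interior_point l M i x -> 0 <= t -> 0 < r M t x.
  by move=> M0 xI t0; have := rI M t i x M0 xI t0; lra.
have inv_le z : rho_lo p <= z -> `|z^-1| <= (rho_lo p)^-1.
  move=> lz; have z0 := lt_le_trans lo0 lz.
  by rewrite ger0_norm ?invr_ge0 ?(ltW z0)// lef_pV2 ?posrE.
have velC M s t i x : (0 < M)%N -> interior_point l M i x -> 0 <= s -> 0 <= t ->
    `|mh M t x / r M t x - mh M s x / r M s x| <= vref_lip * Ct * `|t - s|.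
  move=> M0 xI s0 t0; have rt := r_gt0 _ _ _ _ M0 xI t0; have rs := r_gt0 _ _ _ _ M0 xI s0.
  rewrite (_ : _ - _ = (mh M t x - mh M s x) / r M t x +
     mh M s x * (r M s x - r M t x) / (r M t x * r M s x)); last first.
    by field; rewrite !gt_eqF.
  have ir u : 0 <= u -> `|(r M u x)^-1| <= (rho_lo p)^-1.
    by move=> u0; have /andP[? _] := rI _ _ _ _ M0 xI u0; exact: inv_le.
  rewrite (le_trans (ler_normD _ _))//.
  rewrite (_ : vref_lip * Ct * `|t - s| = (rho_hi p + 1) * Ct * `|t - s| * (rho_lo p)^-1 +
    rho_hi p * (Ct * `|t - s|) * ((rho_lo p)^-1 * (rho_lo p)^-1)); last first.
    by rewrite /vref_lip; field; rewrite gt_eqF.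
  rewrite lerD//; first by rewrite normrM ler_pM// ?mhC ?ir//; exact: mhC xI _ _.
  rewrite normrM ler_pM//; last by rewrite invfM normrM ler_pM// ir.
  rewrite normrM ler_pM//; last by rewrite distrC; exact: rC xI _ _.
  apply: le_trans (mhB _ _ _ _ M0 xI s0) _.
  by rewrite -[leRHS]mulr1 ler_wpM2l// ltW.
have velB M t i x : (0 < M)%N -> interior_point l M i x -> 0 <= t ->
    `|mh M t x / r M t x| <= rho_hi p / rho_lo p * vbar.
  move=> M0 xI t0; rewrite mulrAC normrM ler_pM//; first exact: mhB xI t0.
  by have /andP[? _] := rI _ _ _ _ M0 xI t0; exact: inv_le.
have mr M s t i x : (0 < M)%N -> interior_point l M i x -> 0 <= s -> 0 <= t ->
    mixed K0 `|t - s| (mesh l M) (rhat d t x) (rhat d s x) (r M t x) (r M s x).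
  move=> M0 xI s0 t0; apply: (mixed_proj l0 M0 xI s0 t0 (rb_rho rb)) => [a c e ba|a b ba bb].
    exact: Pih_dist.
  exact: PihB xI ba bb.
have mm M s t i x : (0 < M)%N -> interior_point l M i x -> 0 <= s -> 0 <= t ->
    mixed K0 `|t - s| (mesh l M) (mhat d t x) (mhat d s x) (mh M t x) (mh M s x).
  move=> M0 xI s0 t0; apply: (mixed_proj l0 M0 xI s0 t0 (rb_m rb)) => [a c e ba|a b ba bb].
    exact: Ih_dist.
  exact: IhB xI.
pose iB := (rho_lo p)^-1 + (rho_lo p)^-1 ^+ 2 + 2 * (rho_lo p)^-1 ^+ 3.
have il0 : 0 < (rho_lo p)^-1 by rewrite invr_gt0.
have iB0 : 0 < iB.
  by have := exprn_gt0 2 il0; have := exprn_gt0 3 il0; rewrite /iB; lra.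
pose K1 := K0 + (iB + iB * K0 + iB * K0 ^+ 2).
have iK : 0 < iB * K0 by rewrite mulr_gt0.
have iK2 : 0 < iB * K0 ^+ 2 by rewrite mulr_gt0// exprn_gt0.
have [K10 K01] : 0 < K1 /\ K0 <= K1 by rewrite /K1; clear - p d K00 iB0 iK iK2; split; lra.
pose K2 := 4 * K1 ^+ 2; have K20 : 0 < K2 by rewrite /K2 mulr_gt0// exprn_gt0.
have mesh0 M : (0 < M)%N -> 0 <= mesh l M by move=> M0; rewrite ltW// mesh_gt0.
have mi M s t i x : (0 < M)%N -> interior_point l M i x -> 0 <= s -> 0 <= t ->
    mixed (iB + iB * K0 + iB * K0 ^+ 2) `|t - s| (mesh l M)
      (rhat d t x)^-1 (rhat d s x)^-1 (r M t x)^-1 (r M s x)^-1.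
  move=> M0 xI s0 t0; have xl := interior_mem l0 M0 xI.
  apply: (@mixed_comp _ (rho_lo p) (rho_hi p) (fun z => z^-1) (fun z => - z ^- 2)
    (fun z => 2 * z ^- 3)) => //; try exact: ltW; try exact: mesh0.
  - move=> z zI; have zn : z != 0 by rewrite gt_eqF// (lt_le_trans lo0)//; case/andP: zI.
    have h0 : is_derive z 1 (fun y : R => y) 1 by exact: is_derive_id.
    by have := @is_derive_inv _ (fun y => y) z 1 zn h0; rewrite mulr1.
  - move=> z zI; have zn : z != 0 by rewrite gt_eqF// (lt_le_trans lo0)//; case/andP: zI.
    have zn2 : z ^+ 2 != 0 by rewrite expf_neq0.
    have hX : is_derive z 1 (fun z : R => z ^+ 2) (2 * z).
      by apply: is_derive_eq; rewrite /GRing.scale/=; ring.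
    have h1 := @is_derive_inv _ (fun y => y ^+ 2) z _ zn2 hX.
    have h2 := is_deriveN h1.
    by apply: (is_derive_eq h2); rewrite /GRing.scale/=; field.
  - move=> z zI; have z0 : 0 < z by apply: lt_le_trans lo0 _; case/andP: zI.
    have zi : 0 < z^-1 by rewrite invr_gt0.
    have zl : z^-1 <= (rho_lo p)^-1 by rewrite lef_pV2 ?posrE//; case/andP: zI.
    have e2 : z^-1 ^+ 2 <= (rho_lo p)^-1 ^+ 2 by apply: lerXn2r; rewrite ?nnegrE ?(ltW zi) ?(ltW il0).
    have e3 : z^-1 ^+ 3 <= (rho_lo p)^-1 ^+ 3 by apply: lerXn2r; rewrite ?nnegrE ?(ltW zi) ?(ltW il0).
    have p2 := exprn_gt0 2 il0; have p3 := exprn_gt0 3 il0.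
    have q2 := exprn_gt0 2 zi; have q3 := exprn_gt0 3 zi.
    rewrite normrN -!exprVn; split; rewrite gtr0_norm ?mulr_gt0// /iB;
      clear - p d il0 zl e2 e3 p2 p3 zi q2 q3; lra.
  - by split; [exact: rB|exact: rB|exact: rI xI t0|exact: rI xI s0].
  - exact: mr xI s0 t0.
have mv M s t i x : (0 < M)%N -> interior_point l M i x -> 0 <= s -> 0 <= t ->
    mixed K2 `|t - s| (mesh l M) (vhat d t x) (vhat d s x)
      (mh M t x / r M t x) (mh M s x / r M s x).
  move=> M0 xI s0 t0; have xl := interior_mem l0 M0 xI.
  (* Written as momentum over density, the exact velocity has the same form as the projected one,
     and a single product rule compares them. *)
  have vE u : 0 <= u -> vhat d u x = mhat d u x / rhat d u x.
    by move=> u0; rewrite /mhat mulrAC divff ?mul1r// gt_eqF//; have := rB u x u0 xl; lra.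
  rewrite (vE t)// (vE s)//; apply: mixedM; [exact: ltW|by []|exact: mesh0| |].
    by apply: (mixed_weaken _ _ K01 (mm _ _ _ _ _ M0 xI s0 t0)) => //; exact: mesh0.
  apply: (mixed_weaken _ _ _ (mi _ _ _ _ _ M0 xI s0 t0)) => //; first exact: mesh0.
  by rewrite /K1 lerDr ltW.
pose K3 := K2 + 1; pose K4 := K3 + 4 * K3 ^+ 2.
have K30 : 0 < K3 by rewrite /K3; lra.
have K40 : 0 < K4 by rewrite /K4 addr_gt0// mulr_gt0// exprn_gt0.
pose K5 := B + B * K0 + B * K0 ^+ 2.
have B0 := pb_B pb; have kp := pb_kap pb.
have K50 : 0 < K5 by rewrite /K5 !addr_gt0// !mulr_gt0// exprn_gt0.
pose K6 := 4 * K4 ^+ 2 + K5.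
have K60 : 0 < K6 by rewrite /K6 addr_gt0// mulr_gt0// exprn_gt0.
have mhh M s t i x : (0 < M)%N -> interior_point l M i x -> 0 <= s -> 0 <= t ->
    mixed (2 * K6) `|t - s| (mesh l M) (hhat p d t x) (hhat p d s x)
      (enthalpy (pot p) (r M t x) (mh M t x / r M t x))
      (enthalpy (pot p) (r M s x) (mh M s x / r M s x)).
  move=> M0 xI s0 t0; have xl := interior_mem l0 M0 xI.
  have ms0 := mesh0 M M0.
  rewrite /hhat /enthalpy !expr2; apply: mixedD.
    apply: (@mixed_weaken _ (4 * K4 ^+ 2)) => //; first by rewrite /K6 lerDl ltW.
    apply: mixedM => //; first exact: ltW.
      apply: mixed_cst => //; first exact: ltW.
      rewrite ger0_norm ?invr_ge0//; apply: (@le_trans _ _ 1); first by rewrite invf_le1// ler1n.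
      by rewrite /K4 /K3; have := sqr_ge0 (K2 + 1); clear - p d K20; lra.
    apply: (@mixed_weaken _ (4 * K3 ^+ 2)) => //; first by rewrite /K4 lerDr ltW.
    by apply: mixedM => //; first exact: ltW;
      apply: mixed_weaken (mv _ _ _ _ _ M0 xI s0 t0); rewrite // /K3 lerDl.
  apply: (@mixed_weaken _ K5) => //.
    by rewrite /K6 lerDr mulr_ge0// sqr_ge0.
  apply: (mixed_comp (ltW B0) (ltW K00) _ _ (pb_d1 pb) (pb_d2 pb)) => //.
  - by move=> z /(pb_bd pb)[h1 h2 h3 _]; split; [exact: h1|exact: h2|exact: h3].
  - have hk z : rho_lo p <= z <= rho_hi p -> rho_lo p - kap <= z <= rho_hi p + kap.
      by clear - p d kp; lra.
    by split; apply: hk; [exact: rB|exact: rB|exact: rI xI t0|exact: rI xI s0].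
  - exact: mr xI s0 t0.
pose Kf := K0 + K2 + 2 * K6.
have [f0 f2 f6] : [/\ K0 <= Kf, K2 <= Kf & 2 * K6 <= Kf].
  by rewrite /Kf; clear - p d K00 K20 K60; split; lra.
exists Kf; split; first exact: lt_le_trans f0.
split.
- exact: rI.
- exact: velB.
- exact: rC.
- exact: velC.
- move=> M t i x M0 xI t0; have [_ _ [+ _] _] := mr _ _ _ _ _ M0 xI t0 t0.
  by move=> /le_trans; apply; rewrite ler_wpM2r// mesh0.
- move=> M t i x M0 xI t0; rewrite distrC; apply: (Ih_dist l0 M0 xI) => y yI.
  have yl := interior_sub l0 M0 xI yI; have xl := interior_mem l0 M0 xI.
  apply: le_trans (mixed_lip_space (rb_v rb) t0 yl xl) _.
  by rewrite ler_pM// ?(ltW K00)// distrC; exact: interior_dist xI yI.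
- move=> M s t i x M0 xI s0 t0; apply: mixed_weaken (mv _ _ _ _ _ M0 xI s0 t0) => //.
  exact: mesh0.
- move=> M s t i x M0 xI s0 t0; apply: mixed_weaken (mhh _ _ _ _ _ M0 xI s0 t0) => //.
  exact: mesh0.
Qed.

End Projection.

(** * Pointwise energy estimates *)

Section Pointwise.
Context {R : realType} (p : param R).
Local Notation P0 := (pot p).
Local Notation P1 := (derive1 (pot p)).
Implicit Types (r s rho v : R).

(* The integrand of [relative_energy], with the kinetic part expanded around (r, s). *)
Definition rel_density (r s rho v : R) : R :=
  2^-1 * rho * (v - s) ^+ 2 + s * (rho - r) * (v - s)
  + (P0 rho - P0 r - P1 r * (rho - r)).

(** The part of the lower bound of [P''] that survives on the interval enlarged by [kap]. *)
Definition convexity : R := cP p / 2.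
(** A common lower bound for the weights of the two squares in [rel_density], up to the factor 1/2:
    the density for the velocity error, [P''] for the density error. *)
Definition coercivity : R := Num.min (rho_lo p) convexity.

Lemma absM_le (x y k h : R) : `|x| <= k -> `|y| <= h -> `|x * y| <= k * h.
Proof. by move=> xk yh; rewrite normrM ler_pM. Qed.

Lemma young (k x y : R) : 0 < k -> x * y <= k * x ^+ 2 + (4 * k)^-1 * y ^+ 2.
Proof.
move=> k0; rewrite -subr_ge0 (_ : _ - _ = k * (x - (2 * k)^-1 * y) ^+ 2).
  by apply: mulr_ge0; [exact: ltW|exact: sqr_ge0].
by field; rewrite gt_eqF.
Qed.

Lemma crossV (V x y v : R) : `|v| <= V -> `|v * x * y| <= V / 2 * (x ^+ 2 + y ^+ 2).
Proof.
move=> vV; rewrite -mulrA.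
have h : `|x * y| <= 2^-1 * (x ^+ 2 + y ^+ 2).
  by rewrite ler_norml; have := sqr_ge0 (x - y); have := sqr_ge0 (x + y); nra.
by rewrite -mulrA; exact: absM_le.
Qed.

(** The discrete chain rule. At a fixed reference, convexity bounds the increment by its linear part
    at the new state minus squares of the increments; this is the gain of the implicit step. Moving
    the reference at fixed error then costs only the old error squared, times the motion [dr],
    [ds]. *)
Lemma rel_density_step kap B V r ro s so rho rhoo v vo dr ds :
  pressure_bounds p kap B -> 0 < rho_lo p -> 0 < cP p ->
  rho_lo p <= rho <= rho_hi p -> rho_lo p <= rhoo <= rho_hi p ->
  rho_lo p <= r <= rho_hi p -> rho_lo p <= ro <= rho_hi p ->
  `|v| <= V -> V <= coercivity / 4 ->
  `|r - ro| <= dr -> dr <= kap -> `|s - so| <= ds ->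
  rel_density r s rho v - rel_density ro so rhoo vo <=
    (enthalpy P0 rho v - enthalpy P0 r s) * ((rho - r) - (rhoo - ro))
    + (rho * v - r * s) * ((v - s) - (vo - so))
    - coercivity / 8 * (((rho - r) - (rhoo - ro)) ^+ 2 + ((v - s) - (vo - so)) ^+ 2)
    + ((1 + B) * dr + ds) / 2 * ((rhoo - ro) ^+ 2 + (vo - so) ^+ 2).
Proof.
move=> pb lo0 cP0 rhoI rhooI rI roI vV Vc rr drk ss.
have co0 : 0 < coercivity by rewrite lt_min lo0 divr_gt0.
have [B0 /andP[k0 kl]] := (pb_B pb, pb_kap pb).
have cl : coercivity <= rho_lo p by rewrite ge_min lexx.
have cc : coercivity <= convexity by rewrite ge_min lexx orbT.
set e := rho - r; set eo := rhoo - ro; set f := v - s; set fo := vo - so.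
have in1 z : rho_lo p <= z <= rho_hi p -> rho_lo p - kap <= z <= rho_hi p + kap by lra.
have rk : - kap <= r - ro <= kap by rewrite -ler_norml (le_trans rr).
(* The pivot between the two comparisons: new reference, old error. It differs from [rhoo] by
   [r - ro], hence the condition [dr <= kap]. *)
have reI : rho_lo p - kap <= r + eo <= rho_hi p + kap by rewrite /eo; lra.
have roE : ro + eo = rhoo by rewrite /eo; ring.
have Pc x : rho_lo p - kap <= x <= rho_hi p + kap -> convexity <= derive1n 2 P0 x.
  by case/(pb_bd pb).
have P3 x : rho_lo p - kap <= x <= rho_hi p + kap -> `|derive1n 3 P0 x| <= B.
  by case/(pb_bd pb).
have b1 := bregman_ge (pb_d0 pb) (pb_d1 pb) Pc reI (in1 _ rhoI).
have b2 := bregman_lip (pb_d0 pb) (pb_d1 pb) (pb_d2 pb) P3 (in1 _ rI) (in1 _ roI) reI.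
have {}b2 := b2 ltac:(rewrite roE; exact: in1); rewrite roE in b2.
have reo : r + eo - rho = eo - e by rewrite /e; ring.
rewrite reo in b1.
pose de := e - eo; pose df := f - fo.
have de2 : (eo - e) ^+ 2 = de ^+ 2 by rewrite /de; ring.
rewrite de2 in b1.
(* Exact splitting: the linear part, minus the second-order remainders at fixed reference, plus the
   change of reference at fixed error. *)
have E : rel_density r s rho v - rel_density ro so rhoo vo =
    (enthalpy P0 rho v - enthalpy P0 r s) * de + (rho * v - r * s) * df
    - (2^-1 * (r + eo) * df ^+ 2 + v * de * df)
    - (P0 (r + eo) - P0 rho - P1 rho * (eo - e))
    + (2^-1 * (r - ro) * fo ^+ 2 + (s - so) * eo * fo)
    + ((P0 (r + eo) - P0 r - P1 r * eo) - (P0 rhoo - P0 ro - P1 ro * eo)).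
  rewrite /rel_density /enthalpy -/e -/eo -/f -/fo /de /df.
  have -> : rho = r + e by rewrite /e; ring.
  have -> : rhoo = ro + eo by rewrite /eo; ring.
  have -> : v = s + f by rewrite /f; ring.
  move: (P0 _) (P0 _) (P0 _) (P0 _) (P1 _) (P1 _) (P1 _) => *.
  by field.
have c1 := crossV de df vV.
have c2 := crossV eo fo ss.
have c3 : (r - ro) * fo ^+ 2 <= dr * fo ^+ 2.
  by rewrite ler_wpM2r ?sqr_ge0// (le_trans (ler_norm _)).
have c4 : (P0 (r + eo) - P0 r - P1 r * eo) - (P0 rhoo - P0 ro - P1 ro * eo) <= B / 2 * eo ^+ 2 * dr.
  rewrite (le_trans (ler_norm _))// (le_trans b2)// ler_wpM2l//.
  by rewrite mulr_ge0 ?sqr_ge0// divr_ge0// ltW.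
have c5 : rho_lo p / 2 * df ^+ 2 <= (r + eo) * df ^+ 2.
  by rewrite ler_wpM2r ?sqr_ge0//; lra.
have dr0 : 0 <= dr by rewrite (le_trans _ rr).
rewrite {}E -/de -/df.
have c1' : - (v * de * df) <= V / 2 * (de ^+ 2 + df ^+ 2).
  by rewrite (le_trans _ c1)// -normrN ler_norm.
have c2' : (s - so) * eo * fo <= ds / 2 * (eo ^+ 2 + fo ^+ 2).
  exact: le_trans (ler_norm _) c2.
clear -b1 c3 c4 c5 c1' c2' Vc cl cc dr0 B0 co0.
have := sqr_ge0 de; have := sqr_ge0 df; have := sqr_ge0 eo; have := sqr_ge0 fo.
move: c3 c4 c5 c1' c2' b1; rewrite (_ : 2^-1 * (r - ro) * fo ^+ 2 = 2^-1 * ((r - ro) * fo ^+ 2)); last by ring.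
rewrite (_ : 2^-1 * (r + eo) * df ^+ 2 = 2^-1 * ((r + eo) * df ^+ 2)); last by ring.
move: ((r - ro) * fo ^+ 2) ((r + eo) * df ^+ 2) (v * de * df) ((s - so) * eo * fo).
move: (P0 (r + eo) - P0 rho - P1 rho * (eo - e)) => b1L.
move: (_ - _ - (_ - _ - _)) => c4L.
move: ((_ - _) * de) (_ * df) => h1 h2.
move: (de ^+ 2) (df ^+ 2) (eo ^+ 2) (fo ^+ 2) => D1 D2 E2 F2 u1 u2 u3 u4.
move=> c3 c4 c5 c1 c2 b1 F0 E0 D20 D10.
have k1 : V / 2 * (D1 + D2) <= coercivity / 8 * (D1 + D2).
  by rewrite ler_wpM2r; lra.
have k2 : coercivity / 4 * D2 <= rho_lo p / 4 * D2 by rewrite ler_wpM2r//; lra.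
have k3 : coercivity / 2 * D1 <= convexity / 2 * D1 by rewrite ler_wpM2r//; lra.
have k4 : 0 <= B * dr * F2 by rewrite !mulr_ge0// ltW.
have k5 : 0 <= dr * E2 by rewrite mulr_ge0.
have k6 : 0 <= coercivity / 8 * D1.
  by rewrite mulr_ge0//; lra.
rewrite (_ : rho_lo p / 2 * D2 = 2 * (rho_lo p / 4 * D2)) in c5; last by field.
rewrite (_ : B / 2 * E2 * dr = 2^-1 * (B * dr * E2)) in c4; last by field.
rewrite (_ : coercivity / 2 * D1 = 4 * (coercivity / 8 * D1)) in k3; last by field.
rewrite (_ : coercivity / 4 * D2 = 2 * (coercivity / 8 * D2)) in k2; last by field.
rewrite !mulrDr in c1 c2 k1 *; rewrite (_ : ((1 + B) * dr + ds) / 2 * E2 =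
  2^-1 * (dr * E2) + 2^-1 * (B * dr * E2) + ds / 2 * E2); last by field.
rewrite (_ : ((1 + B) * dr + ds) / 2 * F2 =
  2^-1 * (dr * F2) + 2^-1 * (B * dr * F2) + ds / 2 * F2); last by field.
move: c3 c4 c5 c1 c2 b1 k1 k2 k3 k4 k5 k6.
move: (V / 2 * D1) (V / 2 * D2) (dr * F2) (dr * E2) (B * dr * E2) (B * dr * F2) (ds / 2 * E2) (ds / 2 * F2) (coercivity / 8 * D1) (coercivity / 8 * D2) (rho_lo p / 4 * D2) (convexity / 2 * D1).
by move=> *; lra.
Qed.

(** Each square has coefficient at least [coercivity / 2], and the cross term takes at most [V / 2],
    that is [coercivity / 8]; this leaves [3 / 8]. *)
Lemma rel_density_bounds kap B V r s rho v :
  pressure_bounds p kap B -> 0 < rho_lo p -> 0 < cP p ->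
  rho_lo p <= rho <= rho_hi p -> rho_lo p <= r <= rho_hi p ->
  `|s| <= V -> V <= coercivity / 4 ->
  3 / 8 * coercivity * ((rho - r) ^+ 2 + (v - s) ^+ 2) <= rel_density r s rho v
  <= ((rho_hi p + B) / 2 + coercivity / 8) * ((rho - r) ^+ 2 + (v - s) ^+ 2).
Proof.
move=> pb lo0 cP0 rhoI rI sV Vc.
have [B0 /andP[k0 kl]] := (pb_B pb, pb_kap pb).
have inK z : rho_lo p <= z <= rho_hi p -> rho_lo p - kap <= z <= rho_hi p + kap by lra.
have lo2 := bregman_ge (pb_d0 pb) (pb_d1 pb) (B := convexity)
  (fun x xI => let: And4 _ _ _ h := pb_bd pb xI in h) (inK _ rhoI) (inK _ rI).
have hi2 := bregman_le (pb_d0 pb) (pb_d1 pb) (B := B)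
  (fun x xI => let: And4 _ h _ _ := pb_bd pb xI in le_trans (ler_norm _) h) (inK _ rhoI) (inK _ rI).
have := crossV (rho - r) (v - s) sV; rewrite ler_norml => /andP[x1 x2].
have clo : coercivity <= rho_lo p by rewrite ge_min lexx.
have ccv : coercivity <= convexity by rewrite ge_min lexx orbT.
rewrite /rel_density; move: lo2 hi2 x1 x2.
move: (P0 rho - P0 r - P1 r * (rho - r)) (s * (rho - r) * (v - s)) => T X.
have := sqr_ge0 (rho - r); have := sqr_ge0 (v - s).
move: ((rho - r) ^+ 2) ((v - s) ^+ 2) => E F F0 E0 lo2 hi2 x1 x2.
have y1 : coercivity / 2 * E <= convexity / 2 * E by rewrite ler_wpM2r//; lra.
have y2 : coercivity / 2 * F <= 2^-1 * rho * F by rewrite ler_wpM2r//; lra.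
have y3 : 2^-1 * rho * F <= rho_hi p / 2 * F by rewrite ler_wpM2r//; lra.
have y4 : V / 2 * (E + F) <= coercivity / 8 * (E + F).
  by rewrite ler_wpM2r ?addr_ge0//; lra.
have y5 : 0 <= rho_hi p * E by rewrite mulr_ge0//; lra.
have y6 : 0 <= B * F by rewrite mulr_ge0// ltW.
by rewrite !mulrDr !mulrDl in y4 *; nra.
Qed.

(** [E], [F] and [n] are the sizes of the density, velocity and antiderivative errors; [t], [h] and
    [om] those of the perturbations. Young's inequality absorbs everything linear in the errors. The
    multiple of [n ^+ 2] is kept, sized so that Poincare's inequality turns it into a quarter of
    [dl * c]. *)
Lemma quadratic_absorption (c lo hi gm mu dl l B V K KA t h om E F n : R) :
  0 < c -> 0 < lo -> 0 < hi -> 0 < gm -> 0 < mu -> 0 < dl -> 0 < l -> 0 <= V ->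
  0 <= E -> 0 <= F -> 0 <= n ->
  V * (2 * gm * V + mu + 2 * dl) <= dl * c / 8 ->
  V * (2 * gm * V + mu + 2 * dl) <= mu * lo / 8 ->
  2 * gm * V <= mu -> gm * hi * V <= mu * lo / 4 ->
  dl * (8 * mu ^+ 2 * l ^+ 2 / c + hi) <= mu * lo / 8 ->
  - (dl * c) * E ^+ 2 - mu * lo * F ^+ 2 + V * (2 * gm * V + mu + 2 * dl) * (E * F)
  + dl * hi * F ^+ 2 + 4^-1 * gm * hi * V * F ^+ 2
  + (B * K * t) * E + (V * K * t) * F + hi * om * F + V * om * E + dl * K * h * E
  + dl * KA * t * F + dl * (2 * gm * V + mu) * (F * n) + dl * (om * n) + K ^+ 2 * (h * t)
  <= - (3 / 4 * (dl * c)) * E ^+ 2 - mu * lo / 2 * F ^+ 2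
     + dl * c / (4 * l ^+ 2) * n ^+ 2
     + ((4 * (dl * c / 24))^-1 * ((B * K) ^+ 2 + V ^+ 2 + (dl * K) ^+ 2)
        + (4 * (mu * lo / 24))^-1 * ((V * K) ^+ 2 + hi ^+ 2 + (dl * KA) ^+ 2)
        + 2 * dl * l ^+ 2 / c + K ^+ 2) * (t ^+ 2 + h ^+ 2 + om ^+ 2).
Proof.
move=> c0 lo0 hi0 gm0 mu0 dl0 l0 V0 E0 F0 n0 X1 X2 Vmu VD dlC.
set X := V * _ in X1 X2 *.
have X0 : 0 <= X.
  by rewrite /X mulr_ge0// !addr_ge0// ?mulr_ge0// ltW.
(* Three terms linear in [E] and three linear in [F] each cost [1 / 24] of the damping. With
   [1 / 16] for the product [E * F], this stays below a quarter of [dl * c]. For [F] the further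
   losses [1 / 16] and [1 / 8] keep the total below half of [mu * lo]. *)
set ke := dl * c / 24; set kf := mu * lo / 24.
have dc0 : 0 < dl * c by rewrite mulr_gt0.
have ml0 : 0 < mu * lo by rewrite mulr_gt0.
have ke0 : 0 < ke by rewrite /ke; lra.
have kf0 : 0 < kf by rewrite /kf; lra.
pose ie := (4 * ke)^-1; pose jf := (4 * kf)^-1.
have ie0 : 0 < ie by rewrite invr_gt0; lra.
have jf0 : 0 < jf by rewrite invr_gt0; lra.
have y1 : (B * K * t) * E <= ke * E ^+ 2 + ie * (B * K) ^+ 2 * t ^+ 2.
  by rewrite mulrC -(mulrA ie) -exprMn; exact: young.
have y2 : (V * K * t) * F <= kf * F ^+ 2 + jf * (V * K) ^+ 2 * t ^+ 2.
  by rewrite mulrC -(mulrA jf) -exprMn; exact: young.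
have y3 : hi * om * F <= kf * F ^+ 2 + jf * hi ^+ 2 * om ^+ 2.
  by rewrite mulrC -(mulrA jf) -exprMn; exact: young.
have y4 : V * om * E <= ke * E ^+ 2 + ie * V ^+ 2 * om ^+ 2.
  by rewrite mulrC -(mulrA ie) -exprMn; exact: young.
have y5 : dl * K * h * E <= ke * E ^+ 2 + ie * (dl * K) ^+ 2 * h ^+ 2.
  by rewrite mulrC -(mulrA ie) -exprMn; exact: young.
have y6 : dl * KA * t * F <= kf * F ^+ 2 + jf * (dl * KA) ^+ 2 * t ^+ 2.
  by rewrite mulrC -(mulrA jf) -exprMn; exact: young.
(* Two terms contain [n]; each gets half of the allowance [dl * c / (4 * l ^+ 2)]. *)
pose w := c / (8 * l ^+ 2).
have l20 : 0 < l ^+ 2 by rewrite exprn_gt0.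
have w0 : 0 < w by rewrite divr_gt0// mulr_gt0.
have iw : (4 * w)^-1 = 2 * l ^+ 2 / c.
  by rewrite /w; field; rewrite !gt_eqF.
have y7 : dl * (2 * gm * V + mu) * (F * n) <=
    dl * w * n ^+ 2 + dl * (8 * mu ^+ 2 * l ^+ 2 / c) * F ^+ 2.
  apply: (@le_trans _ _ (dl * (n * (2 * mu * F)))).
    rewrite -mulrA ler_wpM2l ?(ltW dl0)// (_ : n * _ = 2 * mu * (F * n)); last by ring.
    by rewrite ler_wpM2r ?mulr_ge0//; lra.
  rewrite -!(mulrA dl) -mulrDr ler_wpM2l ?(ltW dl0)//.
  rewrite (le_trans (young _ _ w0))// iw le_eqVlt; apply/orP; left; apply/eqP.
  by field; rewrite gt_eqF.
have y8 : dl * (om * n) <= dl * w * n ^+ 2 + 2 * dl * l ^+ 2 / c * om ^+ 2.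
  have h1 := young n om w0; rewrite iw in h1.
  have h2 := ler_wpM2l (ltW dl0) h1; rewrite (mulrC om) (le_trans h2)//.
  rewrite le_eqVlt; apply/orP; left; apply/eqP; field; rewrite gt_eqF//.
have y9 : X * (E * F) <= X / 2 * E ^+ 2 + X / 2 * F ^+ 2.
  rewrite -mulrDr -mulrA ler_wpM2l//; have := sqr_ge0 (E - F); lra.
have y10 : K ^+ 2 * (h * t) <= K ^+ 2 * (t ^+ 2 + h ^+ 2 + om ^+ 2).
  rewrite ler_wpM2l ?sqr_ge0//.
  have := sqr_ge0 (h - t); have := sqr_ge0 om; have := sqr_ge0 h; have := sqr_ge0 t; lra.
have E20 := sqr_ge0 E; have F20 := sqr_ge0 F.
have z1 : X / 2 * E ^+ 2 <= dl * c / 16 * E ^+ 2 by rewrite ler_wpM2r//; lra.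
have z2 : X / 2 * F ^+ 2 <= mu * lo / 16 * F ^+ 2 by rewrite ler_wpM2r//; lra.
have z3 : 4^-1 * gm * hi * V * F ^+ 2 <= mu * lo / 16 * F ^+ 2.
  rewrite ler_wpM2r// (_ : _ * V = 4^-1 * (gm * hi * V)); last by ring.
  lra.
have z4 : dl * (8 * mu ^+ 2 * l ^+ 2 / c) * F ^+ 2 + dl * hi * F ^+ 2 <= mu * lo / 8 * F ^+ 2.
  by rewrite -mulrDl -mulrDr ler_wpM2r.
have wE : dl * c / (4 * l ^+ 2) = 2 * (dl * w).
  by rewrite /w; field; rewrite gt_eqF.
have t20 := sqr_ge0 t; have h20 := sqr_ge0 h; have om20 := sqr_ge0 om.
have c0' : 0 <= 2 * dl * l ^+ 2 / c.
  by rewrite divr_ge0 ?(ltW c0)// mulr_ge0 ?(ltW l20)// mulr_ge0// ltW.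
have B1 : 0 <= ie * (B * K) ^+ 2 by rewrite mulr_ge0 ?sqr_ge0// ltW.
have B2 : 0 <= jf * (V * K) ^+ 2 by rewrite mulr_ge0 ?sqr_ge0// ltW.
have B3 : 0 <= jf * hi ^+ 2 by rewrite mulr_ge0 ?sqr_ge0// ltW.
have B4 : 0 <= ie * V ^+ 2 by rewrite mulr_ge0 ?sqr_ge0// ltW.
have B5 : 0 <= ie * (dl * K) ^+ 2 by rewrite mulr_ge0 ?sqr_ge0// ltW.
have B6 : 0 <= jf * (dl * KA) ^+ 2 by rewrite mulr_ge0 ?sqr_ge0// ltW.
rewrite {}wE !(mulrDl _ _ (t ^+ 2 + h ^+ 2 + om ^+ 2)).
have up k y : 0 <= k -> y <= t ^+ 2 + h ^+ 2 + om ^+ 2 ->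
    k * y <= k * (t ^+ 2 + h ^+ 2 + om ^+ 2) by move=> k0 yk; rewrite ler_wpM2l.
have tS : t ^+ 2 <= t ^+ 2 + h ^+ 2 + om ^+ 2 by rewrite -addrA lerDl addr_ge0.
have hS : h ^+ 2 <= t ^+ 2 + h ^+ 2 + om ^+ 2 by rewrite addrAC lerDr addr_ge0.
have oS : om ^+ 2 <= t ^+ 2 + h ^+ 2 + om ^+ 2 by rewrite lerDr addr_ge0.
have [u1 u2 u3] := And3 (up _ _ B1 tS) (up _ _ B2 tS) (up _ _ B3 oS).
have [u4 u5 u6 u7] := And4 (up _ _ B4 oS) (up _ _ B5 hS) (up _ _ B6 tS) (up _ _ c0' oS).
rewrite -/ie -/jf !(mulrDr ie) !(mulrDr jf) !(mulrDl _ _ (t ^+ 2 + h ^+ 2 + om ^+ 2)).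
have kE : ke * E ^+ 2 = (dl * c * E ^+ 2) / 24 by rewrite /ke; field.
have kF : kf * F ^+ 2 = (mu * lo * F ^+ 2) / 24 by rewrite /kf; field.
rewrite kE in y1 y4 y5; rewrite kF in y2 y3 y6.
rewrite (_ : dl * c / 16 * E ^+ 2 = (dl * c * E ^+ 2) / 16) in z1; last by field.
rewrite (_ : mu * lo / 16 * F ^+ 2 = (mu * lo * F ^+ 2) / 16) in z2 z3; last by field.
rewrite (_ : mu * lo / 8 * F ^+ 2 = (mu * lo * F ^+ 2) / 8) in z4; last by field.
rewrite (_ : - (dl * c) * E ^+ 2 = - (dl * c * E ^+ 2)); last by ring.
rewrite (_ : - (3 / 4 * (dl * c)) * E ^+ 2 = - (3 / 4 * (dl * c * E ^+ 2))); last by ring.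
rewrite (_ : mu * lo / 2 * F ^+ 2 = (mu * lo * F ^+ 2) / 2); last by field.
have e1 : 0 <= dl * c * E ^+ 2 by rewrite mulr_ge0// ltW.
have f1 : 0 <= mu * lo * F ^+ 2 by rewrite mulr_ge0// ltW.
rewrite (_ : 2 * (dl * w) * n ^+ 2 = 2 * (dl * w * n ^+ 2)); last by ring.
clear - y1 y2 y3 y4 y5 y6 y7 y8 y9 y10 z1 z2 z3 z4 u1 u2 u3 u4 u5 u6 u7 e1 f1.
move: y1 y2 y3 y4 y5 y6 y7 y8 y9 y10 z1 z2 z3 z4 u1 u2 u3 u4 u5 u6 u7 e1 f1.
move: (t ^+ 2 + h ^+ 2 + om ^+ 2) => S.
move: (dl * c * E ^+ 2) (mu * lo * F ^+ 2) (dl * hi * F ^+ 2) => EE FF HF.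
move: (4^-1 * gm * hi * V * F ^+ 2) (B * K * t * E) (V * K * t * F) (hi * om * F) => a1 a2 a3 a4.
move: (V * om * E) (dl * K * h * E) (dl * KA * t * F) (dl * (2 * gm * V + mu) * (F * n)) => a5 a6 a7 a8.
move: (dl * (om * n)) (K ^+ 2 * (h * t)) (X * (E * F)) (X / 2 * E ^+ 2) (X / 2 * F ^+ 2) => a9 a10 a11 a12 a13.
move: (dl * w * n ^+ 2) (dl * (8 * mu ^+ 2 * l ^+ 2 / c) * F ^+ 2) => a14 a15.
move: (ie * (B * K) ^+ 2 * S) (ie * (B * K) ^+ 2 * t ^+ 2) => b1 b1'.
move: (jf * (V * K) ^+ 2 * S) (jf * (V * K) ^+ 2 * t ^+ 2) => b2 b2'.
move: (jf * hi ^+ 2 * S) (jf * hi ^+ 2 * om ^+ 2) => b3 b3'.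
move: (ie * V ^+ 2 * S) (ie * V ^+ 2 * om ^+ 2) => b4 b4'.
move: (ie * (dl * K) ^+ 2 * S) (ie * (dl * K) ^+ 2 * h ^+ 2) => b5 b5'.
move: (jf * (dl * KA) ^+ 2 * S) (jf * (dl * KA) ^+ 2 * t ^+ 2) => b6 b6'.
move: (2 * dl * l ^+ 2 / c * S) (2 * dl * l ^+ 2 / c * om ^+ 2) (K ^+ 2 * S) => b7 b7' b8.
by move=> *; lra.
Qed.

(** [a] is the mass residual, [A] its antiderivative, [b] the enthalpy consistency error, [N] the
    antiderivative error and [om] the momentum defect. Since [g = rho * f + s * e], the observer
    term contains [- mu * rho * f ^+ 2] and friction the nonpositive [- gam * rho * q * f]; since
    [p1] is a difference of [P'] plus a mean velocity times [f], the [dl] term contains the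
    convexity damping of [e]. What remains is linear in the perturbations, carries a factor [V], or
    is covered by [dlC]. *)
Lemma dissipation_pointwise kap B V K KA dl t h om r s rho v a b A N l :
  pressure_bounds p kap B -> 0 < rho_lo p -> 0 < cP p -> 0 < gam p -> 0 < muo p ->
  0 < dl -> 0 < l -> 0 < K -> 0 <= t -> 0 <= h -> 0 <= om ->
  rho_lo p <= rho <= rho_hi p -> rho_lo p <= r <= rho_hi p ->
  `|v| <= V -> `|s| <= V -> `|a| <= K * t -> `|b| <= K * h -> `|A| <= KA * t ->
  V * (2 * gam p * V + muo p + 2 * dl) <= dl * convexity / 8 ->
  V * (2 * gam p * V + muo p + 2 * dl) <= muo p * rho_lo p / 8 ->
  2 * gam p * V <= muo p -> gam p * rho_hi p * V <= muo p * rho_lo p / 4 ->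
  dl * (8 * muo p ^+ 2 * l ^+ 2 / convexity + rho_hi p) <= muo p * rho_lo p / 8 ->
  forall e f g q p1, e = rho - r -> f = v - s -> g = rho * v - r * s ->
  q = `|v| * v - `|s| * s -> p1 = enthalpy P0 rho v - enthalpy P0 r s ->
  p1 * a - b * a - gam p * (q * g) - muo p * (f * g) + om * `|g|
  + dl * (- (p1 * e) + b * e - gam p * (q * N) - muo p * (f * N) + om * `|N| + (g - A) * f)
  + 8^-1 * gam p * (r * f * (f * (`|v| + `|s|)))
  <= - (3 / 4 * (dl * convexity)) * e ^+ 2 - muo p * rho_lo p / 2 * f ^+ 2
     + dl * convexity / (4 * l ^+ 2) * N ^+ 2
     + ((4 * (dl * convexity / 24))^-1 * ((B * K) ^+ 2 + V ^+ 2 + (dl * K) ^+ 2)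
        + (4 * (muo p * rho_lo p / 24))^-1 *
            ((V * K) ^+ 2 + rho_hi p ^+ 2 + (dl * KA) ^+ 2)
        + 2 * dl * l ^+ 2 / convexity + K ^+ 2) * (t ^+ 2 + h ^+ 2 + om ^+ 2).
Proof.
move=> pb lo0 cP0 g0 mu0 dl0 l0 K0 t0 h0 om0 rhoI rI vV sV aK bK AK X1 X2 Vmu VD dlC e f g q p1 e_def f_def g_def q_def p1_def.
have [B0 /andP[k0 kl]] := (pb_B pb, pb_kap pb).
have V0 : 0 <= V by rewrite (le_trans _ vV).
have hi0 : 0 < rho_hi p by lra.
have c0 : 0 < convexity by rewrite divr_gt0.
have in1 z : rho_lo p <= z <= rho_hi p -> rho_lo p - kap <= z <= rho_hi p + kap by lra.
have := @quadratic_absorption convexity (rho_lo p) (rho_hi p) (gam p) (muo p) dl l B V K KA t h om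
  `|e| `|f| `|N| c0 lo0 hi0 g0 mu0 dl0 l0 V0 (normr_ge0 _) (normr_ge0 _) (normr_ge0 _) X1 X2 Vmu VD dlC.
rewrite !real_normK ?num_real//; apply: le_trans.
have Pc x : rho_lo p - kap <= x <= rho_hi p + kap -> convexity <= derive1n 2 P0 x.
  by case/(pb_bd pb).
have P2 x : rho_lo p - kap <= x <= rho_hi p + kap -> `|derive1n 2 P0 x| <= B.
  by case/(pb_bd pb).
pose D := P1 rho - P1 r.
have p1E : p1 = D + 2^-1 * (v + s) * f.
  by rewrite p1_def /enthalpy /D f_def; move: (P1 _) (P1 _) => x y; ring.
have De : convexity * e ^+ 2 <= D * e.
  have u1 := bregman_ge (pb_d0 pb) (pb_d1 pb) Pc (in1 _ rhoI) (in1 _ rI).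
  have u2 := bregman_ge (pb_d0 pb) (pb_d1 pb) Pc (in1 _ rI) (in1 _ rhoI).
  have e2 : (r - rho) ^+ 2 = e ^+ 2 by rewrite e_def; ring.
  rewrite e2 in u2; move: u1 u2; rewrite /D -e_def (_ : r - rho = - e); last by rewrite e_def; ring.
  move: (P0 _) (P0 _) (P1 _) (P1 _) (e ^+ 2) => y x z w ee u1 u2.
  have E1 : (z - w) * e - convexity * ee = (x - y - w * e - convexity / 2 * ee) +
    (y - x - z * - e - convexity / 2 * ee) by field.
  by rewrite -subr_ge0 E1; apply: addr_ge0; rewrite subr_ge0.
have DB : `|D| <= B * `|e|.
  rewrite e_def; exact: mvt_lip (pb_d1 pb) P2 _ _ (in1 _ rhoI) (in1 _ rI).
have vs : `|2^-1 * (v + s)| <= V.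
  rewrite normrM ger0_norm ?invr_ge0//; have := ler_normD v s; clear - p vV sV; lra.
have p1B : `|p1| <= B * `|e| + V * `|f|.
  by rewrite p1E (le_trans (ler_normD _ _))// lerD// normrM ler_wpM2r.
have gE : g = rho * f + s * e by rewrite g_def f_def e_def; ring.
have gB : `|g| <= rho_hi p * `|f| + V * `|e|.
  rewrite gE (le_trans (ler_normD _ _))// !normrM lerD// ler_wpM2r//.
  by case/andP: rhoI => rl rh; rewrite ger0_norm// (le_trans (ltW lo0)).
have qB : `|q| <= 2 * V * `|f| by rewrite q_def f_def; exact: absM_lip.
(* Monotonicity of [|x| * x], by the signs of [v] and [s]. *)
have qf : 0 <= q * f.
  rewrite q_def f_def.
  have [v0|v0] := leP 0 v; have [s0|s0] := leP 0 s.
  - rewrite !ger0_norm// (_ : _ * _ = (v + s) * (v - s) ^+ 2); last by ring.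
    by rewrite mulr_ge0 ?sqr_ge0// addr_ge0.
  - rewrite (ger0_norm v0) (ltr0_norm s0) mulr_ge0//; last by rewrite subr_ge0 (le_trans (ltW s0)).
    by rewrite mulNr opprK addr_ge0// -?expr2 sqr_ge0.
  - rewrite (ltr0_norm v0) (ger0_norm s0) -mulrNN mulr_ge0//; last by rewrite opprB subr_ge0 (le_trans (ltW v0)).
    by rewrite mulNr opprB opprK addr_ge0// -?expr2 sqr_ge0.
  - rewrite !ltr0_norm// (_ : _ * _ = (- v - s) * (v - s) ^+ 2); last by ring.
    by rewrite mulr_ge0 ?sqr_ge0// addr_ge0 ?oppr_ge0// ltW.
have ef0 : 0 <= `|e| * `|f| by rewrite mulr_ge0.
have f2E : `|f| ^+ 2 = f ^+ 2 by rewrite real_normK ?num_real.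
have up (x y : R) : `|x| <= y -> x <= y by exact/le_trans/ler_norm.
have upN (x y : R) : `|x| <= y -> - x <= y by move=> xy; apply: up; rewrite normrN.
have s1 : p1 * a <= B * K * t * `|e| + V * K * t * `|f|.
  apply: up; rewrite (_ : _ + _ = (B * `|e| + V * `|f|) * (K * t)); last by ring.
  exact: absM_le.
have s2 : - (b * a) <= K ^+ 2 * (h * t).
  apply: upN; rewrite (_ : _ * (h * t) = (K * h) * (K * t)); last by ring.
  exact: absM_le.
have s3 : - (gam p * (q * g)) <= 2 * gam p * V * V * (`|e| * `|f|).
  have h1 : - (q * g) <= 2 * V * `|f| * (V * `|e|).
    rewrite gE (_ : - _ = - (rho * (q * f)) + - (q * (s * e))); last by ring.
    rewrite -[leRHS]add0r lerD//; first by rewrite oppr_le0 mulr_ge0// (le_trans (ltW lo0))//; case/andP: rhoI.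
    by apply: upN; apply: absM_le => //; rewrite normrM ler_wpM2r.
  rewrite -mulrN (_ : 2 * gam p * V * V * _ = gam p * (2 * V * `|f| * (V * `|e|))); last by ring.
  by rewrite ler_wpM2l// ltW.
have fse : - (f * (s * e)) <= V * (`|e| * `|f|).
  apply: upN; rewrite (_ : V * _ = `|f| * (V * `|e|)); last by ring.
  by apply: absM_le => //; rewrite normrM ler_wpM2r.
have s4 : - (muo p * (f * g)) <= - muo p * rho_lo p * f ^+ 2 + muo p * V * (`|e| * `|f|).
  rewrite gE (_ : - (muo p * _) = muo p * (- (rho * f ^+ 2) + - (f * (s * e)))); last by ring.
  rewrite (_ : - muo p * rho_lo p * f ^+ 2 + _ =
    muo p * (- (rho_lo p * f ^+ 2) + V * (`|e| * `|f|))); last by ring.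
  rewrite ler_wpM2l ?(ltW mu0)// lerD// lerN2 ler_wpM2r ?sqr_ge0//; by case/andP: rhoI.
have s5 : om * `|g| <= rho_hi p * om * `|f| + V * om * `|e|.
  rewrite (_ : rho_hi p * _ * _ + _ = om * (rho_hi p * `|f| + V * `|e|)); last by ring.
  by rewrite ler_wpM2l.
have s6 : - (p1 * e) <= - convexity * e ^+ 2 + V * (`|e| * `|f|).
  rewrite p1E (_ : - _ = - (D * e) + - (2^-1 * (v + s) * (f * e))); last by ring.
  rewrite mulNr lerD ?lerN2//; apply: upN; apply: absM_le => //.
  by rewrite normrM mulrC.
have s7 : b * e <= K * h * `|e| by apply: up; rewrite normrM ler_wpM2r.
have s8 : - (gam p * (q * N)) <= 2 * gam p * V * (`|f| * `|N|).
  rewrite -mulrN (_ : 2 * gam p * V * _ = gam p * (2 * V * `|f| * `|N|)); last by ring.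
  by rewrite ler_wpM2l ?(ltW g0)//; apply: upN; rewrite normrM ler_wpM2r.
have s9 : - (muo p * (f * N)) <= muo p * (`|f| * `|N|).
  by rewrite -mulrN ler_wpM2l ?(ltW mu0)//; apply: upN; rewrite normrM.
have s10 : (g - A) * f <= rho_hi p * f ^+ 2 + V * (`|e| * `|f|) + KA * t * `|f|.
  rewrite -f2E; apply: up.
  rewrite (_ : _ + _ + _ = ((rho_hi p * `|f| + V * `|e|) + KA * t) * `|f|); last by ring.
  rewrite normrM ler_wpM2r// (le_trans (ler_normB _ _))// lerD//.
have s11 : 8^-1 * gam p * (r * f * (f * (`|v| + `|s|))) <= 4^-1 * gam p * rho_hi p * V * f ^+ 2.
  rewrite (_ : 8^-1 * _ * _ = 8^-1 * gam p * f ^+ 2 * (r * (`|v| + `|s|))); last by ring.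
  rewrite (_ : 4^-1 * _ * _ * _ * _ = 8^-1 * gam p * f ^+ 2 * (rho_hi p * (V + V))); last by field.
  apply: ler_wpM2l.
    by apply: mulr_ge0; [rewrite mulr_ge0 ?invr_ge0// ltW|exact: sqr_ge0].
  have /andP[rl rh] := rI; have rr := le_trans (ltW lo0) rl.
  by rewrite ler_pM ?addr_ge0// lerD.
have S : - (p1 * e) + b * e - gam p * (q * N) - muo p * (f * N) + om * `|N| + (g - A) * f <=
  - convexity * e ^+ 2 + 2 * V * (`|e| * `|f|) + K * h * `|e| +
    (2 * gam p * V + muo p) * (`|f| * `|N|) + om * `|N| + rho_hi p * f ^+ 2 + KA * t * `|f|.
  rewrite (mulrDl _ _ (`|f| * `|N|)) (_ : 2 * V * _ = V * (`|e| * `|f|) + V * (`|e| * `|f|)); last by ring.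
  move: s6 s7 s8 s9 s10.
  move: (- convexity * _) (V * _) (K * h * _) (2 * gam p * V * _) (muo p * (`|f| * _)) (rho_hi p * _) (KA * t * _) => z1 z2 z3 z4 z5 z6 z7.
  move: (p1 * e) (b * e) (gam p * _) (muo p * _) (om * _) (_ * f) => z8 z9 z10 z11 z12 z13.
  by clear; move=> *; lra.
have S' := ler_wpM2l (ltW dl0) S.
have XE : V * (2 * gam p * V + muo p + 2 * dl) * (`|e| * `|f|) =
  2 * gam p * V * V * (`|e| * `|f|) + muo p * V * (`|e| * `|f|) + dl * (2 * V * (`|e| * `|f|)) by ring.
rewrite XE.
have SE : dl * (- convexity * e ^+ 2 + 2 * V * (`|e| * `|f|) + K * h * `|e| +
    (2 * gam p * V + muo p) * (`|f| * `|N|) + om * `|N| + rho_hi p * f ^+ 2 + KA * t * `|f|) =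
  - (dl * convexity) * e ^+ 2 + dl * (2 * V * (`|e| * `|f|)) + dl * K * h * `|e| +
  dl * (2 * gam p * V + muo p) * (`|f| * `|N|) + dl * (om * `|N|) + dl * rho_hi p * f ^+ 2 +
  dl * KA * t * `|f| by ring.
rewrite SE in S'.
rewrite (_ : - muo p * rho_lo p * f ^+ 2 = - (muo p * rho_lo p * f ^+ 2)) in s4; last by ring.
clear - s1 s2 s3 s4 s5 s11 S'; move: s1 s2 s3 s4 s5 s11 S'.
move: (- (dl * convexity) * e ^+ 2) (dl * (2 * V * (`|e| * `|f|))) => z1 z2.
move: (dl * K * h * `|e|) (dl * (2 * gam p * V + muo p) * (`|f| * `|N|)) (dl * (om * `|N|)) => z3 z4 z5.
move: (dl * rho_hi p * f ^+ 2) (dl * KA * t * `|f|) => z6 z7.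
move: (2 * gam p * V * V * (`|e| * `|f|)) (muo p * V * (`|e| * `|f|)) => z8 z9.
move: (B * K * t * `|e|) (V * K * t * `|f|) (K ^+ 2 * (h * t)) => z10 z11 z12.
move: (muo p * rho_lo p * f ^+ 2) (rho_hi p * om * `|f|) (V * om * `|e|) (4^-1 * gam p * rho_hi p * V * f ^+ 2) => z13 z14 z15 z16.
move: (dl * (_ + _ + _)) (8^-1 * _ * _) (p1 * a) (b * a) (gam p * (q * g)) (muo p * (f * g)) (om * `|g|) => *.
lra.
Qed.

End Pointwise.

(** * The discrete energy balance *)

Ltac bmeas_tac := repeat lazymatch goal with
  | H : bmeas ?a ?b ?f |- bmeas ?a ?b ?f => exact: H
  | |- bmeas _ _ (fun x => @?f x + @?g x) => apply: bmD
  | |- bmeas _ _ (fun x => - @?f x) => apply: bmN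
  | |- bmeas _ _ (fun x => @?f x * @?g x) => apply: bmM
  | |- bmeas _ _ (fun x => @?f x ^+ 2) => apply: bmX2
  | |- bmeas _ _ (fun x => `|@?f x|) => apply: bm_norm
  | |- bmeas _ _ (fun=> _) => exact: bm_cst
  | _ => assumption
  end.

(** The Young weight [(2 * l)^-1] balances the factor [l ^+ 2] of Poincare's inequality, so that
    both errors receive the weight [l / 2]. *)
Lemma mass_velocity_le {R : realType} (l : R) (e f N : R -> R) : 0 < l ->
  bmeas 0 l e -> bmeas 0 l f -> bmeas 0 l N ->
  (forall x, 0 <= x <= l -> N x = - intg 0 x e) ->
  `|intg 0 l (fun x => N x * f x)| <=
  l / 2 * (intg 0 l (fun x => e x * e x) + intg 0 l (fun x => f x * f x)).
Proof.
move=> l0 be bf bN HN; have l2 : 0 < (2 * l)^-1 by rewrite invr_gt0 mulr_gt0.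
have sq g : intg 0 l (fun x => g x * g x) = intg 0 l (fun x => g x ^+ 2).
  by apply: eq_intg => x _; rewrite expr2.
have PN : intg 0 l (fun x => N x ^+ 2) <= l ^+ 2 * intg 0 l (fun x => e x ^+ 2).
  have := poincare (ltW l0) be; rewrite subr0.
  by congr (_ <= _); apply: eq_intg => x xl; rewrite HN// sqrrN.
apply: le_trans (ler_norm_intg (bmM bN bf)) _.
apply: (@le_trans _ _ (intg 0 l (fun x => (2 * l)^-1 * N x ^+ 2 + l / 2 * f x ^+ 2))).
  apply: le_intg; [by bmeas_tac|by bmeas_tac|] => x _; rewrite normrM.
  apply: le_trans (young _ _ l2) _.
  rewrite !real_normK ?num_real// lerD2l ler_wpM2r ?sqr_ge0//.
  by rewrite le_eqVlt; apply/orP; left; apply/eqP; field; rewrite gt_eqF.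
rewrite intgD; [|by bmeas_tac..]; rewrite !intgZ; [|by bmeas_tac..].
rewrite !sq mulrDr lerD2r.
apply: le_trans (ler_wpM2l (ltW l2) PN) _; rewrite mulrA.
rewrite (_ : (2 * l)^-1 * l ^+ 2 = l / 2)//.
by field; rewrite gt_eqF.
Qed.

(** * Combining the tested balances *)

Section Assembly.
Context {R : realType} (l : R) (l_gt0 : 0 < l).
Local Notation lmu := (@lebesgue_measure R).
Local Notation J f := (intg 0 l f).
Variables psi psio p1 b bo a G dG q f fo e eo N No A Dd : R -> R.
Variables t om dl gm mu c1 C5 : R.
Hypotheses (b_psi : bmeas 0 l psi) (b_psio : bmeas 0 l psio) (b_p1 : bmeas 0 l p1)
  (b_b : bmeas 0 l b) (b_bo : bmeas 0 l bo) (b_a : bmeas 0 l a) (b_G : bmeas 0 l G)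
  (b_dG : bmeas 0 l dG) (b_q : bmeas 0 l q) (b_f : bmeas 0 l f) (b_fo : bmeas 0 l fo)
  (b_e : bmeas 0 l e) (b_eo : bmeas 0 l eo) (b_N : bmeas 0 l N) (b_No : bmeas 0 l No)
  (b_A : bmeas 0 l A) (b_Dd : bmeas 0 l Dd).
Hypotheses (t0 : 0 <= t) (dl0 : 0 < dl).
Hypothesis H1 : {ae lmu, forall x, `[0, l]%classic x ->
  psi x - psio x <= p1 x * (e x - eo x) + G x * (f x - fo x)
    - c1 * ((e x - eo x) ^+ 2 + (f x - fo x) ^+ 2) + C5 * (eo x ^+ 2 + fo x ^+ 2)}.
Hypothesis H2 : {ae lmu, forall x, `[0, l]%classic x -> e x - eo x = t * (a x - dG x)}.
Hypothesis H3 : J (fun x => (f x - fo x) * G x) <=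
  t * (J (fun x => p1 x * dG x) - J (fun x => b x * dG x)
    - gm * J (fun x => q x * G x) - mu * J (fun x => f x * G x) + om * J (fun x => `|G x|)).
Hypothesis H4 : J (fun x => (f x - fo x) * N x) <=
  t * (- J (fun x => p1 x * e x) + J (fun x => b x * e x)
    - gm * J (fun x => q x * N x) - mu * J (fun x => f x * N x) + om * J (fun x => `|N x|)).
Hypothesis H5 : forall x, 0 <= x <= l -> N x - No x = t * (G x - A x).

Let Z x := t * (p1 x * a x - b x * a x - gm * (q x * G x) - mu * (f x * G x) + om * `|G x|
    + dl * (- (p1 x * e x) + b x * e x - gm * (q x * N x) - mu * (f x * N x) + om * `|N x|
        + (G x - A x) * f x))
  - (b x - bo x) * eo x - c1 * ((e x - eo x) ^+ 2 + (f x - fo x) ^+ 2)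
  + C5 * (eo x ^+ 2 + fo x ^+ 2) - dl * ((N x - No x) * (f x - fo x)).

Let T1 x := (f x - fo x) * G x - t * (p1 x * dG x - b x * dG x - gm * (q x * G x)
  - mu * (f x * G x) + om * `|G x|).
Let T2 x := (f x - fo x) * N x - t * (- (p1 x * e x) + b x * e x - gm * (q x * N x)
  - mu * (f x * N x) + om * `|N x|).

(** The suffix [o] marks the old time level. [H1] is the chain rule, [H2] the mass balance with
    residual [a], [H3] and [H4] the momentum balance tested with the momentum error [G] and with the
    antiderivative error [N], [H5] the integrated mass balance. The pairing of [p1] with [dG] occurs
    in [H3] and, through [H2], in [H1], with opposite signs, and drops out. The drift of the
    consistency term is summed by parts: [b * e - bo * eo] is [b * (e - eo)], which cancels the
    pairing of [b] with [dG], plus [(b - bo) * eo]. *)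
Lemma energy_increment_le :
  (J psi + dl * J (fun x => N x * f x)) - (J psio + dl * J (fun x => No x * fo x))
  - (J (fun x => b x * e x) - J (fun x => bo x * eo x)) <= J Z.
Proof.
have bZ : bmeas 0 l Z by rewrite /Z; bmeas_tac.
have bT1 : bmeas 0 l T1 by rewrite /T1; bmeas_tac.
have bT2 : bmeas 0 l T2 by rewrite /T2; bmeas_tac.
have JT1 : J T1 <= 0.
  rewrite /T1 intgB; [|bmeas_tac..].
  rewrite intgZ; last by bmeas_tac.
  rewrite intgD; [|bmeas_tac..].
  do 3 (rewrite intgB; [|bmeas_tac..]).
  do 3 (rewrite intgZ; last by bmeas_tac).
  by rewrite subr_le0.
have JT2 : J T2 <= 0.
  rewrite /T2 intgB; [|bmeas_tac..].
  rewrite intgZ; last by bmeas_tac.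
  rewrite intgD; [|bmeas_tac..].
  do 2 (rewrite intgB; [|bmeas_tac..]).
  rewrite intgD; [|bmeas_tac..].
  rewrite intgN; last by bmeas_tac.
  do 3 (rewrite intgZ; last by bmeas_tac).
  by rewrite subr_le0.
have -> : (J psi + dl * J (fun x => N x * f x)) - (J psio + dl * J (fun x => No x * fo x))
  - (J (fun x => b x * e x) - J (fun x => bo x * eo x)) =
  J (fun x => (psi x + dl * (N x * f x)) - (psio x + dl * (No x * fo x))
     - (b x * e x - bo x * eo x)).
  do 3 (rewrite intgB; [|bmeas_tac..]).
  do 2 (rewrite intgD; [|bmeas_tac..]).
  by do 2 (rewrite intgZ; last by bmeas_tac).
(* [H3] and [H4] hold only after integration. Adding [T1] and [T2], whose integrals are nonpositive,
   reduces the claim to a pointwise inequality that is linear in [H1], [H2] and [H5]. *)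
apply: (@le_trans _ _ (J (fun x => Z x + (T1 x + dl * T2 x)))).
  apply: le_intg_ae; [bmeas_tac|bmeas_tac|].
  apply: aeS2 H1 H2 => x h1 h2 xl; have {h1} h1 := h1 xl; have {h2} h2 := h2 xl.
  have h5 := H5 xl; rewrite /Z /T1 /T2.
  rewrite -subr_ge0; move: h1; rewrite -subr_ge0 => h1; apply: le_trans h1 _.
  rewrite le_eqVlt; apply/orP; left; apply/eqP.
  have h6 : t * p1 x * dG x = t * p1 x * a x - p1 x * (e x - eo x).
    by rewrite h2; ring.
  have h7 : t * b x * dG x = t * b x * a x - b x * (e x - eo x) by rewrite h2; ring.
  have h8 : dl * (t * (G x - A x) * f x) = dl * ((N x - No x) * f x) by rewrite h5.
  apply/eqP; rewrite -subr_eq0; apply/eqP.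
  transitivity ((t * p1 x * dG x - (t * p1 x * a x - p1 x * (e x - eo x)))
    - (t * b x * dG x - (t * b x * a x - b x * (e x - eo x)))
    - (dl * (t * (G x - A x) * f x) - dl * ((N x - No x) * f x))); last first.
    by rewrite h6 h7 h8 !subrr; ring.
  ring.
rewrite (intgD bZ (bmD bT1 (bmZ dl bT2))) (intgD bT1 (bmZ dl bT2)) (intgZ dl bT2).
rewrite gerDl; move: JT1 JT2; move: (J T1) (J T2) => x y x0 y0.
by have := ler_wpM2l (ltW dl0) y0; rewrite mulr0; lra.
Qed.

Variables (kE kF kN CS th : R) (S2 : R).
Hypotheses (c1l : dl * l <= 2 * c1) (kN0 : 0 <= kN).
Hypothesis HZ : {ae lmu, forall x, `[0, l]%classic x ->
  p1 x * a x - b x * a x - gm * (q x * G x) - mu * (f x * G x) + om * `|G x|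
    + dl * (- (p1 x * e x) + b x * e x - gm * (q x * N x) - mu * (f x * N x) + om * `|N x|
        + (G x - A x) * f x) + Dd x
  <= - kE * e x ^+ 2 - kF * f x ^+ 2 + kN * N x ^+ 2 + CS}.
Hypothesis Hb : {ae lmu, forall x, `[0, l]%classic x ->
  - ((b x - bo x) * eo x) <= t * (th * eo x ^+ 2 + S2)}.
Hypothesis HN : forall x, 0 <= x <= l -> N x = - intg 0 x e.
Hypothesis HNo : forall x, 0 <= x <= l -> No x = - intg 0 x eo.

(** The product of the increments of [N] and [f] is left by the [dl] term. Young's inequality splits
    it; the square in [f] is paid pointwise by [c1], and the square in [N] becomes, by Poincare, a
    square of the density increment that [c1] also pays. Both uses require exactly
    [dl * l <= 2 * c1]. *)
Lemma energy_increment_bound : 0 <= C5 -> 0 <= th ->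
  (J psi + dl * J (fun x => N x * f x)) - (J psio + dl * J (fun x => No x * fo x))
  - (J (fun x => b x * e x) - J (fun x => bo x * eo x))
  <= t * (- (kE - kN * l ^+ 2) * J (fun x => e x * e x) - kF * J (fun x => f x * f x)
      - J Dd + (CS + S2) * l)
     + (t * th + C5) * (J (fun x => eo x * eo x) + J (fun x => fo x * fo x)).
Proof.
move=> C50 th0; apply: le_trans energy_increment_le _.
have dl2 : 0 <= dl / (2 * l) by rewrite divr_ge0 ?mulr_ge0// ltW.
have bZ : bmeas 0 l Z by rewrite /Z; bmeas_tac.
apply: (@le_trans _ _ (J (fun x => t * (- kE * e x ^+ 2 - kF * f x ^+ 2 + kN * N x ^+ 2
    - Dd x + (CS + S2)) + (dl / (2 * l) * (N x - No x) ^+ 2 - c1 * (e x - eo x) ^+ 2)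
    + (t * th + C5) * (eo x ^+ 2 + fo x ^+ 2)))).
  apply: le_intg_ae => //; first by bmeas_tac.
  apply: aeS2 HZ Hb => x hz hb xl; have {hz} hz := ler_wpM2l t0 (hz xl).
  have {hb} hb := hb xl; rewrite /Z.
  have y1 : - dl * ((N x - No x) * (f x - fo x)) <=
      dl / (2 * l) * (N x - No x) ^+ 2 + c1 * (f x - fo x) ^+ 2.
    have h1 : - ((N x - No x) * (f x - fo x)) <=
        (2 * l)^-1 * (N x - No x) ^+ 2 + l / 2 * (f x - fo x) ^+ 2.
      rewrite -mulrN.
      have := @young R (2 * l)^-1 (N x - No x) (- (f x - fo x)).
      rewrite invr_gt0 mulr_gt0// => /(_ isT)/le_trans; apply; rewrite sqrrN.
      by rewrite (_ : (4 * (2 * l)^-1)^-1 = l / 2)//; field; rewrite gt_eqF.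
    have h2 := ler_wpM2l (ltW dl0) h1; rewrite mulNr -mulrN (le_trans h2)//.
    rewrite mulrDr mulrA lerD// mulrA ler_wpM2r ?sqr_ge0//.
    by rewrite mulrA ler_pdivrMr// (mulrC c1).
  have fo2 : 0 <= t * th * fo x ^+ 2 by rewrite mulr_ge0 ?sqr_ge0// mulr_ge0.
  rewrite -subr_ge0 in hz; rewrite -subr_ge0 in hb; rewrite -subr_ge0 in y1.
  rewrite -subr_ge0; apply: le_trans (addr_ge0 (addr_ge0 hz hb) (addr_ge0 y1 fo2)) _.
  by rewrite le_eqVlt; apply/orP; left; apply/eqP; ring.
do 2 (rewrite intgD; [|bmeas_tac..]).
rewrite intgZ; last by bmeas_tac.
rewrite intgB; [|bmeas_tac..].
do 2 (rewrite intgZ; last by bmeas_tac).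
rewrite intgZ; last by bmeas_tac.
rewrite intgD; [|bmeas_tac..]; rewrite intgB; [|bmeas_tac..].
do 2 (rewrite intgD; [|bmeas_tac..]).
rewrite intgB; [|bmeas_tac..].
do 3 (rewrite intgZ; last by bmeas_tac).
rewrite !(intg_cst _ (ltW l_gt0)) (intgD (bmX2 b_eo) (bmX2 b_fo)) subr0.
have sq g : J (fun x => g x ^+ 2) = J (fun x => g x * g x).
  by apply: eq_intg => x _; rewrite expr2.
have PN : J (fun x => N x ^+ 2) <= l ^+ 2 * J (fun x => e x * e x).
  rewrite -sq; have := poincare (ltW l_gt0) b_e; rewrite subr0.
  by congr (_ <= _); apply: eq_intg => x xl; rewrite HN// sqrrN.
have PdN : J (fun x => (N x - No x) ^+ 2) <= l ^+ 2 * J (fun x => (e x - eo x) ^+ 2).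
  have := poincare (ltW l_gt0) (bmB b_e b_eo); rewrite subr0.
  congr (_ <= _); apply: eq_intg => x xl; rewrite HN// HNo// intgB.
  - by rewrite -opprB sqrrN; congr (_ ^+ 2); ring.
  - by apply: bm_sub b_e => //; lra.
  - by apply: bm_sub b_eo => //; lra.
have Jde : 0 <= J (fun x => (e x - eo x) ^+ 2).
  by apply: intg_ge0; [bmeas_tac|apply: aeW => x _; exact: sqr_ge0].
have q1 : dl / (2 * l) * J (fun x => (N x - No x) ^+ 2) - c1 * J (fun x => (e x - eo x) ^+ 2) <= 0.
  rewrite subr_le0 (le_trans (ler_wpM2l dl2 PdN))// mulrA ler_wpM2r//.
  rewrite (_ : _ * l ^+ 2 = dl * l / 2); last by field; rewrite gt_eqF.
  by rewrite ler_pdivrMr// (mulrC c1).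
have q2 := ler_wpM2l t0 (ler_wpM2l kN0 PN).
have S0 g : J (fun x => g x ^+ 2) = J (fun x => g x * g x) by exact: sq.
rewrite !S0 in q1 q2 *; move: q1 q2.
move: (J (fun x => e x * e x)) (J (fun x => f x * f x)) (J (fun x => N x * N x)) => x1 x2 x3.
move: (dl / (2 * l) * J _ - c1 * J _) => x4.
move: (J Dd) (J (fun x => eo x * eo x)) (J (fun x => fo x * fo x)) => x5 x6 x7 q1 q2.
rewrite lerD2r -subr_ge0.
rewrite (_ : _ - _ = (t * (kN * (l ^+ 2 * x1)) - t * (kN * x3)) - x4); last by ring.
by rewrite subr_ge0 (le_trans q1)// subr_ge0.
Qed.

End Assembly.

(** * Functions determined on cell interiors *)

Section CellwiseFunctions.
Context {R : realType} (l : R) (M : nat) (l_gt0 : 0 < l) (M_gt0 : (0 < M)%N).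
Local Notation nd := (node l M).
Local Notation lmu := (@lebesgue_measure R).

Lemma ae_interior (Q : R -> Prop) : (forall i x, interior_point l M i x -> Q x) ->
  {ae lmu, forall x, `[0, l]%classic x -> Q x}.
Proof. by move=> H; apply: (ae_cells l_gt0 M_gt0) => i x iM xI; apply: (H i). Qed.

Lemma bm_interior_affine f : (forall i, (i < M)%N -> exists a b, forall x,
  interior_point l M i x -> f x = a + b * x) -> bmeas 0 l f.
Proof.
move=> fA; apply: (bm_cells l_gt0 M_gt0) => i iM; have [a [b fE]] := fA i iM.
apply: (@bm_open _ _ _ _ (fun x => a + b * x)); last first.
  by move=> x xI; apply: fE; split.
apply: (@bm_lip _ _ _ _ `|b|) => x y _ _.
by rewrite (_ : _ - _ = b * (x - y)) ?normrM//; ring.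
Qed.

Lemma bm_Qh_comp (F : R -> R) q : Qh l M q -> bmeas 0 l (fun x => F (q x)).
Proof.
move=> qQ; apply: bm_interior_affine => i iM; have [c qc] := qQ i iM.
by exists (F c), 0 => x [_ xI]; rewrite qc// mul0r addr0.
Qed.

Definition cell_affine (f : R -> R) : Prop := forall i, (i < M)%N ->
  exists a b, forall x, nd i <= x <= nd i.+1 -> f x = a + b * x.

Lemma cell_affine_bm f : cell_affine f -> bmeas 0 l f.
Proof.
move=> fA; apply: bm_interior_affine => i iM; have [a [b fE]] := fA i iM.
by exists a, b => x [_ xI]; apply: fE; lra.
Qed.

Lemma cell_affine_vel q f : Qh l M q -> cell_affine f -> bmeas 0 l (vel q f).
Proof.
move=> qQ fA; apply: bm_interior_affine => i iM.
have [c qc] := qQ i iM; have [a [b fE]] := fA i iM.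
exists (a / c), (b / c) => x [_ xI].
by rewrite /vel qc// fE; [ring|lra].
Qed.

Lemma cell_affine_Ih f : cell_affine (Ih l M f).
Proof.
move=> i iM; have [_ /(_ i iM)[a [b fE]]] := Ih_Rh l_gt0 M_gt0 f.
exists (a + f 0), b => x /fE E.
by rewrite addrAC -E; ring.
Qed.

Lemma Qh_diff_eq0 q : Qh l M q -> intg 0 l (fun x => q x * q x) = 0 ->
  forall i x, interior_point l M i x -> q x = 0.
Proof.
move=> qQ q0 i x [iM xI]; have [c qc] := qQ i iM.
have bq := bm_Qh_comp (fun y => y * y) qQ.
have i0 := node_ge0 l_gt0 M_gt0 i; have il := node_le_l l_gt0 M_gt0 iM.
have ii := ltW (node_lt l_gt0 M_gt0 i).
have q20 u v : 0 <= u -> v <= l -> 0 <= intg u v (fun x => q x * q x).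
  move=> u0 vl; apply: intg_ge0; first exact: bm_sub bq.
  by apply: aeW => y _; rewrite -expr2 sqr_ge0.
have : intg (nd i) (nd i.+1) (fun x => q x * q x) <= 0.
  rewrite -q0 (intg_split _ _ bq (c := nd i)); [|by []|lra].
  rewrite (intg_split ii il (bm_sub i0 (lexx l) bq)).
  have := q20 0 (nd i) (lexx 0) ltac:(lra).
  have := q20 (nd i.+1) l ltac:(lra) (lexx l).
  move: (intg _ _ _) (intg _ _ _) (intg _ _ _) => u v w; lra.
have -> : intg (nd i) (nd i.+1) (fun x => q x * q x) = c * c * mesh l M.
  rewrite -(nodeB l M i) -intg_cst//; apply: eq_intg_ae; [exact: bm_sub bq|exact: bm_cst|].
  apply: aeS (ae_neq2 (nd i) (nd i.+1)) => y [y1 y2]; rewrite /= in_itv/= => yI.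
  by rewrite !qc//; lra.
rewrite pmulr_lle0 ?mesh_gt0// -expr2 => c2.
rewrite qc//; apply/eqP; rewrite -sqrf_eq0; apply/eqP/le_anti.
by rewrite c2 sqr_ge0.
Qed.

Lemma intg_mul_le k (X r : R -> R) : bmeas 0 l X -> bmeas 0 l r ->
  (forall i x, interior_point l M i x -> `|X x| <= k) ->
  `|intg 0 l (fun x => X x * r x)| <= k * intg 0 l (fun x => `|r x|).
Proof.
move=> bX br Xk; apply: le_trans (ler_norm_intg (bmM bX br)) _.
rewrite -intgZ; last exact: bm_norm.
apply: le_intg_ae; [exact/bm_norm/bmM|exact/bmZ/bm_norm|].
by apply: ae_interior => i x xI; rewrite normrM ler_wpM2r//; exact: Xk xI.
Qed.

End CellwiseFunctions.

(** * One step of the scheme *)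

Section ConcreteStep.
Context {R : realType} (p : param R) (d : refdata R) (M : nat) (tau : R).
Context (rho m : nat -> R -> R) (vbar K1 K2 kap B Ct : R).
Hypotheses (hp : valid_param p) (pb : pressure_bounds p kap B).
Hypotheses (rb : reference_bounds p d K1 Ct) (pj : projection_bounds p d K2 Ct vbar).
Hypotheses (M_gt0 : (0 < M)%N) (tau_gt0 : 0 < tau).
Hypotheses (sch : scheme p d M tau rho m) (dbd : discrete_bounds p M rho m vbar).
Hypothesis vhatB : forall t x, 0 <= t -> 0 <= x <= ell p -> `|vhat d t x| <= vbar.
Local Notation l := (ell p).
Local Notation lmu := (@lebesgue_measure R).
Local Notation t n := (n%:R * tau).
Local Notation J f := (intg 0 l f).
Local Notation h := (mesh l M).
Local Notation r n := (Pih l M (rhat d (t n))).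
Local Notation mh n := (Ih l M (mhat d (t n))).
Local Notation s n := (vel (r n) (mh n)).
Local Notation v n := (vh rho m n).
Local Notation V := (rho_hi p / rho_lo p * vbar).
Local Notation int i x := (interior_point l M i x).

Let l_gt0 : 0 < l. Proof. by case: hp => -[]. Qed.
Let lo_gt0 : 0 < rho_lo p. Proof. by case: hp => _ _ []. Qed.
Let lohi : rho_lo p < rho_hi p. Proof. by case: hp => _ _ []. Qed.
Let cP_gt0 : 0 < cP p. Proof. by case: hp => _ _ []. Qed.
Let gam_gt0 : 0 < gam p. Proof. by case: hp => -[]. Qed.
Let mu_gt0 : 0 < muo p. Proof. by case: hp => -[]. Qed.
Let tn_ge0 n : 0 <= t n. Proof. by rewrite mulr_ge0// ltW. Qed.
Let h_gt0 : 0 < h. Proof. exact: mesh_gt0. Qed.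

Lemma rho_itv n i x : int i x -> rho_lo p <= rho n x <= rho_hi p.
Proof. by move=> [iM xI]; have [] := dbd n iM xI. Qed.

Lemma r_itv n i x : int i x -> rho_lo p <= r n x <= rho_hi p.
Proof. by move=> xI; exact: (pj_rho pj M_gt0 xI (tn_ge0 n)). Qed.

Lemma v_vbar n i x : int i x -> `|v n x| <= vbar.
Proof. by move=> [iM xI]; have [] := dbd n iM xI. Qed.

Lemma vbar_ge0 (n i : nat) x : int i x -> 0 <= vbar.
Proof. by move=> xI; apply: le_trans (v_vbar n xI). Qed.

Lemma v_bound n i x : int i x -> `|v n x| <= V.
Proof.
move=> xI; apply: le_trans (v_vbar n xI) _; rewrite ler_peMl ?(vbar_ge0 n xI)//.
by rewrite ler_pdivlMr// mul1r ltW.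
Qed.

Lemma s_bound n i x : int i x -> `|s n x| <= V.
Proof. by move=> xI; exact: (pj_v pj M_gt0 xI (tn_ge0 n)). Qed.

Lemma rhoQ n : Qh l M (rho n). Proof. by have [] := sch.1 n. Qed.
Lemma rQ n : Qh l M (r n). Proof. exact: Pih_Qh. Qed.

Lemma m_affine n : cell_affine l M (m n).
Proof.
have [_ [_ mA]] := sch.1 n; move=> i iM; have [a [b mE]] := mA i iM.
exists (a + mhat d (t n) 0), b => x /mE E; rewrite addrAC -E; ring.
Qed.

Lemma mh_affine n : cell_affine l M (mh n). Proof. exact: cell_affine_Ih. Qed.

Lemma bm_rho n : bmeas 0 l (rho n).
Proof. exact: (bm_Qh_comp l_gt0 M_gt0 (fun x => x) (rhoQ n)). Qed.
Lemma bm_r n : bmeas 0 l (r n).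
Proof. exact: (bm_Qh_comp l_gt0 M_gt0 (fun x => x) (rQ n)). Qed.
Lemma bm_v n : bmeas 0 l (v n).
Proof. exact: (cell_affine_vel l_gt0 M_gt0 (rhoQ n) (m_affine n)). Qed.
Lemma bm_s n : bmeas 0 l (s n).
Proof. exact: (cell_affine_vel l_gt0 M_gt0 (rQ n) (mh_affine n)). Qed.

Lemma bm_hh n : bmeas 0 l (hh p rho m n).
Proof.
apply: bmD; first by apply/bmZ/bmX2/bm_v.
exact: (bm_Qh_comp l_gt0 M_gt0 _ (rhoQ n)).
Qed.

Lemma bm_hhat_h n : bmeas 0 l (hhat_h p d M tau n).
Proof.
apply: bmD; first by apply/bmZ/bmX2/bm_s.
exact: (bm_Qh_comp l_gt0 M_gt0 _ (rQ n)).
Qed.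

Lemma bm_hhat n : bmeas 0 l (hhat p d (t n)).
Proof. exact: mixed_lip_bm (rb_h rb) (tn_ge0 n). Qed.

Lemma bm_vhat n : bmeas 0 l (vhat d (t n)).
Proof. exact: mixed_lip_bm (rb_v rb) (tn_ge0 n). Qed.

Lemma bm_Ih f : bmeas 0 l (Ih l M f).
Proof. exact: (cell_affine_bm l_gt0 M_gt0 (cell_affine_Ih l_gt0 M_gt0 f)). Qed.

Definition err_rho n x := rho n x - r n x.
Definition err_v n x := v n x - s n x.
Definition err_m n x := m n x - mh n x.
Definition err_h n x := hh p rho m n x - hhat_h p d M tau n x.
(** The reference momentum balance contains [hhat] and not the projected enthalpy, so the balance of
    the errors sees [err_h - cons_h]. *)
Definition cons_h n x := hhat p d (t n) x - hhat_h p d M tau n x.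
Definition err_fric n x := `|v n x| * v n x - `|s n x| * s n x.
Definition err_mass n x := neg_mass (rho n) x - neg_mass (r n) x.

Lemma bm_err_rho n : bmeas 0 l (err_rho n).
Proof. exact: bmB (bm_rho n) (bm_r n). Qed.
Lemma bm_err_v n : bmeas 0 l (err_v n).
Proof. exact: bmB (bm_v n) (bm_s n). Qed.
Lemma bm_err_h n : bmeas 0 l (err_h n).
Proof. exact: bmB (bm_hh n) (bm_hhat_h n). Qed.
Lemma bm_cons_h n : bmeas 0 l (cons_h n).
Proof. exact: bmB (bm_hhat n) (bm_hhat_h n). Qed.
Lemma bm_err_fric n : bmeas 0 l (err_fric n).
Proof. by apply: bmB; apply: bmM; [exact/bm_norm/bm_v|exact: bm_v|exact/bm_norm/bm_s|exact: bm_s]. Qed.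

Lemma err_m_Rh n : Rh l M (err_m n).
Proof.
have [_ [m0 _]] := sch.1 n; have [I0 _] := Ih_Rh l_gt0 M_gt0 (mhat d (t n)); split.
  by rewrite /err_m (_ : _ - _ = (m n 0 - mhat d (t n) 0) -
    (mh n 0 - mhat d (t n) 0)); [rewrite m0 I0 subrr|ring].
move=> i iM; have [a [b mE]] := m_affine n iM; have [a' [b' mhE]] := mh_affine n iM.
exists (a - a'), (b - b') => x xI; rewrite /err_m mE// mhE//; ring.
Qed.

Lemma bm_err_m n : bmeas 0 l (err_m n) /\ bmeas 0 l (derive1 (err_m n)).
Proof. exact: (bm_Rh l_gt0 M_gt0 (err_m_Rh n)). Qed.

Lemma err_mass_intg n x : 0 <= x <= l -> err_mass n x = - intg 0 x (err_rho n).
Proof.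
move=> xl; rewrite /err_mass /neg_mass /err_rho intgB.
- by rewrite opprB opprK addrC.
- by apply: bm_sub (bm_rho n); lra.
- by apply: bm_sub (bm_r n); lra.
Qed.

Lemma err_rho_cst n i : (i < M)%N -> exists c, forall x, int i x -> err_rho n x = c.
Proof.
move=> iM; have [c rc] := rhoQ n iM; have [c' rc'] := rQ n iM.
by exists (c - c') => x [_ xI]; rewrite /err_rho rc// rc'.
Qed.

(** The density error is constant on cells, so its antiderivative from 0 is affine on cells, agrees
    at the nodes and vanishes at 0. It is thus an admissible test function, whose derivative returns
    the density error. *)
Lemma err_mass_Rh n : Rh l M (err_mass n) /\
  forall i x, int i x -> derive1 (err_mass n) x = - err_rho n x.
Proof.
have aff i : (i < M)%N -> exists a c, (forall x, node l M i <= x <= node l M i.+1 ->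
    err_mass n x = a + c * x) /\ (forall x, int i x -> err_rho n x = - c).
  move=> iM; have [c ec] := err_rho_cst n iM.
  have i0 := node_ge0 l_gt0 M_gt0 i; have il := node_le_l l_gt0 M_gt0 iM.
  exists (err_mass n (node l M i) + c * node l M i), (- c); split; last first.
    by move=> x xI; rewrite opprK ec.
  move=> x xI; rewrite !err_mass_intg; [|lra|lra].
  have bx : bmeas 0 x (err_rho n) by apply: bm_sub (bm_err_rho n); lra.
  rewrite (intg_split i0 _ bx); last by lra.
  have -> : intg (node l M i) x (err_rho n) = c * (x - node l M i).
    rewrite -intg_cst; last by lra.
    apply: eq_intg_ae; [by apply: bm_sub bx => //; lra|exact: bm_cst|].
    apply: aeS (ae_neq2 (node l M i) x) => y [y1 y2]; rewrite /= in_itv/= => yI.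
    by apply: ec; split => //; lra.
  by move: (intg _ _ _) => I; ring.
split; first split.
- by rewrite err_mass_intg ?intg_xx ?oppr0// lexx ltW.
- by move=> i iM; have [a [c [E _]]] := aff i iM; exists a, c.
move=> i x [iM xI]; have [a [c [E e]]] := aff i iM.
by rewrite (derive1_affine xI E) (e x)// opprK.
Qed.

Lemma bm_err_mass n : bmeas 0 l (err_mass n).
Proof. by have [] := bm_Rh l_gt0 M_gt0 (proj1 (err_mass_Rh n)). Qed.

Lemma relative_energyE n :
  relative_energy p (uh rho m n) (uhat_h p d M tau n) =
  J (fun x => rel_density p (r n x) (s n x) (rho n x) (v n x)).
Proof.
rewrite /relative_energy /energy /inner /=.
have b1 : bmeas 0 l (fun x => 2^-1 * rho n x * v n x ^+ 2 + pot p (rho n x)).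
  apply: bmD; last exact: (bm_Qh_comp l_gt0 M_gt0 _ (rhoQ n)).
  by apply: bmM; [exact/bmZ/bm_rho|exact/bmX2/bm_v].
have b2 : bmeas 0 l (fun x => 2^-1 * r n x * s n x ^+ 2 + pot p (r n x)).
  apply: bmD; last exact: (bm_Qh_comp l_gt0 M_gt0 _ (rQ n)).
  by apply: bmM; [exact/bmZ/bm_r|exact/bmX2/bm_s].
have b3 : bmeas 0 l (fun x => enthalpy (pot p) (r n x) (s n x) * (rho n x - r n x)).
  by apply: bmM; [exact: bm_hhat_h|exact: bm_err_rho].
have b4 : bmeas 0 l (fun x => (r n x * s n x) * (v n x - s n x)).
  by apply: bmM; [exact: bmM (bm_r n) (bm_s n)|exact: bm_err_v].
rewrite -(intgB b1 b2) -(intgD b3 b4) -(intgB (bmB b1 b2) (bmD b3 b4)).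
apply: eq_intg => x _; rewrite /rel_density /enthalpy.
by move: (pot p _) (pot p _) (derive1 _ _) => P Q S; field.
Qed.

Lemma mod_energyE dl n :
  mod_energy p dl (uh rho m n) (uhat_h p d M tau n) =
  J (fun x => rel_density p (r n x) (s n x) (rho n x) (v n x)) +
  dl * J (fun x => err_mass n x * err_v n x).
Proof. by rewrite /mod_energy relative_energyE. Qed.

Lemma dist2E n : dist2 l (uh rho m n) (uhat_h p d M tau n) =
  J (fun x => err_rho n x * err_rho n x) + J (fun x => err_v n x * err_v n x).
Proof. by []. Qed.

Let tS k : t k.+1 - t k = tau.
Proof. by rewrite -natr1 mulrDl mul1r addrC addKr. Qed.

Definition res_mass k x : R :=
  (err_rho k.+1 x - err_rho k x) / tau + derive1 (err_m k.+1) x.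

Lemma bm_res_mass k : bmeas 0 l (res_mass k).
Proof.
apply: bmD; last by have [] := bm_err_m k.+1.
by apply: bmM; [apply: bmB; exact: bm_err_rho|exact: bm_cst].
Qed.

(** The residual of the discrete mass equation belongs to [Qh]; tested with itself, it has zero L2
    norm and so vanishes on every cell. *)
Lemma mass_pointwise k i x : int i x ->
  (rho k.+1 x - rho k x) / tau + derive1 (m k.+1) x = Pih l M (src1 d (t k.+1)) x.
Proof.
have [_ dm] : bmeas 0 l (m k.+1) /\ bmeas 0 l (derive1 (m k.+1)).
  split; first exact: (cell_affine_bm l_gt0 M_gt0 (m_affine k.+1)).
  apply: (bm_interior_affine l_gt0 M_gt0) => j jM; have [a [b mE]] := m_affine k.+1 jM.
  by exists b, 0 => y [_ yI]; rewrite (derive1_affine yI mE) mul0r addr0.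
pose q x := bdiff tau (rho^~ x) k.+1 + derive1 (m k.+1) x - Pih l M (src1 d (t k.+1)) x.
have qQ : Qh l M q.
  move=> j jM; have [c1 r1] := rhoQ k.+1 jM; have [c2 r2] := rhoQ k jM.
  have [c3 r3] := Pih_Qh l_gt0 M_gt0 (src1 d (t k.+1)) jM.
  have [a [b mE]] := m_affine k.+1 jM.
  exists ((c1 - c2) / tau + b - c3) => y yI.
  by rewrite /q /bdiff r1// r2// r3// (derive1_affine yI mE).
have bq : bmeas 0 l q by exact: (bm_Qh_comp l_gt0 M_gt0 (fun x => x) qQ).
have bP : bmeas 0 l (Pih l M (src1 d (t k.+1))).
  exact: (bm_Qh_comp l_gt0 M_gt0 (fun x => x) (Pih_Qh l_gt0 M_gt0 _)).
have bb : bmeas 0 l (fun x => bdiff tau (rho^~ x) k.+1).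
  by apply: bmM; [apply: bmB; exact: bm_rho|exact: bm_cst].
have [+ _] := sch.2 k.+1 isT => /(_ q qQ); rewrite /inner => me.
have q0 : J (fun x => q x * q x) = 0.
  rewrite [LHS](_ : _ = J (fun x => bdiff tau (rho^~ x) k.+1 * q x) +
      J (fun x => derive1 (m k.+1) x * q x) - J (fun x => Pih l M (src1 d (t k.+1)) x * q x)).
    by rewrite me subrr.
  rewrite -intgD; [|exact: bmM..]; rewrite -intgB; [|by apply: bmD; exact: bmM|exact: bmM].
  by apply: eq_intg => y _; rewrite /q; ring.
move=> xI; have := Qh_diff_eq0 l_gt0 M_gt0 qQ q0 xI.
by rewrite /q /bdiff => /eqP; rewrite subr_eq0 => /eqP.
Qed.

Lemma derive1_err_m n i x : int i x -> derive1 (err_m n) x =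
  derive1 (m n) x - (mhat d (t n) (node l M i.+1) - mhat d (t n) (node l M i)) / h.
Proof.
move=> [iM xI]; have [a [b mE]] := m_affine n iM.
rewrite (derive1_affine xI mE).
pose D := mhat d (t n) (node l M i.+1) - mhat d (t n) (node l M i).
rewrite -/D; apply: (derive1_affine (a := a - mhat d (t n) (node l M i) + node l M i / h * D) xI).
by move=> y yI; rewrite /err_m mE// (@Ih_affine _ l M l_gt0 M_gt0 _ i)// -/D; ring.
Qed.

(** No power of [h] occurs: the slope of the nodal interpolant is the cell average of the
    derivative, so projection commutes with the space derivative. Only the time residual in
    [rb_mass] remains, divided by [tau] and by the cell length. *)
Lemma res_mass_le k i x : int i x -> `|res_mass k x| <= K1 * tau.
Proof.
move=> xI; have [iM xI'] := xI.
have i0 := node_ge0 l_gt0 M_gt0 i; have il := node_le_l l_gt0 M_gt0 iM.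
have ii := ltW (node_lt l_gt0 M_gt0 i).
have kk : t k <= t k.+1 by rewrite -subr_ge0 tS ltW.
have := rb_mass rb (tn_ge0 k) kk i0 ii il; rewrite tS nodeB.
set I1 := intg _ _ (fun y => _ - _); set I2 := intg _ _ (src1 _ _).
set D := mhat _ _ _ - mhat _ _ _ => H.
have bc u : 0 <= u -> bmeas (node l M i) (node l M i.+1) (rhat d u).
  by move=> u0; apply: bm_sub (mixed_lip_bm (rb_rho rb) u0).
have rE : r k.+1 x - r k x = h^-1 * I1.
  by rewrite !(PihE l_gt0 M_gt0 _ xI) -mulrBr /I1 intgB//; exact: bc.
have -> : res_mass k x = - (h^-1 * tau^-1 * (I1 - tau * (I2 - D))).
  have mp := mass_pointwise k xI; rewrite (PihE l_gt0 M_gt0 _ xI) -/I2 in mp.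
  rewrite /res_mass (derive1_err_m _ xI) -/D /err_rho.
  have -> : rho k.+1 x - r k.+1 x - (rho k x - r k x) =
    (rho k.+1 x - rho k x) - (r k.+1 x - r k x) by ring.
  rewrite rE.
  transitivity (h^-1 * I2 - h^-1 * I1 / tau - D / h).
    rewrite -mp; ring.
  by field; rewrite !gt_eqF.
rewrite normrN normrM [X in X * _]ger0_norm; last by rewrite mulr_ge0// invr_ge0 ltW.
apply: le_trans (ler_wpM2l _ H) _; first by rewrite mulr_ge0// invr_ge0 ltW.
rewrite le_eqVlt; apply/orP; left; apply/eqP; field.
by rewrite !gt_eqF.
Qed.

Lemma err_mass_step k x : 0 <= x <= l ->
  err_mass k.+1 x - err_mass k x =
    tau * (err_m k.+1 x - intg 0 x (res_mass k)).
Proof.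
move=> xl; rewrite !err_mass_intg// -(Rh_primitive l_gt0 M_gt0 (err_m_Rh k.+1) xl).
have /andP[_ xl2] := xl.
have sub f : bmeas 0 l f -> bmeas 0 x f by apply: bm_sub.
have b1 := sub _ (bm_err_rho k.+1); have b2 := sub _ (bm_err_rho k).
have b3 := sub _ (proj2 (bm_err_m k.+1)); have b4 := sub _ (bm_res_mass k).
rewrite -intgB// -intgZ; last exact: bmB.
rewrite opprK addrC -intgB//; apply: eq_intg => y _; rewrite /res_mass.
by field; rewrite gt_eqF.
Qed.

Lemma m_vel n i x : int i x -> err_m n x = rho n x * v n x - r n x * s n x.
Proof.
move=> xI; have /andP[h1 _] := rho_itv n xI; have /andP[h2 _] := r_itv n xI.
have rho0 := lt_le_trans lo_gt0 h1; have r0 := lt_le_trans lo_gt0 h2.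
by rewrite /err_m /vh /vel; field; rewrite !gt_eqF.
Qed.

(** [K1 * tau] is the time residual. [K2 * h] comes from time increments of [vhat] against those of
    the projected velocity, and the friction term from replacing [vhat] by that velocity. In the
    observer term, projection and interpolation each contribute [K2 * h], and [eta] bounds the
    interpolated noise. *)
Definition momentum_defect (eta : R) : R :=
  K1 * tau + K2 * h + gam p * (2 * V * (K2 * h)) + muo p * (2 * K2 * h + eta).

(** Subtracting [rb_mom] from the scheme cancels sources and boundary terms. The function [X]
    collects what is left when [vhat] is replaced by the projected velocity; it is small pointwise,
    so its pairing is bounded by the L1 norm of [w]. *)
Lemma momentum_step eta k w : Rh l M w ->
  (forall i x, int i x -> `|Ih l M (noise d (t k.+1)) x| <= eta) ->
  `|J (fun x => (err_v k.+1 x - err_v k x) * w x)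
    - tau * (J (fun x => err_h k.+1 x * derive1 w x) - J (fun x => cons_h k.+1 x * derive1 w x)
        - gam p * J (fun x => err_fric k.+1 x * w x) - muo p * J (fun x => err_v k.+1 x * w x))|
  <= tau * momentum_defect eta * J (fun x => `|w x|).
Proof.
move=> wR noiseB; have [bw bdw] := bm_Rh l_gt0 M_gt0 wR.
have kk : t k <= t k.+1 by rewrite -subr_ge0 tS ltW.
have [_ /(_ w wR)] := sch.2 k.+1 isT; rewrite /inner /= => mom.
have := rb_mom rb M_gt0 wR (tn_ge0 k) kk; rewrite tS.
have bv := bm_v k.+1; have bvk := bm_v k; have bs := bm_s k.+1; have bsk := bm_s k.
have bvh := bm_vhat k.+1; have bvhk := bm_vhat k; have bs2 := rb_s2 rb (tn_ge0 k.+1).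
have bhh := bm_hh k.+1; have bhw := bm_hhat_h k.+1; have bht := bm_hhat k.+1.
have bI := bm_Ih (vhat d (t k.+1)); have bE := bm_Ih (noise d (t k.+1)).
pose X x := (vhat d (t k.+1) x - vhat d (t k) x) - (s k.+1 x - s k x)
  + tau * gam p * (`|vhat d (t k.+1) x| * vhat d (t k.+1) x - `|s k.+1 x| * s k.+1 x)
  - tau * muo p * (s k.+1 x - (Ih l M (vhat d (t k.+1)) x + Ih l M (noise d (t k.+1)) x)).
have bX : bmeas 0 l X by rewrite /X; bmeas_tac.
have XB i x : int i x -> `|X x| <= tau * (K2 * h + gam p * (2 * V * (K2 * h))
    + muo p * (2 * K2 * h + eta)).
  move=> xI; have xl := interior_mem l_gt0 M_gt0 xI.
  have [_ _ [c1 _] c2] := pj_mv pj M_gt0 xI (tn_ge0 k) (tn_ge0 k.+1).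
  rewrite tS (gtr0_norm tau_gt0) in c2.
  have c3 := pj_Iv pj M_gt0 xI (tn_ge0 k.+1); have c4 := noiseB i x xI.
  have vV : `|vhat d (t k.+1) x| <= V.
    apply: le_trans (vhatB (tn_ge0 k.+1) xl) _; rewrite ler_peMl ?(vbar_ge0 k xI)//.
    by rewrite ler_pdivlMr// mul1r ltW.
  have c5 := absM_lip vV (s_bound k.+1 xI).
  have V0 : 0 <= V by rewrite (le_trans _ vV).
  rewrite /X; apply: le_trans (ler_normB _ _) _.
  rewrite [leRHS](_ : _ = (tau * (K2 * h) + tau * gam p * (2 * V * (K2 * h))) +
    tau * muo p * (2 * K2 * h + eta)); last by ring.
  apply: lerD.
    apply: le_trans (ler_normD _ _) _; apply: lerD.
      by apply: le_trans c2 _; rewrite (mulrC K2) mulrA.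
    rewrite normrM [X in X * _]ger0_norm; last by rewrite mulr_ge0// ltW.
    apply: ler_wpM2l.
      by rewrite mulr_ge0// ltW.
    by apply: le_trans c5 _; rewrite ler_wpM2l// mulr_ge0.
  rewrite normrM [X in X * _]ger0_norm; last by rewrite mulr_ge0// ltW.
  apply: ler_wpM2l.
    by rewrite mulr_ge0// ltW.
  rewrite (_ : _ - _ = - (vhat d (t k.+1) x - s k.+1 x) +
    (vhat d (t k.+1) x - Ih l M (vhat d (t k.+1)) x) - Ih l M (noise d (t k.+1)) x); last by ring.
  apply: le_trans (ler_normB _ _) _; rewrite lerD//.
  apply: le_trans (ler_normD _ _) _; rewrite normrN.
  by rewrite (_ : 2 * K2 * h = K2 * h + K2 * h); [rewrite lerD|ring].
have JX := intg_mul_le l_gt0 M_gt0 bX bw XB.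
have E0 : J (fun x => bdiff tau ((vh rho m)^~ x) k.+1 * w x) =
    tau^-1 * J (fun x => (v k.+1 x - v k x) * w x).
  rewrite -intgZ; last by bmeas_tac.
  by apply: eq_intg => x _; rewrite /bdiff /=; ring.
have E1 : J (fun x => (err_v k.+1 x - err_v k x) * w x) =
    J (fun x => (v k.+1 x - v k x) * w x) - J (fun x => (s k.+1 x - s k x) * w x).
  rewrite -intgB; [|bmeas_tac..].
  by apply: eq_intg => x _; rewrite /err_v; ring.
have E2 : J (fun x => err_h k.+1 x * derive1 w x) - J (fun x => cons_h k.+1 x * derive1 w x) =
    J (fun x => hh p rho m k.+1 x * derive1 w x) - J (fun x => hhat p d (t k.+1) x * derive1 w x).
  rewrite -intgB; [|by apply: bmM bdw; exact: bm_err_h|by apply: bmM bdw; exact: bm_cons_h].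
  rewrite -intgB; [|bmeas_tac..].
  by apply: eq_intg => x _; rewrite /err_h /cons_h; ring.
have E3 : J (fun x => err_fric k.+1 x * w x) =
    J (fun x => `|v k.+1 x| * v k.+1 x * w x) - J (fun x => `|s k.+1 x| * s k.+1 x * w x).
  rewrite -intgB; [|bmeas_tac..].
  by apply: eq_intg => x _; rewrite /err_fric; ring.
have E4 : J (fun x => err_v k.+1 x * w x) =
    J (fun x => v k.+1 x * w x) - J (fun x => s k.+1 x * w x).
  rewrite -intgB; [|bmeas_tac..].
  by apply: eq_intg => x _; rewrite /err_v; ring.
have E5 : J (fun x => (v k.+1 x - (Ih l M (vhat d (t k.+1)) x + Ih l M (noise d (t k.+1)) x)) * w x) =
    J (fun x => v k.+1 x * w x) -
    J (fun x => (Ih l M (vhat d (t k.+1)) x + Ih l M (noise d (t k.+1)) x) * w x).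
  rewrite -intgB; [|bmeas_tac..].
  by apply: eq_intg => x _; ring.
have E6 : J (fun x => (src2 d (t k.+1) x -
      gam p * (`|vhat d (t k.+1) x| * vhat d (t k.+1) x)) * w x) =
    J (fun x => src2 d (t k.+1) x * w x) -
    gam p * J (fun x => `|vhat d (t k.+1) x| * vhat d (t k.+1) x * w x).
  rewrite -intgZ; last by bmeas_tac.
  rewrite -intgB; [|bmeas_tac..].
  by apply: eq_intg => x _; ring.
have E7 : J (fun x => X x * w x) =
    J (fun x => (vhat d (t k.+1) x - vhat d (t k) x) * w x)
    - J (fun x => (s k.+1 x - s k x) * w x)
    + (tau * gam p) * (J (fun x => `|vhat d (t k.+1) x| * vhat d (t k.+1) x * w x)
        - J (fun x => `|s k.+1 x| * s k.+1 x * w x))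
    - (tau * muo p) * (J (fun x => s k.+1 x * w x) -
        J (fun x => (Ih l M (vhat d (t k.+1)) x + Ih l M (noise d (t k.+1)) x) * w x)).
  do 3 (rewrite -intgB; [|bmeas_tac..]).
  do 2 (rewrite -intgZ; last by bmeas_tac).
  rewrite -intgD; [|bmeas_tac..]; rewrite -intgB; [|bmeas_tac..].
  by apply: eq_intg => x _; rewrite /X; ring.
rewrite E0 E5 in mom; rewrite E6 E1 E2 E3 E4; rewrite E7 in JX.
move: mom JX.
set j1 := J (fun x => (v k.+1 x - v k x) * w x).
set j2 := J (fun x => (s k.+1 x - s k x) * w x).
set j3 := J (fun x => hh p rho m k.+1 x * derive1 w x).
set j4 := J (fun x => hhat p d (t k.+1) x * derive1 w x).
set j5 := J (fun x => `|v k.+1 x| * v k.+1 x * w x).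
set j6 := J (fun x => `|s k.+1 x| * s k.+1 x * w x).
set j7 := J (fun x => v k.+1 x * w x).
set j8 := J (fun x => s k.+1 x * w x).
set j9 := J (fun x => (Ih l M (vhat d (t k.+1)) x + Ih l M (noise d (t k.+1)) x) * w x).
set j10 := J (fun x => src2 d (t k.+1) x * w x).
set j11 := J (fun x => `|vhat d (t k.+1) x| * vhat d (t k.+1) x * w x).
set j12 := J (fun x => (vhat d (t k.+1) x - vhat d (t k) x) * w x).
set W := J (fun x => `|w x|).
set hl := hhat p d (t k.+1) l * w l.
move=> mom JX err1.
have j1E : j1 = tau * (j10 + j3 - hl - gam p * j5 - muo p * (j7 - j9)).
  by rewrite -mom; field; rewrite gt_eqF.
rewrite j1E.
set Y := _ - _ in JX; set Q := _ - _ in err1.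
rewrite (_ : _ - _ = Y - Q); last by rewrite /Y /Q; ring.
apply: le_trans (ler_normB _ _) _; apply: le_trans (lerD JX err1) _.
by rewrite /momentum_defect le_eqVlt; apply/orP; left; apply/eqP; ring.
Qed.

(** The constant of [dissipation_pointwise] for [K = K1 + K2], which dominates the mass residual
    [K1 * tau] and the enthalpy consistency error [K2 * h], and for [KA = K1 * l], from integrating
    the residual over at most the length [l]. *)
Definition absorption_constant (dl : R) : R :=
  (4 * (dl * convexity p / 24))^-1 * ((B * (K1 + K2)) ^+ 2 + V ^+ 2 + (dl * (K1 + K2)) ^+ 2)
  + (4 * (muo p * rho_lo p / 24))^-1 *
      ((V * (K1 + K2)) ^+ 2 + rho_hi p ^+ 2 + (dl * (K1 * l)) ^+ 2)
  + 2 * dl * l ^+ 2 / convexity p + (K1 + K2) ^+ 2.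

Lemma bm_rel_density n :
  bmeas 0 l (fun x => rel_density p (r n x) (s n x) (rho n x) (v n x)).
Proof.
have e1 := bm_err_rho n; have e2 := bm_err_v n; have e3 := bm_rho n; have e4 := bm_s n.
have P f q : Qh l M q -> bmeas 0 l (fun x => f (q x)) by exact: bm_Qh_comp.
exact: bmD (bmD (bmM (bmZ _ e3) (bmX2 e2)) (bmM (bmM e4 e1) e2))
  (bmB (bmB (P _ _ (rhoQ n)) (P _ _ (rQ n))) (bmM (P _ _ (rQ n)) e1)).
Qed.

(** The weight [8^-1] is that of the pointwise estimate: the integral absorbed there is half of
    [dissipation]. *)
Lemma dissipationE n : dissipation p (uh rho m n) (uhat_h p d M tau n) =
  2 * J (fun x => 8^-1 * gam p * (r n x * err_v n x * (err_v n x * (`|v n x| + `|s n x|)))).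
Proof.
have br := bm_r n; have bf := bm_err_v n; have bv := bm_v n; have bs := bm_s n.
rewrite intgZ; last by bmeas_tac.
by rewrite /dissipation /inner mulrA; congr (_ * _); field.
Qed.

Lemma dissipation_ge0 n : 0 <= dissipation p (uh rho m n) (uhat_h p d M tau n).
Proof.
rewrite dissipationE mulr_ge0//.
have br := bm_r n; have bf := bm_err_v n; have bv := bm_v n; have bs := bm_s n.
apply: intg_ge0; first by bmeas_tac.
apply: (ae_interior l_gt0 M_gt0) => i x xI; have /andP[rx _] := r_itv n xI => /=.
have g8 : 0 <= 8^-1 * gam p by rewrite mulr_ge0// ltW.
have rf : 0 <= r n x * err_v n x ^+ 2.
  by rewrite mulr_ge0 ?sqr_ge0// (le_trans (ltW lo_gt0)).
rewrite (_ : r n x * _ * _ = r n x * err_v n x ^+ 2 * (`|v n x| + `|s n x|)); last by ring.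
by rewrite mulr_ge0// mulr_ge0// addr_ge0.
Qed.

(** Two costs multiply the old squared distance: [th], a free Young weight for the drift of the
    consistency term, and a multiple of [Ct], from the motion of the reference state in the chain
    rule. Both are made small against the damping when the constants are chosen. *)
Lemma one_step dl eta th k : 0 < K2 -> 0 < dl -> 0 < th -> 0 <= eta ->
  dl * l <= coercivity p / 4 -> V <= coercivity p / 4 -> Ct * tau <= kap -> 0 <= Ct ->
  V * (2 * gam p * V + muo p + 2 * dl) <= dl * convexity p / 8 ->
  V * (2 * gam p * V + muo p + 2 * dl) <= muo p * rho_lo p / 8 ->
  2 * gam p * V <= muo p -> gam p * rho_hi p * V <= muo p * rho_lo p / 4 ->
  dl * (8 * muo p ^+ 2 * l ^+ 2 / convexity p + rho_hi p) <= muo p * rho_lo p / 8 ->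
  (forall i x, int i x -> `|Ih l M (noise d (t k.+1)) x| <= eta) ->
  mod_energy p dl (uh rho m k.+1) (uhat_h p d M tau k.+1)
  - mod_energy p dl (uh rho m k) (uhat_h p d M tau k)
  - (J (fun x => cons_h k.+1 x * err_rho k.+1 x) - J (fun x => cons_h k x * err_rho k x))
  <= tau * (- (dl * convexity p / 2) * J (fun x => err_rho k.+1 x * err_rho k.+1 x)
       - muo p * rho_lo p / 2 * J (fun x => err_v k.+1 x * err_v k.+1 x)
       - 2^-1 * dissipation p (uh rho m k.+1) (uhat_h p d M tau k.+1)
       + (absorption_constant dl * (tau ^+ 2 + h ^+ 2 + momentum_defect eta ^+ 2)
            + (4 * th)^-1 * (K2 * h) ^+ 2) * l)
     + (tau * th + ((1 + B) * (Ct * tau) + vref_lip p * Ct * tau) / 2)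
       * dist2 l (uh rho m k) (uhat_h p d M tau k).
Proof.
move=> K20 dl0 th0 eta0 dll Vc Ctk Ct0 X1 X2 Vmu VD dlC noiseB.
have cv0 : 0 < convexity p by rewrite divr_gt0.
have co0 : 0 < coercivity p by rewrite lt_min lo_gt0.
have K10 := rb_K rb; have B0 := pb_B pb.
have hi0 : 0 < rho_hi p by exact: lt_trans lohi.
have t0 := ltW tau_gt0; have h0 := ltW h_gt0.
(* The midpoint of the first cell, a point at which the velocity bound shows [V] to be
   nonnegative. *)
have x0I : int 0%N (h / 2).
  by split=> //; rewrite node0 (nodeS l M 0) node0; move: h_gt0; lra.
have V0 : 0 <= V by apply: le_trans (v_bound k x0I).
have om0 : 0 <= momentum_defect eta.
  have Kh0 : 0 <= K2 * h by rewrite mulr_ge0// ltW.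
  have m2 := ltW mu_gt0; have g2 := ltW gam_gt0; have k2 := ltW K10.
  rewrite /momentum_defect (addr_ge0 (addr_ge0 (addr_ge0 (mulr_ge0 _ _) Kh0) _) _)//.
    by rewrite mulr_ge0// mulr_ge0// mulr_ge0.
  by rewrite mulr_ge0// addr_ge0// -mulrA mulr_ge0.
have bE := bm_err_rho k.+1; have bEo := bm_err_rho k.
have bF := bm_err_v k.+1; have bFo := bm_err_v k.
have [bG bdG] := bm_err_m k.+1; have bq := bm_err_fric k.+1.
have bp1 := bm_err_h k.+1; have bb := bm_cons_h k.+1; have bbo := bm_cons_h k.
have ba := bm_res_mass k; have bN := bm_err_mass k.+1; have bNo := bm_err_mass k.
have br := bm_r k.+1; have bv := bm_v k.+1; have bs := bm_s k.+1.
have bA := bm_prim ba.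
pose psi n x := rel_density p (r n x) (s n x) (rho n x) (v n x).
have bpsi n : bmeas 0 l (psi n) := bm_rel_density n.
rewrite dist2E !mod_energyE dissipationE mulKf ?pnatr_eq0//.
have defect w (wR : Rh l M w) := momentum_step wR noiseB.
have [NR dN] := err_mass_Rh k.+1.
pose Kt := K1 + K2; pose C5 := ((1 + B) * (Ct * tau) + vref_lip p * Ct * tau) / 2.
pose c1 := coercivity p / 8.
pose Dd x := 8^-1 * gam p * (r k.+1 x * err_v k.+1 x * (err_v k.+1 x * (`|v k.+1 x| + `|s k.+1 x|))).
have bDd : bmeas 0 l Dd by rewrite /Dd; bmeas_tac.
have H1 : {ae lmu, forall x, `[0, l]%classic x -> psi k.+1 x - psi k x <=
    err_h k.+1 x * (err_rho k.+1 x - err_rho k x) + err_m k.+1 x * (err_v k.+1 x - err_v k x)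
    - c1 * ((err_rho k.+1 x - err_rho k x) ^+ 2 + (err_v k.+1 x - err_v k x) ^+ 2)
    + C5 * (err_rho k x ^+ 2 + err_v k x ^+ 2)}.
  apply: (ae_interior l_gt0 M_gt0) => i x xI; rewrite (m_vel _ xI).
  have rC := pj_rhoC pj M_gt0 xI (tn_ge0 k) (tn_ge0 k.+1).
  have vC := pj_vC pj M_gt0 xI (tn_ge0 k) (tn_ge0 k.+1).
  rewrite tS (gtr0_norm tau_gt0) in rC vC.
  exact: (rel_density_step _ pb lo_gt0 cP_gt0 (rho_itv k.+1 xI) (rho_itv k xI)
    (r_itv k.+1 xI) (r_itv k xI) (v_bound k.+1 xI) Vc rC Ctk vC).
have H2 : {ae lmu, forall x, `[0, l]%classic x ->
    err_rho k.+1 x - err_rho k x = tau * (res_mass k x - derive1 (err_m k.+1) x)}.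
  by apply: aeW => x _; rewrite /res_mass; field; rewrite gt_eqF.
have H3 : J (fun x => (err_v k.+1 x - err_v k x) * err_m k.+1 x) <=
    tau * (J (fun x => err_h k.+1 x * derive1 (err_m k.+1) x)
      - J (fun x => cons_h k.+1 x * derive1 (err_m k.+1) x)
      - gam p * J (fun x => err_fric k.+1 x * err_m k.+1 x)
      - muo p * J (fun x => err_v k.+1 x * err_m k.+1 x)
      + momentum_defect eta * J (fun x => `|err_m k.+1 x|)).
  have := defect _ (err_m_Rh k.+1) => /(le_trans (ler_norm _)).
  by rewrite lerBlDl => /le_trans; apply; rewrite -mulrA -mulrDr.
have swap g : bmeas 0 l g -> J (fun x => g x * derive1 (err_mass k.+1) x) =
    - J (fun x => g x * err_rho k.+1 x).
  move=> bg; rewrite -intgN; last exact: bmM.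
  apply: eq_intg_ae; [by apply: bmM => //; have [] := bm_Rh l_gt0 M_gt0 NR|exact/bmN/bmM|].
  by apply: (ae_interior l_gt0 M_gt0) => i x /dN ->; rewrite mulrN.
have H4 : J (fun x => (err_v k.+1 x - err_v k x) * err_mass k.+1 x) <=
    tau * (- J (fun x => err_h k.+1 x * err_rho k.+1 x) + J (fun x => cons_h k.+1 x * err_rho k.+1 x)
      - gam p * J (fun x => err_fric k.+1 x * err_mass k.+1 x)
      - muo p * J (fun x => err_v k.+1 x * err_mass k.+1 x)
      + momentum_defect eta * J (fun x => `|err_mass k.+1 x|)).
  have := defect _ NR => /(le_trans (ler_norm _)).
  rewrite !swap// opprK.
  by rewrite lerBlDl => /le_trans; apply; rewrite -mulrA -mulrDr.
have H5 x (xl : 0 <= x <= l) := err_mass_step k xl.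
have HZ : {ae lmu, forall x, `[0, l]%classic x ->
  err_h k.+1 x * res_mass k x - cons_h k.+1 x * res_mass k x
    - gam p * (err_fric k.+1 x * err_m k.+1 x) - muo p * (err_v k.+1 x * err_m k.+1 x)
    + momentum_defect eta * `|err_m k.+1 x|
    + dl * (- (err_h k.+1 x * err_rho k.+1 x) + cons_h k.+1 x * err_rho k.+1 x
        - gam p * (err_fric k.+1 x * err_mass k.+1 x) - muo p * (err_v k.+1 x * err_mass k.+1 x)
        + momentum_defect eta * `|err_mass k.+1 x|
        + (err_m k.+1 x - intg 0 x (res_mass k)) * err_v k.+1 x) + Dd x
  <= - (3 / 4 * (dl * convexity p)) * err_rho k.+1 x ^+ 2
     - muo p * rho_lo p / 2 * err_v k.+1 x ^+ 2
     + dl * convexity p / (4 * l ^+ 2) * err_mass k.+1 x ^+ 2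
     + absorption_constant dl * (tau ^+ 2 + h ^+ 2 + momentum_defect eta ^+ 2)}.
  apply: (ae_interior l_gt0 M_gt0) => i x xI.
  have xl := interior_mem l_gt0 M_gt0 xI; have /andP[xl1 xl2] := xl.
  have Kt0 : 0 < Kt by rewrite addr_gt0.
  have [_ _ [hb _] _] := pj_mh pj M_gt0 xI (tn_ge0 k) (tn_ge0 k.+1).
  have aB : `|res_mass k x| <= Kt * tau.
    by apply: le_trans (res_mass_le k xI) _; rewrite ler_wpM2r// lerDl ltW.
  have bB : `|cons_h k.+1 x| <= Kt * h.
    by apply: le_trans hb _; rewrite ler_wpM2r// lerDr ltW.
  have AB : `|intg 0 x (res_mass k)| <= K1 * l * tau.
    apply: (@le_trans _ _ (K1 * tau * (x - 0))); last first.
      by rewrite subr0 mulrAC ler_wpM2r// ler_wpM2l// ltW.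
    apply: intg_bound => //; first by apply: bm_sub ba.
    apply: aeS (ae_interior l_gt0 M_gt0 (res_mass_le k)) => y yb; rewrite /= in_itv/= => yx.
    by case/andP: yx => y0 yx; apply: yb; rewrite /= in_itv/= y0 (le_trans yx).
  have D := dissipation_pointwise (err_mass k.+1 x) pb lo_gt0 cP_gt0 gam_gt0 mu_gt0 dl0 l_gt0
    Kt0 t0 h0 om0 (rho_itv k.+1 xI) (r_itv k.+1 xI) (v_bound k.+1 xI) (s_bound k.+1 xI)
    aB bB AB X1 X2 Vmu VD dlC.
  exact: (D _ _ _ _ _ erefl erefl (m_vel k.+1 xI) erefl erefl).
have Hb : {ae lmu, forall x, `[0, l]%classic x ->
    - ((cons_h k.+1 x - cons_h k x) * err_rho k x) <=
      tau * (th * err_rho k x ^+ 2 + (4 * th)^-1 * (K2 * h) ^+ 2)}.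
  apply: (ae_interior l_gt0 M_gt0) => i x xI.
  have [_ _ _] := pj_mh pj M_gt0 xI (tn_ge0 k) (tn_ge0 k.+1).
  rewrite tS (gtr0_norm tau_gt0) => hb.
  have {hb} hb : `|cons_h k.+1 x - cons_h k x| <= tau * (K2 * h).
    rewrite (_ : tau * _ = K2 * tau * h); last by ring.
    apply: le_trans hb; rewrite /cons_h le_eqVlt; apply/orP; left.
    by apply/eqP; congr `|_|; rewrite /hhat_h /=; ring.
  apply: (@le_trans _ _ (tau * (`|err_rho k x| * (K2 * h)))).
    apply: le_trans (ler_norm _) _; rewrite normrN normrM.
    rewrite [leRHS](_ : _ = tau * (K2 * h) * `|err_rho k x|); last by ring.
    exact: ler_wpM2r.
  apply: ler_wpM2l => //; apply: le_trans (young _ _ th0) _.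
  by rewrite real_normK// num_real.
have vl0 : 0 <= vref_lip p.
  have lo2 := exprn_gt0 2 lo_gt0; rewrite /vref_lip addr_ge0// divr_ge0// ?ltW//.
  by rewrite ltr_wpDr.
have C50 : 0 <= C5.
  exact: divr_ge0 (addr_ge0 (mulr_ge0 (addr_ge0 ler01 (ltW B0)) (mulr_ge0 Ct0 t0))
    (mulr_ge0 (mulr_ge0 vl0 Ct0) t0)) (ler0n _ 2).
have c1l : dl * l <= 2 * c1 by rewrite (_ : 2 * c1 = coercivity p / 4)// /c1; field.
have kN0 : 0 <= dl * convexity p / (4 * l ^+ 2).
  by rewrite divr_ge0// mulr_ge0// ?exprn_ge0// ltW.
have S := energy_increment_bound l_gt0 (bpsi k.+1) (bpsi k) bp1 bb bbo ba bG bdG bq bF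
  bFo bE bEo bN bNo bA bDd t0 dl0 H1 H2 H3 H4 H5 c1l kN0 HZ Hb
  (@err_mass_intg k.+1) (@err_mass_intg k) C50 (ltW th0).
apply: le_trans S _.
rewrite lerD2r le_eqVlt; apply/orP; left; apply/eqP; congr (_ * _).
rewrite (_ : 3 / 4 * (dl * convexity p) - _ = dl * convexity p / 2).
  by rewrite mulNr.
by field; rewrite gt_eqF.
Qed.

(** By [mass_velocity_le] the [dl] term is at most [dl * l / 2], hence [coercivity / 8], times the
    squared distance; subtracted from [3 / 8] this leaves more than the stated lower constant. *)
Lemma mod_energy_bounds dl n : 0 < dl ->
  dl * l <= coercivity p / 4 -> V <= coercivity p / 4 ->
  coercivity p / 8 * dist2 l (uh rho m n) (uhat_h p d M tau n)
  <= mod_energy p dl (uh rho m n) (uhat_h p d M tau n)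
  <= (rho_hi p + B + cP p) * dist2 l (uh rho m n) (uhat_h p d M tau n).
Proof.
move=> dl0 dll Vc; rewrite mod_energyE dist2E.
have be := bm_err_rho n; have bf := bm_err_v n.
have bpsi := bm_rel_density n.
have co0 : 0 < coercivity p by rewrite lt_min lo_gt0 divr_gt0.
have coc : coercivity p <= cP p / 2 by rewrite ge_min lexx orbT.
have B0 := pb_B pb.
have pw i x : int i x -> _ := fun xI => rel_density_bounds (v n x) pb lo_gt0 cP_gt0
  (rho_itv n xI) (r_itv n xI) (s_bound n xI) Vc.
have b2 : bmeas 0 l (fun x => err_rho n x ^+ 2 + err_v n x ^+ 2) by bmeas_tac.
have sq : J (fun x => err_rho n x ^+ 2 + err_v n x ^+ 2) =
    J (fun x => err_rho n x * err_rho n x) + J (fun x => err_v n x * err_v n x).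
  by rewrite -intgD; [|exact: bmM..]; apply: eq_intg => x _; rewrite !expr2.
have lo1 : 3 / 8 * coercivity p * J (fun x => err_rho n x ^+ 2 + err_v n x ^+ 2) <=
    J (fun x => rel_density p (r n x) (s n x) (rho n x) (v n x)).
  rewrite -intgZ//; apply: le_intg_ae => //; first exact: bmZ.
  by apply: (ae_interior l_gt0 M_gt0) => i x /pw /andP[].
have hi1 : J (fun x => rel_density p (r n x) (s n x) (rho n x) (v n x)) <=
    ((rho_hi p + B) / 2 + coercivity p / 8) * J (fun x => err_rho n x ^+ 2 + err_v n x ^+ 2).
  rewrite -intgZ//; apply: le_intg_ae => //; first exact: bmZ.
  by apply: (ae_interior l_gt0 M_gt0) => i x /pw /andP[].
have E0 : 0 <= J (fun x => err_rho n x ^+ 2 + err_v n x ^+ 2).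
  by apply: intg_ge0 => //; apply: aeW => x _; rewrite addr_ge0 ?sqr_ge0.
have := mass_velocity_le l_gt0 be bf (bm_err_mass n) (@err_mass_intg n).
rewrite -sq; move: lo1 hi1 E0.
move: (J (fun x => rel_density _ _ _ _ _)) (J (fun x => _ ^+ 2 + _)) (J (fun x => err_mass _ _ * _)).
move=> X E G lo1 hi1 E0 GE.
have {GE} : `|dl * G| <= coercivity p / 8 * E.
  rewrite normrM (gtr0_norm dl0) (le_trans (ler_wpM2l (ltW dl0) GE))// mulrA ler_wpM2r//.
  by move: dll; move: (coercivity p) => c; lra.
rewrite ler_norml => /andP[g1 g2].
have y1 : coercivity p * E <= cP p / 2 * E by rewrite ler_wpM2r.
have y2 : 0 <= coercivity p * E by rewrite mulr_ge0// ltW.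
have y3 : 0 <= rho_hi p * E by rewrite mulr_ge0// ltW// (lt_trans lo_gt0).
have y4 : 0 <= B * E by rewrite mulr_ge0// ltW.
move: g1 g2 y1 y2 y3 y4 lo1 hi1; move: (coercivity p) (dl * G) => c D.
by rewrite !mulrDl => g1 g2 y1 y2 y3 y4 lo1 hi1; apply/andP; split; lra.
Qed.

Lemma consistency_le th n : 0 < K2 -> 0 < th ->
  `|J (fun x => cons_h n x * err_rho n x)| <=
  th * dist2 l (uh rho m n) (uhat_h p d M tau n) + (4 * th)^-1 * (K2 * h) ^+ 2 * l.
Proof.
move=> K20 th0; rewrite dist2E.
have be := bm_err_rho n; have bf := bm_err_v n; have bc := bm_cons_h n.
apply: le_trans (ler_norm_intg (bmM bc be)) _.
apply: (@le_trans _ _ (J (fun x => th * (err_rho n x * err_rho n x) + (4 * th)^-1 * (K2 * h) ^+ 2))).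
  apply: le_intg_ae; [by bmeas_tac|by bmeas_tac|].
  apply: (ae_interior l_gt0 M_gt0) => i x xI; rewrite normrM.
  have [_ _ [hb _] _] := pj_mh pj M_gt0 xI (tn_ge0 n) (tn_ge0 n).
  apply: (@le_trans _ _ (`|err_rho n x| * (K2 * h))); first by rewrite mulrC ler_wpM2l.
  by apply: le_trans (young _ _ th0) _; rewrite real_normK ?num_real// expr2.
rewrite intgD; [|by bmeas_tac..]; rewrite intgZ; last by bmeas_tac.
rewrite intg_cst ?(ltW l_gt0)// subr0 lerD2r ler_wpM2l ?(ltW th0)// lerDl.
by apply: intg_ge0; [exact: bmM|apply: aeW => x _; rewrite -expr2 sqr_ge0].
Qed.

(** The weight [4 / 3], paid for by the factor 4 on the projection error, is dictated by the
    constants of the theorem: [2^-1 * c0] times it is the [2 / 3 * c0] that [gronwall_energy]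
    controls. *)
Lemma dist2_uref n : dist2 l (uh rho m n) (uref d tau n) <=
  4 / 3 * dist2 l (uh rho m n) (uhat_h p d M tau n) + 8 * (K2 * h) ^+ 2 * l.
Proof.
rewrite dist2E /dist2 /inner /uref /uh /=.
have be := bm_err_rho n; have bf := bm_err_v n.
have bR : bmeas 0 l (rhat d (t n)) := mixed_lip_bm (rb_rho rb) (tn_ge0 n).
have b1 : bmeas 0 l (rho n \- rhat d (t n)) := bmB (bm_rho n) bR.
have b2 : bmeas 0 l (v n \- vhat d (t n)) := bmB (bm_v n) (bm_vhat n).
have tri (x y e : R) : `|y| <= e -> (x - y) * (x - y) <= 4 / 3 * (x * x) + 4 * e ^+ 2.
  move=> ye; have : y ^+ 2 <= e ^+ 2.
    by rewrite -(real_normK (num_real y)) ler_sqr ?nnegrE// (le_trans _ ye).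
  by have := sqr_ge0 (x + 3 * y); rewrite !expr2; nra.
have key f g a : bmeas 0 l f -> bmeas 0 l g ->
    (forall i x, int i x -> f x = g x - a x /\ `|a x| <= K2 * h) ->
    J (fun x => f x * f x) <= 4 / 3 * J (fun x => g x * g x) + 4 * (K2 * h) ^+ 2 * l.
  move=> bF bG fg.
  apply: (@le_trans _ _ (J (fun x => 4 / 3 * (g x * g x) + 4 * (K2 * h) ^+ 2))).
    apply: le_intg_ae; [by bmeas_tac|by bmeas_tac|].
    by apply: (ae_interior l_gt0 M_gt0) => i x /fg[-> ae]; exact: tri.
  rewrite (intgD (bmZ (4 / 3) (bmM bG bG)) (bm_cst _ _ _)) (intgZ _ (bmM bG bG)).
  by rewrite intg_cst ?(ltW l_gt0)// subr0.
have k1 := key _ _ (fun x => rhat d (t n) x - r n x) b1 be.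
have k2 := key _ _ (fun x => vhat d (t n) x - s n x) b2 bf.
rewrite mulrDr [8 * _ ^+ 2](_ : _ = 4 * (K2 * h) ^+ 2 + 4 * (K2 * h) ^+ 2); last by ring.
rewrite (mulrDl _ _ l) addrACA lerD//; [apply: k1|apply: k2] => i x xI; split.
- by rewrite /err_rho /=; ring.
- exact: (pj_mrho pj M_gt0 xI (tn_ge0 n)).
- by rewrite /err_v /=; ring.
- by have [_ _ []] := pj_mv pj M_gt0 xI (tn_ge0 n) (tn_ge0 n).
Qed.

End ConcreteStep.

(** * Measurement noise *)

Section Noise.
Context {R : realType}.
Local Notation lmu := (@lebesgue_measure R).
Implicit Types (l : R) (f : R -> R).

(* No measurability of f: the integral of a nonnegative function is a supremum
   over simple functions, so it is monotone even without it. *)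
Lemma le_integral_muOmega l (f : R -> \bar R) C : 0 < l -> 0 <= C ->
  (forall x, 0 <= f x)%E -> (forall x, 0 <= x <= l -> (f x <= C%:E)%E) ->
  (\int[muOmega l]_x f x <= (C * l)%:E)%E.
Proof.
move=> l0 C0 f0 fC; have mO := mOmega l.
pose g x : \bar R := if x \in Omega l then C%:E else +oo%E.
have g0 x : (0 <= g x)%E by rewrite /g; case: ifP => _; rewrite ?leey ?lee_fin.
apply: (@le_trans _ _ (\int[muOmega l]_x g x)%E).
  rewrite !ge0_integralTE//; apply: le_ereal_sup => _ [h hf <-]; exists h => // x.
  apply: le_trans (hf x) _; rewrite /g; case: ifPn => xO; last by rewrite leey.
  by apply: fC; move: xO; rewrite inE /Omega /= in_itv.
have mg : measurable_fun [set: measurableTypeR R] g.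
  rewrite -(setUv (Omega l)); apply/measurable_funU => //; first exact: measurableC.
  split; [apply: (eq_measurable_fun (cst C%:E))|apply: (eq_measurable_fun (cst +oo%E))];
    rewrite ?/g// => x; rewrite inE => xO.
    by rewrite mem_set.
  by rewrite memNset.
rewrite (@ge0_negligible_integral _ _ _ (muOmega l) setT (~` Omega l))//; last first.
  by rewrite /= /muOmega /mrestr setICl measure0.
  exact: measurableC.
rewrite setTD setCK.
rewrite (eq_integral (cst C%:E)); last by move=> x xO; rewrite /g xO.
rewrite integral_cst//= /muOmega /mrestr setIid /Omega lebesgue_measure_itv/= lte_fin l0.
by rewrite -EFinB subr0 -EFinM.
Qed.

Lemma N2_le l f B : 0 < l -> 0 <= B -> (forall x, 0 <= x <= l -> `|f x| <= B) ->
  ('N[muOmega l]_2%:E[EFin \o f] <= ((B ^+ 2 * l) `^ 2^-1)%:E)%E.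
Proof.
move=> l0 B0 fB; rewrite unlock /= -poweR_EFin; apply: gt0_ler_poweR => //.
- by rewrite in_itv/= leey andbT integral_ge0// => x _; rewrite lee_fin powR_ge0.
- by rewrite in_itv/= leey andbT lee_fin mulr_ge0 ?sqr_ge0// ltW.
apply: le_integral_muOmega; rewrite ?sqr_ge0// ; rewrite ?sqr_ge0//.
move => x xl; rewrite lee_fin.
rewrite powR_mulrn//.
by rewrite ler_sqr ?nnegrE//; exact: fB.
Qed.


(* The constant depends on the noise: a vanishing norm forces the continuous noise
   to vanish identically, and otherwise its maximum is a multiple of its norm. *)
Lemma noise_bound (p : param R) (d : refdata R) : 0 < ell p -> data_regular p d ->
  exists eta C, [/\ 0 <= eta, 0 < C, eta ^+ 2 <= C * noise_norm2 p d &
    forall t x, 0 <= t -> 0 <= x <= ell p -> `|noise d t x| <= eta].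
Proof.
move=> l0 [_ _ nc [B nB]].
have B0 : 0 <= B.
  by apply: le_trans (nB 0 0 (lexx 0) _) => //; rewrite /Omega /= in_itv/= lexx ltW.
have nB' t x : 0 <= t -> 0 <= x <= ell p -> `|noise d t x| <= B by move=> ? ?; exact: nB.
have N0 : 0 <= noise_norm2 p d by rewrite /noise_norm2 sqr_ge0.
move: N0; rewrite le_eqVlt => /predU1P[N0|N0]; last first.
  exists B, ((B ^+ 2 + 1) / noise_norm2 p d); split => //.
    by rewrite divr_gt0// ltr_wpDl// sqr_ge0.
  by rewrite divfK ?gt_eqF// lerDl.
exists 0, 1; split => //; first by rewrite -N0 expr0n/= mulr0.
have fin : (LinfLp_norm (ell p) 2%:E (noise d) < +oo)%E.
  apply: (@le_lt_trans _ _ ((B ^+ 2 * ell p) `^ 2^-1)%:E); last exact: ltry.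
  apply/ess_supP; exists (~` `[0, +oo[); split.
  - by apply: measurableC; exact: measurable_itv.
  - by rewrite /= /muTime /mrestr setICl measure0.
  move=> t nt /=; rewrite in_itv/= andbT => t0; apply: nt.
  by apply: N2_le => // x xl; exact: nB'.
have le0 : (LinfLp_norm (ell p) 2%:E (noise d) <= 0)%E.
  move: fin N0; rewrite /noise_norm2; case: (LinfLp_norm _ _ _) => [r|//|//] _ /=.
  by move/esym/eqP; rewrite sqrf_eq0 => /eqP ->.
have ae0 : {ae lmu, forall t, 0 <= t ->
    (\int[lmu]_(x in `[0%R, ell p]) (noise d t x ^+ 2)%:E <= 0)%E}.
  apply: (@aeS _ (fun t => 0 <= t -> ('N[muOmega (ell p)]_2%:E[EFin \o noise d t] <= 0%:E)%E)).
    by move=> t h /h /N2_sqr; rewrite expr0n.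
  by apply: ae_muTime; move/ess_supP: le0.
have near_pt t x : 0 <= t -> 0 <= x <= ell p -> forall e, 0 < e -> exists2 k, 0 < k &
    forall s y, 0 <= s -> 0 <= y <= ell p -> `|t - s| < k -> `|x - y| < k ->
      `|noise d t x - noise d s y| < e.
  move=> t0 xl e e0; move/subspace_continuousP: nc => /(_ (t, x) (conj t0 xl)).
  move=> /cvgrPdist_lt /(_ e e0); rewrite near_withinE => /nbhs_ballP[k /= k0 kb].
  exists k => // s y s0 yl ts xy.
  have b1 : ball (t, x) k (s, y) by split.
  have b2 : cylinder (ell p) (s, y) by split.
  exact: (kb (s, y) b1 b2).
have ms t : 0 <= t -> measurable_fun `[0, ell p] (noise d t).
  move=> t0; apply: subspace_continuous_measurable_fun; first exact: measurable_itv.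
  apply/subspace_continuousP => x; rewrite /= in_itv/= => xl.
  apply/cvgrPdist_lt => e e0; have [k k0 kP] := near_pt t x t0 xl e e0.
  rewrite near_withinE; apply/nbhs_ballP; exists k => // y xy; rewrite /= in_itv/= => yl.
  by apply: kP => //; rewrite subrr normr0.
move=> t x t0 xl; rewrite normr_le0; apply/negP => /negP nz.
(* If the noise is nonzero at this point, continuity keeps it above half its size on a
   neighbourhood; a nearby time at which the L2 norm vanishes then gives a contradiction. *)
pose c := `|noise d t x| / 2; have c0 : 0 < c by rewrite divr_gt0// normr_gt0.
have [k k0 kP] := near_pt t x t0 xl c c0.
have k2 : 0 < k / 2 by rewrite divr_gt0.
have [s [s0 ts int0]] := ae_dense ae0 t0 k2.
have bs : bmeas 0 (ell p) (noise d s).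
  by apply: (@bm_ae _ _ _ _ B); [exact: ms|move=> y yl; exact: nB'].
pose u := Num.max 0 (x - k / 2); pose v := Num.min (ell p) (x + k / 2).
have uv : u < v by rewrite /u /v lt_min !gt_max; lra.
have u0 : 0 <= u by rewrite le_max lexx.
have vl : v <= ell p by rewrite ge_min lexx.
have : intg 0 (ell p) (fun y => noise d s y ^+ 2) <= 0.
  move: int0; rewrite /Rintegral /=; case: (integral _ _ _) => [r| |] //=.
have cle : c ^+ 2 * (v - u) <= intg u v (fun y => noise d s y ^+ 2).
  rewrite -intg_cst ?(ltW uv)//; apply: le_intg; [exact: bm_cst|exact/bmX2/(bm_sub u0 vl)|].
  move=> y yuv; have /andP[uy yv] := yuv.
  have yl : 0 <= y <= ell p by rewrite (le_trans u0 uy) (le_trans yv vl).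
  rewrite -[leRHS](real_normK (num_real _)) ler_sqr ?nnegrE ?(ltW c0)//.
  have xy : `|x - y| < k.
    move: yuv; rewrite /u /v ge_max le_min ltr_norml; lra.
  have tk : `|t - s| < k by apply: le_lt_trans ts _; lra.
  have := kP s y s0 yl tk xy; have := ler_normD (noise d t x - noise d s y) (noise d s y).
  by rewrite subrK /c; lra.
have sq0 a b : 0 <= a -> b <= ell p -> 0 <= intg a b (fun y => noise d s y ^+ 2).
  move=> a0 bl; apply: intg_ge0; first exact/bmX2/(bm_sub a0 bl).
  by apply: aeW => y _; rewrite sqr_ge0.
rewrite (intg_split _ _ (bmX2 bs) (c := u)); [|by []|lra].
rewrite (intg_split (ltW uv) vl (bmX2 (bm_sub u0 (lexx _) bs))).
have := sq0 0 u (lexx _) ltac:(lra); have := sq0 v (ell p) ltac:(lra) (lexx _).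
have : 0 < c ^+ 2 * (v - u) by rewrite mulr_gt0 ?subr_gt0// exprn_gt0.
move: cle; move: (intg _ _ _) (intg _ _ _) (intg _ _ _) => I1 I2 I3; lra.
Qed.

End Noise.

(** * Discrete Gronwall argument *)

(* The boundary term [Bd] of the discrete dissipation inequality is absorbed in
   [F n = E n - Bd n + Rb], which lies between [E n / 2] and [3 / 2 * E n + 2 * Rb]; the
   factor [4^-1] on [a2] pays for this loss. *)
Lemma gronwall_energy {R : realFieldType} (E D Bd : nat -> R) (c0 C0 C1 a2 tau Rh Rb : R) :
  0 < c0 -> 0 < C0 -> 0 < C1 -> 0 < a2 -> 0 < tau -> 0 <= Rh -> 0 <= Rb ->
  a2 / c0 < C1 / C0 ->
  (forall n, 0 <= D n) -> (forall n, c0 * D n <= E n <= C0 * D n) ->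
  (forall n, `|Bd n| <= c0 / 2 * D n + Rb) ->
  (forall k, E k.+1 - E k - (Bd k.+1 - Bd k) <=
    tau * (- C1 * D k.+1 + 4^-1 * a2 * D k + Rh)) ->
  let w := (2 + tau * (C1 / C0)) / (2 + tau * (a2 / c0)) in
  forall n, 2 / 3 * c0 * D n <= 2 * C0 * w^-1 ^+ n * D 0%N + 8 / 3 * Rb
    + 8 / 3 * ((Rh + 4 / 3 * (C1 / C0) * Rb) / (C1 / C0 - a2 / c0)).
Proof.
move=> c00 C00 C10 a20 t0 Rh0 Rb0 qp D0 ED BD step w n.
set P := C1 / C0 in qp w *; set q := a2 / c0 in qp w *.
have P0 : 0 < P by rewrite divr_gt0.
have q0 : 0 < q by rewrite divr_gt0.
have tP : 0 < tau * P by rewrite mulr_gt0.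
have tq : 0 < tau * q by rewrite mulr_gt0.
have C1E : C1 = P * C0 by rewrite /P divfK// gt_eqF.
have a2E : a2 = q * c0 by rewrite /q divfK// gt_eqF.
have wV : w^-1 = (2 + tau * q) / (2 + tau * P) by rewrite /w invf_div.
have w0 : 0 < w^-1 by rewrite wV divr_gt0// addr_gt0.
have w1 : w^-1 <= 1.
  by rewrite wV ler_pdivrMr ?addr_gt0// mul1r lerD2l ler_wpM2l// ltW.
pose F k := E k - Bd k + Rb; set R' := Rh + 4 / 3 * P * Rb.
have F_lo k : 2^-1 * E k <= F k.
  have := BD k; rewrite ler_norml => /andP[_]; have /andP[] := ED k; rewrite /F; lra.
have F_hi k : F k <= 3 / 2 * E k + 2 * Rb.
  have := BD k; rewrite ler_norml => /andP[+ _]; have /andP[] := ED k; rewrite /F; lra.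
have F0 k : 0 <= F k.
  by apply: le_trans (F_lo k); have /andP[h _] := ED k; rewrite mulr_ge0// (le_trans _ h)// mulr_ge0// ltW.
(* The fixed point of the affine recursion [Fs], since [1 - w^-1] equals
   [tau * (P - q) / (2 + tau * P)]. *)
pose X := 2 * (R' / (P - q)).
have Fs k : F k.+1 <= w^-1 * F k + (1 - w^-1) * X.
  have s1 : F k.+1 - F k <= tau * (- C1 * D k.+1 + 4^-1 * a2 * D k + Rh).
    by apply: le_trans (step k); rewrite /F; lra.
  (* Passing from [E] to [F] keeps two thirds of the damping, of which [s4] uses one half. The shift
     [2 * Rb] produces the term [4 / 3 * P * Rb] of [R']. *)
  have s2 : 2 / 3 * P * (F k.+1 - 2 * Rb) <= C1 * D k.+1.
    rewrite C1E -(mulrA P) [leLHS](_ : _ = P * (2 / 3 * (F k.+1 - 2 * Rb))); last by ring.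
    rewrite ler_wpM2l ?(ltW P0)//.
    by have := F_hi k.+1; have /andP[_] := ED k.+1; lra.
  have s3 : 4^-1 * a2 * D k <= 2^-1 * q * F k.
    rewrite a2E (_ : 4^-1 * (q * c0) * D k = q * (4^-1 * (c0 * D k))); last by ring.
    rewrite (_ : 2^-1 * q * F k = q * (2^-1 * F k)); last by ring.
    by rewrite ler_wpM2l ?(ltW q0)//; have := F_lo k; have /andP[] := ED k; lra.
  have PF : 0 <= P * F k.+1 by rewrite mulr_ge0// ltW.
  have s4 : F k.+1 - F k <= tau * (- (2^-1 * P * F k.+1) + 2^-1 * q * F k + R').
    apply: le_trans s1 _; rewrite ler_pM2l// /R'.
    by move: s2 s3 PF; clear; lra.
  rewrite wV (_ : (1 - _) * X = 2 * tau * R' / (2 + tau * P)); last first.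
    have n1 : P - q != 0 by rewrite gt_eqF// subr_gt0.
    have n2 : 2 + tau * P != 0 by rewrite gt_eqF// addr_gt0.
    by rewrite /X; field; rewrite n1 n2.
  rewrite mulrAC -mulrDl ler_pdivlMr ?addr_gt0//.
  move: s4; move: (F k.+1) (F k) => f g; nra.
have Fn k : F k <= w^-1 ^+ k * F 0%N + X.
  have X0 : 0 <= X.
    rewrite mulr_ge0// divr_ge0//; last by rewrite subr_ge0 ltW.
    by rewrite addr_ge0// mulr_ge0// mulr_ge0// ltW.
  elim: k => [|k IH]; first by rewrite expr0 mul1r lerDl.
  apply: le_trans (Fs k) _; rewrite exprS -mulrA.
  apply: le_trans (lerD (ler_wpM2l (ltW w0) IH) (lexx _)) _.
  by rewrite le_eqVlt; apply/orP; left; apply/eqP; ring.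
have wn : w^-1 ^+ n <= 1 by rewrite exprn_ile1// ltW.
have wn0 : 0 <= w^-1 ^+ n by rewrite exprn_ge0// ltW.
have r1 : w^-1 ^+ n * F 0%N <= w^-1 ^+ n * (3 / 2 * (C0 * D 0%N)) + 2 * Rb.
  have h1 : F 0%N <= 3 / 2 * (C0 * D 0%N) + 2 * Rb.
    by apply: le_trans (F_hi 0%N) _; have /andP[_] := ED 0%N; lra.
  apply: le_trans (ler_wpM2l wn0 h1) _; rewrite mulrDr lerD2l.
  by apply: ler_piMl => //; rewrite mulr_ge0.
have := Fn n; have := F_lo n; have /andP[+ _] := ED n; rewrite -/R' /X.
rewrite (_ : 2 * C0 * w^-1 ^+ n * D 0%N = 4 / 3 * (w^-1 ^+ n * (3 / 2 * (C0 * D 0%N)))).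
  rewrite -mulrA; move: r1; move: (w^-1 ^+ n * (3 / 2 * _)) (w^-1 ^+ n * F 0%N) (R' / _) (c0 * D n).
  by move=> a b x y; lra.
by field.
Qed.

(** * Choice of the constants *)

Lemma small_velocity {R : realType} (p : param R) (dl : R) : valid_param p -> 0 < dl ->
  exists vs, 0 < vs <= 1 /\ forall vbar, 0 < vbar <= vs ->
  let V := rho_hi p / rho_lo p * vbar in
  [/\ V <= coercivity p / 4,
      V * (2 * gam p * V + muo p + 2 * dl) <= dl * convexity p / 8,
      V * (2 * gam p * V + muo p + 2 * dl) <= muo p * rho_lo p / 8,
      2 * gam p * V <= muo p & gam p * rho_hi p * V <= muo p * rho_lo p / 4].
Proof.
move=> [[l0 g0 mu0] _ [lo0 lohi _ cP0] _ _] dl0.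
have hi0 := lt_trans lo0 lohi.
have cv0 : 0 < convexity p by rewrite divr_gt0.
have co0 : 0 < coercivity p by rewrite lt_min lo0.
(* Once [2 * gam * V <= mu], the bracket in the second and third conditions is at most
   [2 * mu + 2 * dl], and these conditions become linear in [V]. *)
have md : 0 < 2 * muo p + 2 * dl by rewrite addr_gt0// mulr_gt0.
pose a1 := coercivity p / 4; pose a2 := dl * convexity p / 8 / (2 * muo p + 2 * dl).
pose a3 := muo p * rho_lo p / 8 / (2 * muo p + 2 * dl).
pose a4 := muo p / (2 * gam p); pose a5 := muo p * rho_lo p / 4 / (gam p * rho_hi p).
pose A := Num.min a1 (Num.min a2 (Num.min a3 (Num.min a4 a5))).
have A0 : 0 < A by rewrite !lt_min !divr_gt0// ?mulr_gt0.
have q0 : 0 < rho_lo p / rho_hi p by rewrite divr_gt0.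
(* The factor [rho_lo / rho_hi] converts the bound [A] on [V] into one on [vbar]; the entry 1 serves
   the Lipschitz constant [vref_lip]. *)
exists (Num.min 1 (rho_lo p / rho_hi p * A)); split.
  by rewrite lt_min ltr01 mulr_gt0//= ge_min lexx.
move=> vbar /andP[vb0]; rewrite le_min => /andP[_ vbA] V.
have V0 : 0 < V by rewrite mulr_gt0// divr_gt0.
have : V <= A.
  rewrite /V; apply: le_trans (ler_wpM2l _ vbA) _; first by rewrite divr_ge0// ltW.
  by rewrite le_eqVlt; apply/orP; left; apply/eqP; field; rewrite !gt_eqF.
rewrite !le_min => /and5P[V1 V2 V3 V4 V5]; clearbody V.
have V4' : 2 * gam p * V <= muo p.
  by move: V4; rewrite /a4 ler_pdivlMr ?mulr_gt0// mulrC.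
have X : V * (2 * gam p * V + muo p + 2 * dl) <= V * (2 * muo p + 2 * dl).
  by rewrite ler_wpM2l ?(ltW V0)// lerD2r; move: V4'; lra.
split=> //.
- by apply: le_trans X _; rewrite -ler_pdivlMr.
- by apply: le_trans X _; rewrite -ler_pdivlMr.
- by move: V5; rewrite /a5 ler_pdivlMr ?mulr_gt0// mulrC.
Qed.

Lemma sqr_defect_le {R : realFieldType} (x k t h y : R) : 0 <= x -> 0 <= k ->
  (x * t + k * h + y) ^+ 2 <= 3 * ((x + k) ^+ 2 * (t ^+ 2 + h ^+ 2) + y ^+ 2).
Proof.
move=> x0 k0; set a := x * t; set b := k * h.
have s : (a + b + y) ^+ 2 <= 3 * (a ^+ 2 + b ^+ 2 + y ^+ 2).
  rewrite -subr_ge0 (_ : _ - _ = (a - b) ^+ 2 + (a - y) ^+ 2 + (b - y) ^+ 2).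
    by rewrite !addr_ge0// sqr_ge0.
  by ring.
apply: le_trans s _; rewrite ler_pM2l// lerD2r mulrDr /a /b !exprMn lerD//.
  by rewrite ler_wpM2r ?sqr_ge0// ler_sqr ?nnegrE ?addr_ge0// lerDl.
by rewrite ler_wpM2r ?sqr_ge0// ler_sqr ?nnegrE ?addr_ge0// lerDr.
Qed.

Lemma collect_errors {R : realFieldType} (rb s Ca Cb P G h2 Y m e2 Cn nn : R) :
  0 <= rb -> 0 <= s -> 0 <= Cb -> 0 <= P -> 0 < G -> h2 <= Y -> 0 <= m -> e2 <= Cn * nn ->
  8 / 3 * (rb * h2) + 8 / 3 * ((Ca * Y + Cb * (m * e2) + 4 / 3 * P * (rb * h2)) / G) + s * h2
  <= (8 / 3 * rb + s + 8 / 3 * ((Ca + 4 / 3 * P * rb) / G)) * Y + m * (8 / 3 * (Cb * Cn / G)) * nn.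
Proof.
move=> rb0 s0 Cb0 P0 G0 hY m0 eN.
have Gi : 0 <= G^-1 by rewrite invr_ge0 ltW.
have y1 := ler_wpM2l rb0 hY; have y2 := ler_wpM2l s0 hY.
have y3 : P * rb * G^-1 * h2 <= P * rb * G^-1 * Y by rewrite ler_wpM2l// !mulr_ge0.
have y4 : Cb * m * G^-1 * e2 <= Cb * m * G^-1 * (Cn * nn) by rewrite ler_wpM2l// !mulr_ge0.
by move: G^-1 y1 y2 y3 y4 => g y1 y2 y3 y4; lra.
Qed.

(** The constants follow the order of the quantifiers: [delta] against the observer gain and the
    convexity, [vstar] against [delta], [Ctstar] against the damping [C1]. The Lipschitz constants
    [K1], [K2] of the reference solution come later and enter only the remainders [Ca], [Cb] and
    [rb2]; the rates [C1], [a2], [c0] and [C0] are free of them, so the thresholds are uniform over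
    reference solutions. *)
Theorem corollary30 (R : realType) (p : param R) (hp : valid_param p) :
  exists delta0 : R, 0 < delta0 /\ forall delta : R, 0 < delta <= delta0 ->
  exists vstar Ctstar : R, [/\ 0 < vstar, 0 < Ctstar &
  forall vbar Ct : R, 0 < vbar <= vstar -> 0 < Ct <= Ctstar ->
  forall (d : refdata R) (rho v : R -> R -> R),
  reference_solution p d ->
  reference_regular p d ->
  data_regular p d ->
  observer_solution p d rho v ->
  smallness p d v vbar Ct ->
  exists alpha0 : R, 0 < alpha0 /\ forall alpha : R, 0 < alpha <= alpha0 ->
  exists tau0 h0 C1 C2 C3 C4 c0 C0 : R,
    [/\ [/\ 0 < tau0, 0 < h0, 0 < c0 & 0 < C0],
        [/\ 0 < C1, 0 < C2, 0 < C3 & 0 < C4],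
        dissipation_constants p d vbar tau0 h0 delta alpha C1 C2 C3 C4,
        norm_equivalence p d vbar tau0 h0 delta c0 C0 &
        (alpha + tau0) * C2 * c0^-1 < C1 * C0^-1 /\
        exists Ctilde C : R, [/\ 0 < Ctilde, 0 < C &
          forall (M : nat) (tau : R) (rho_h m_h : nat -> R -> R),
          admissible p d vbar tau0 h0 M tau rho_h m_h ->
          forall n : nat,
            2^-1 * c0 * dist2 (ell p) (uh rho_h m_h n) (uref d tau n)
            <= 2 * C0
                 * (\prod_(1 <= j < n.+1)
                      (decay_factor tau tau0 alpha C1 C2 c0 C0)^-1)
                 * dist2 (ell p) (uh rho_h m_h 0%N) (uhat_h p d M tau 0%N)
               + Ctilde * (tau ^+ 2 + mesh (ell p) M ^+ 2)
               + muo p ^+ 2 * C * noise_norm2 p d]]].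

Proof.
have [[l0 g0 mu0] _ [lo0 lohi _ cP0] _ _] := hp.
have [kap [B pb]] := pressure_boundsP hp.
have B0 := pb_B pb; have /andP[kap0 _] := pb_kap pb.
have hi0 := lt_trans lo0 lohi.
have cv0 : 0 < convexity p by rewrite divr_gt0.
have co0 : 0 < coercivity p by rewrite lt_min lo0.
pose q := 8 * muo p ^+ 2 * ell p ^+ 2 / convexity p + rho_hi p.
have q0 : 0 < q by rewrite addr_gt0// divr_gt0// !mulr_gt0// exprn_gt0.
(* The first bound makes the [delta] term subordinate to the relative energy and to the squared
   increments; the second lets the observer damping absorb what the antiderivative test creates in
   the velocity error. *)
exists (Num.min (coercivity p / 4 / ell p) (muo p * rho_lo p / 8 / q)); split.
  by rewrite lt_min !divr_gt0// mulr_gt0.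
move=> dl /andP[dl0]; rewrite le_min (ler_pdivlMr _ _ l0) (ler_pdivlMr _ _ q0) => /andP[dll dlC].
have [vs [/andP[vs0 vs1] vsP]] := small_velocity hp dl0.
pose c0 := coercivity p / 8; pose C0 := rho_hi p + B + cP p.
pose C1 := Num.min (dl * convexity p / 2) (muo p * rho_lo p / 2).
have c00 : 0 < c0 by rewrite divr_gt0.
have C00 : 0 < C0 by rewrite !addr_gt0.
have C10 : 0 < C1 by rewrite lt_min !divr_gt0// mulr_gt0.
(* The threshold for the coefficient of the old error: [a2 < g] is equivalent to
   [a2 / c0 < C1 / C0]. *)
pose g := C1 * c0 / C0; have g00 : 0 < g by rewrite divr_gt0// mulr_gt0.
pose Lc := 1 + B + vref_lip p.
have Lc0 : 0 < Lc.
  by rewrite /Lc /vref_lip !addr_gt0// divr_gt0// ?addr_gt0// exprn_gt0.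
(* With this bound on [Ct] and with [th = g / 16], each of the two summands of [a2] is at most
   [g / 4]. *)
exists vs, (g / (8 * Lc)); split=> //; first by rewrite divr_gt0// mulr_gt0.
move=> vbar Ct vb /andP[Ct0 Ctle] d rho v sol reg dat obs sm.
have [Vc X1 X2 Vmu VD] := vsP vbar vb; have /andP[vb0 vbs] := vb.
have [_ _ rB _] := reg; have [_ vB _] := sm.
have [K1 rb] := reference_boundsP hp sol reg dat sm; have K10 := rb_K rb.
have vb1 : 0 < vbar <= 1 by rewrite vb0 (le_trans vbs).
have [K2 [K20 pj]] := projection_boundsP hp pb rb vb1 Ct0 rB vB.
have [eta [Cn [eta0 Cn0 etaN nB]]] := noise_bound l0 dat.
(* The witness 1 is arbitrary: [alpha] enters only through the scaling of [C2] and [C4]. *)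
exists 1; split=> // alpha /andP[al0 _].
pose th := g / 16; have th0 : 0 < th by rewrite divr_gt0.
(* Four times the coefficient of the old distance in [one_step], divided by [tau]: the Gronwall
   lemma asks for that factor 4. *)
pose a2 := 4 * th + 2 * Lc * Ct; 
have four : (0 : R) < 4 by [].
have two : (0 : R) < 2 by [].
have a20 : 0 < a2.
  exact: addr_gt0 (mulr_gt0 four th0) (mulr_gt0 (mulr_gt0 two Lc0) Ct0).
have a2g : a2 < g.
  have : Lc * Ct <= g / 8.
    by rewrite mulrC -ler_pdivlMr// (le_trans Ctle)// invfM mulrA.
  by rewrite /a2 /th -mulrA; lra.
have a2P : a2 / c0 < C1 / C0.
  by rewrite ltr_pdivrMr// mulrAC.
(* Over one step the projected density then moves by at most [Ct * tau <= kap], within the margin on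
   which the potential stays convex. *)
pose tau0 := kap / Ct; have t00 : 0 < tau0 by rewrite divr_gt0.
have at0 : 0 < alpha + tau0 by rewrite addr_gt0.
have a2E : (alpha + tau0) * (a2 / (alpha + tau0)) = a2 by rewrite mulrC divfK// gt_eqF.
pose V := rho_hi p / rho_lo p * vbar; have V0 : 0 < V by rewrite mulr_gt0// divr_gt0.
(* The coefficient of the mesh size in [momentum_defect], which becomes
   [K1 * tau + kh * h + mu * eta]. *)
pose kh := K2 + gam p * (2 * V * K2) + muo p * (2 * K2).
have kh0 : 0 < kh.
  exact: addr_gt0 (addr_gt0 K20 (mulr_gt0 g0 (mulr_gt0 (mulr_gt0 two V0) K20)))
    (mulr_gt0 mu0 (mulr_gt0 two K20)).
pose CQ := absorption_constant p vbar K1 K2 B dl.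
have CQ0 : 0 <= CQ.
  have sq3 (k a b c : R) : 0 < k -> 0 <= k^-1 * (a ^+ 2 + b ^+ 2 + c ^+ 2).
    by move=> k0; rewrite mulr_ge0 ?invr_ge0 ?(ltW k0)// !addr_ge0 ?sqr_ge0.
  have k1 : 0 < 4 * (dl * convexity p / 24) by rewrite mulr_gt0// divr_gt0// mulr_gt0.
  have k2 : 0 < 4 * (muo p * rho_lo p / 24) by rewrite mulr_gt0// divr_gt0// mulr_gt0.
  have k3 : 0 <= 2 * dl * ell p ^+ 2 / convexity p.
    by rewrite divr_ge0 ?(ltW cv0)// mulr_ge0 ?sqr_ge0// mulr_ge0// ltW.
  exact: addr_ge0 (addr_ge0 (addr_ge0 (sq3 _ _ _ _ k1) (sq3 _ _ _ _ k2)) k3) (sqr_ge0 _).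
(* The added 1 here and in [Cb] only secures strict positivity. *)
pose Ca := (CQ * (1 + 3 * (K1 + kh) ^+ 2) + (4 * th)^-1 * K2 ^+ 2) * ell p + 1.
pose Cb := 3 * CQ * ell p + 1.
have Ca0 : 0 < Ca.
  rewrite ltr_wpDl// mulr_ge0 ?(ltW l0)// addr_ge0//.
    by rewrite mulr_ge0// addr_ge0// mulr_ge0// sqr_ge0.
  by rewrite mulr_ge0 ?sqr_ge0// invr_ge0 mulr_ge0// ltW.
have Cb0 : 0 < Cb by rewrite ltr_wpDl// mulr_ge0 ?(ltW l0)// mulr_ge0.
pose Rh tau h := Ca * (tau ^+ 2 + h ^+ 2) + Cb * (muo p ^+ 2 * eta ^+ 2).
have defect M tau : (CQ * (tau ^+ 2 + mesh (ell p) M ^+ 2 +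
      momentum_defect p M tau vbar K1 K2 eta ^+ 2) + (4 * th)^-1 * (K2 * mesh (ell p) M) ^+ 2) * ell p
    <= Rh tau (mesh (ell p) M).
  set h := mesh _ _; rewrite (_ : momentum_defect _ _ _ _ _ _ _ = K1 * tau + kh * h + muo p * eta).
    have h2 : (4 * th)^-1 * (K2 * h) ^+ 2 <= (4 * th)^-1 * K2 ^+ 2 * (tau ^+ 2 + h ^+ 2).
      rewrite exprMn mulrA ler_wpM2l ?lerDr ?sqr_ge0//.
      by rewrite mulr_ge0 ?sqr_ge0// invr_ge0 mulr_ge0// ltW.
    have := sqr_defect_le tau h (muo p * eta) (ltW K10) (ltW kh0).
    rewrite [(muo p * eta) ^+ 2]exprMn => /(ler_wpM2l CQ0) om.
    have Y0 : 0 <= tau ^+ 2 + h ^+ 2 by rewrite addr_ge0 ?sqr_ge0.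
    have e0 : 0 <= muo p ^+ 2 * eta ^+ 2 by rewrite mulr_ge0 ?sqr_ge0.
    have := ler_wpM2r (ltW l0) (lerD om h2); move: Y0 e0; rewrite /Rh /Ca /Cb; clear.
    move: (muo p ^+ 2 * _) (tau ^+ 2 + _) ((K1 * tau + _ + _) ^+ 2)
      ((4 * th)^-1 * (K2 * h) ^+ 2) ((4 * th)^-1 * K2 ^+ 2) ((K1 + kh) ^+ 2).
    by move=> m Y o z y k Y0 m0 hl; lra.
  by rewrite /momentum_defect /kh -/V -/h; ring.
have D0 M tau rh mh n : 0 <= dist2 (ell p) (uh rh mh n) (uhat_h p d M tau n).
  by rewrite addr_ge0//; apply: fine_ge0; apply: integral_ge0 => x _; rewrite lee_fin -expr2 sqr_ge0.
pose Bd M tau (rh : nat -> R -> R) n := inner (ell p)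
  (hhat p d (n%:R * tau) \- hhat_h p d M tau n) ((uh rh rh n).1 \- (uhat_h p d M tau n).1).
have step M tau rh mh : admissible p d vbar tau0 1 M tau rh mh -> forall k,
    mod_energy p dl (uh rh mh k.+1) (uhat_h p d M tau k.+1)
    - mod_energy p dl (uh rh mh k) (uhat_h p d M tau k) - (Bd M tau rh k.+1 - Bd M tau rh k)
    <= tau * (- C1 * dist2 (ell p) (uh rh mh k.+1) (uhat_h p d M tau k.+1)
      + 4^-1 * a2 * dist2 (ell p) (uh rh mh k) (uhat_h p d M tau k)
      - 2^-1 * dissipation p (uh rh mh k.+1) (uhat_h p d M tau k.+1) + Rh tau (mesh (ell p) M)).
  move=> [M0 _ /andP[tau_gt0 tau_le] sch dbd] k.
  have Ctk : Ct * tau <= kap by rewrite mulrC -ler_pdivlMr.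
  have vB' t x : 0 <= t -> 0 <= x <= ell p -> `|vhat d t x| <= vbar by move=> ? ?; exact: vB.
  have nI i x : interior_point (ell p) M i x ->
      `|Ih (ell p) M (noise d (k.+1%:R * tau)) x| <= eta.
    move=> xI; rewrite -[X in `|X|]subr0; apply: (Ih_dist l0 M0 xI) => y yI.
    rewrite subr0; apply: nB; first by rewrite mulr_ge0// ltW.
    exact: (interior_sub l0 M0 xI yI).
  have := one_step hp pb rb pj M0 tau_gt0 sch dbd vB' K20 dl0 th0 eta0 dll Vc Ctk
    (ltW Ct0) X1 X2 Vmu VD dlC nI.
  move=> /le_trans; apply; rewrite (dist2E p d M tau rh mh k.+1).
  have De := D0 M tau rh mh k; have dM := defect M tau.
  set e2 := Rintegral _ _ _; set f2 := Rintegral _ _ _.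
  have e20 : 0 <= e2 by apply: fine_ge0; apply: integral_ge0 => x _; rewrite lee_fin -expr2 sqr_ge0.
  have f20 : 0 <= f2 by apply: fine_ge0; apply: integral_ge0 => x _; rewrite lee_fin -expr2 sqr_ge0.
  have m1 : C1 * e2 <= dl * convexity p / 2 * e2 by rewrite ler_wpM2r// ge_min lexx.
  have m2 : C1 * f2 <= muo p * rho_lo p / 2 * f2 by rewrite ler_wpM2r// ge_min lexx orbT.
  rewrite [X in _ + X * dist2 _ _ _](_ : _ = tau * (4^-1 * a2)); last first.
    by rewrite /a2 /Lc; field.
  rewrite -[tau * (4^-1 * a2) * _]mulrA -mulrDr ler_pM2l//.
  move: De dM m1 m2; rewrite -/CQ; clear.
  move: (dist2 _ _ _) (dissipation _ _ _) (Rh _ _) ((CQ * _ + _) * _) (dl * _ / 2) (muo p * _ / 2).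
  by move=> D di rr cc u w D0 dM m1 m2; lra.
pose rb2 := (4 * (c0 / 2))^-1 * K2 ^+ 2 * ell p; pose G := C1 / C0 - a2 / c0.
have G0 : 0 < G by rewrite subr_gt0.
have K22 : 0 < K2 ^+ 2 by rewrite exprn_gt0.
have rb0 : 0 < rb2 by rewrite !mulr_gt0// invr_gt0 mulr_gt0// divr_gt0.
have P0 : 0 < C1 / C0 by rewrite divr_gt0.
(* [C2] is normalised so that [(alpha + tau0) * C2 = a2], and the factor [alpha] in [C4] cancels the
   division by [alpha]; the decay factor thus depends on [a2] alone. [Cn] converts the pointwise
   noise bound into the norm. *)
exists tau0, 1, C1, (a2 / (alpha + tau0)), Ca, (alpha * (Cb * Cn)), c0, C0; split.
- by split.
- by split=> //; [rewrite divr_gt0|rewrite !mulr_gt0].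
- move=> M tau rh mh adm [//|k] _ /=; have [_ _ /andP[tau_gt0 _] _ _] := adm.
  rewrite -lerBlDr /bdiff /= -mulrBl ler_pdivrMr// [leRHS]mulrC.
  apply: le_trans (step M tau rh mh adm k) _; rewrite ler_pM2l// a2E.
  rewrite [muo p ^+ 2 * _ / alpha](_ : _ = Cb * (muo p ^+ 2 * Cn)); last first.
    by field; rewrite gt_eqF.
  have De := D0 M tau rh mh k; have aD := mulr_ge0 (ltW a20) De.
  have Y0 : 0 <= tau ^+ 2 + mesh (ell p) M ^+ 2 by rewrite addr_ge0 ?sqr_ge0.
  have aY : 0 <= alpha^-1 * (tau ^+ 2 + mesh (ell p) M ^+ 2) * Ca.
    by rewrite !mulr_ge0// ?invr_ge0 ltW.
  have eN : Cb * (muo p ^+ 2 * eta ^+ 2) <= Cb * (muo p ^+ 2 * Cn) * noise_norm2 p d.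
    by rewrite -!mulrA !ler_wpM2l ?sqr_ge0// ltW.
  rewrite /Rh; move: aD aY eN; clear.
  move: (dist2 _ _ _) (dist2 _ _ _) (dissipation _ _ _) (tau ^+ 2 + _) (Cb * _) (Cb * _ * _).
  by move=> D' D di Y u w aD aY eN; lra.
- move=> M tau rh mh [M0 _ /andP[tau_gt0 _] sch dbd] n.
  exact: (mod_energy_bounds hp pb pj M0 tau_gt0 sch dbd n dl0 dll Vc).
split; first by rewrite a2E.
exists (8 / 3 * rb2 + 4 * c0 * K2 ^+ 2 * ell p + 8 / 3 * ((Ca + 4 / 3 * (C1 / C0) * rb2) / G)),
  (8 / 3 * (Cb * Cn / G)); split.
- have r83 : (0 : R) < 8 / 3 by rewrite divr_gt0.
  have r43 : (0 : R) < 4 / 3 by rewrite divr_gt0.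
  exact: addr_gt0 (addr_gt0 (mulr_gt0 r83 rb0) (mulr_gt0 (mulr_gt0 (mulr_gt0 four c00) K22) l0))
    (mulr_gt0 r83 (divr_gt0 (addr_gt0 Ca0 (mulr_gt0 (mulr_gt0 r43 P0) rb0)) G0)).
- by rewrite mulr_gt0// divr_gt0// mulr_gt0.
move=> M tau rh mh adm n; have [M0 _ /andP[tau_gt0 _] sch dbd] := adm.
set h := mesh (ell p) M.
have c02 : 0 < c0 / 2 by rewrite divr_gt0.
have RbE : (4 * (c0 / 2))^-1 * (K2 * h) ^+ 2 * ell p = rb2 * h ^+ 2 by rewrite /rb2; ring.
have Bdle k : `|Bd M tau rh k| <= c0 / 2 * dist2 (ell p) (uh rh mh k) (uhat_h p d M tau k)
    + rb2 * h ^+ 2.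
  by rewrite -RbE; exact: (consistency_le hp rb pj M0 tau_gt0 sch k K20 c02).
have Y0 := addr_ge0 (sqr_ge0 tau) (sqr_ge0 h); have mu20 := sqr_ge0 (muo p).
have Rh0 : 0 <= Rh tau h.
  exact: addr_ge0 (mulr_ge0 (ltW Ca0) Y0) (mulr_ge0 (ltW Cb0) (mulr_ge0 mu20 (sqr_ge0 eta))).
have Rb0 : 0 <= rb2 * h ^+ 2 by rewrite mulr_ge0 ?sqr_ge0// ltW.
have stepG k : mod_energy p dl (uh rh mh k.+1) (uhat_h p d M tau k.+1)
    - mod_energy p dl (uh rh mh k) (uhat_h p d M tau k) - (Bd M tau rh k.+1 - Bd M tau rh k)
    <= tau * (- C1 * dist2 (ell p) (uh rh mh k.+1) (uhat_h p d M tau k.+1)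
      + 4^-1 * a2 * dist2 (ell p) (uh rh mh k) (uhat_h p d M tau k) + Rh tau h).
  apply: le_trans (step M tau rh mh adm k) _; rewrite ler_pM2l// lerD2r gerBl.
  by rewrite mulr_ge0//; exact: (dissipation_ge0 hp pj M0 tau_gt0 sch).
have gw := gronwall_energy c00 C00 C10 a20 tau_gt0 Rh0 Rb0 a2P (D0 M tau rh mh)
  (fun k => mod_energy_bounds hp pb pj M0 tau_gt0 sch dbd k dl0 dll Vc) Bdle stepG n.
(* The decay factor does not depend on the index, so the product is the [n]-th power of the Gronwall
   lemma. *)
rewrite prodr_const_nat subn1 /= /decay_factor a2E.
have hY : h ^+ 2 <= tau ^+ 2 + h ^+ 2 by rewrite lerDr sqr_ge0.
have s0 : 0 <= 4 * c0 * K2 ^+ 2 * ell p by rewrite ltW// (mulr_gt0 _ l0)// mulr_gt0// mulr_gt0.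
have ce := collect_errors Ca (ltW rb0) s0 (ltW Cb0) (ltW P0) G0 hY mu20 etaN.
have dr := dist2_uref hp rb pj M0 tau_gt0 sch n.
apply: le_trans (ler_wpM2l _ dr) _; first by rewrite mulr_ge0// ltW.
rewrite [leLHS](_ : _ = 2 / 3 * c0 * dist2 (ell p) (uh rh mh n) (uhat_h p d M tau n)
  + 4 * c0 * K2 ^+ 2 * ell p * h ^+ 2); last by rewrite /h; field.
apply: le_trans (lerD gw (lexx _)) _.
by rewrite -[X in X + _ <= _]addrA -[leLHS]addrA -[leRHS]addrA lerD2l.
Qed.
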